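(* There exist a universal constant $C>0$ and, for each $p\ge 2$, a universal constant $C_p>0$ (depending only on $p$) such that for every finite simple graph $G=(V,E)$ with $V=\{1,\dots,n\}$, every $p\ge1$ and every $k\in\{1,\dots,n\}$, the following inequalities hold: (i) $2^{p-1}\hat h_k^-\le 2^{p-1}\hat h_k\le 2^{p-1}\hat h_k^+\le 2^{p-1}h_k$; (ii) $\lambda_k^-(\Delta_p)\le\lambda_k(\Delta_p)\le\lambda_k^+(\Delta_p)$; (iii) $\lambda_k^-(\Delta_p)\le 2^{p-1}\hat h_k^-$, $\ \lambda_k(\Delta_p)\le 2^{p-1}\hat h_k$, $\ \lambda_k^+(\Delta_p)\le 2^{p-1}\hat h_k^+$; (iv) $\frac{2^{p-1}}{p^p}(\hat h_k^-)^p\le\lambda_k^-(\Delta_p)$, $\ \frac{2^{p-1}}{p^p}\hat h_k^p\le\lambda_k(\Delta_p)$, $\ \frac{2^{p-1}}{p^p}(\hat h_k^+)^p\le\lambda_k^+(\Delta_p)$, and $\frac{2^{p-1}}{p^p}(\hat h_k^-)^p\le\frac{2^{p-1}}{p^p}\hat h_k^p\le\frac{2^{p-1}}{p^p}(\hat h_k^+)^p$; (v) $\frac{2^{p-1}}{p^p}(h_{s_k^-})^p\le\lambda_k^-(\Delta_p)$, $\ \frac{2^{p-1}}{p^p}(h_{s_k})^p\le\lambda_k(\Delta_p)$, $\ \frac{2^{p-1}}{p^p}(h_{s_k^+})^p\le\lambda_k^+(\Delta_p)$, and $\frac{2^{p-1}}{p^p}(h_{s_k^-})^p\le\frac{2^{p-1}}{p^p}(h_{s_k})^p\le\frac{2^{p-1}}{p^p}(h_{s_k^+})^p$;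 (vi) $\lambda_k^-(\Delta_p)\ge\dfrac{h_k^2}{Ck^4}$ if $p\le2$, and $\lambda_k^-(\Delta_p)\ge\dfrac{h_k^p}{C_pk^{2p}}$ if $p\ge2$. Here $$s_k=\max_{x\in\bigcup_{q\in[1,p]}\mathsf S_k(\Delta_q)}\mathfrak S(x),\qquad s_k^\pm=\max_{x\in\bigcup_{q\in[1,p]}\mathsf S_k^\pm(\Delta_q)}\mathfrak S(x),$$ where $\mathfrak S(x)$ is the number of strong nodal domains of $x$, $\mathsf S_k(\Delta_q)$ is the set of all $x\ne0$ that are eigenvectors of $\Delta_q$ for some eigenvalue $\lambda\le\lambda_k(\Delta_q)$, and $\mathsf S_k^\pm(\Delta_q)$ is the set of all $x\ne0$ that are eigenvectors of $\Delta_q$ for some eigenvalue $\lambda\le\lambda_k^\pm(\Delta_q)$.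
   Context: Every vertex has degree $\deg(i)\ge1$. For $A\subset V$: $\mathrm{vol}(A)=\sum_{i\in A}\deg(i)$, and $|\partial A|$ is the number of edges connecting $A$ and $V\setminus A$. $p$-Laplacian. For $p>1$, $(\Delta_p x)_i=\sum_{j:\{i,j\}\in E}|x_i-x_j|^{p-2}(x_i-x_j)$ (with $|0|^{p-2}0=0$); $(\lambda,x)$, $x\neq0$, is an eigenpair of $\Delta_p$ if $(\Delta_p x)_i=\lambda\deg(i)|x_i|^{p-2}x_i$ for all $i$. For $p=1$, $(\lambda,x)$, $x\ne0$, is an eigenpair of $\Delta_1$ if there are $z_{ij}\in\mathrm{Sgn}(x_i-x_j)$, $z_{ij}=-z_{ji}$ ($\{i,j\}\in E$), with $\sum_{j:\{i,j\}\in E}z_{ij}\in\lambda\deg(i)\,\mathrm{Sgn}(x_i)$ for all $i$, where $\mathrm{Sgn}(t)=\{1\}$ if $t>0$, $[-1,1]$ if $t=0$, $\{-1\}$ if $t<0$. $F_p(x)=\frac{\sum_{\{i,j\}\in E}|x_i-x_j|^p}{\sum_{i\in V}\deg(i)|x_i|^p}$ for $x\ne0$. The strong nodal domains of $x$ are the connected components of the subgraphs induced by $\{i:x_i>0\}$ and by $\{i:x_i<0\}$. Indices. Let $S\subset\mathbb R^n\setminus\{0\}$ be compact and centrally symmetric ($-S=S$); all indices below are $0$ if $S=\varnothing$ or if $S$ is not centrally symmetric. $\gamma^-(S)$ (Krasnoselskii genus) is the least $k\ge1$ for which there is an odd continuous map $S\to\mathbb S^{k-1}$. $\gamma^+(S)$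 is the largest $k\ge1$ for which there is an odd continuous map $\mathbb S^{k-1}\to S$. Yang index $\gamma(S)$: let $C_*(S)$ be the singular chain complex with $\mathbb Z_2$ coefficients, $T$ the chain map induced by $x\mapsto -x$, $C_*(S,-)=\{c: Tc=c\}$ the subcomplex of symmetric chains, with cycles $Z_q(S,-)$ and homology $H_q(S,-)$. Define homomorphisms $\nu:Z_q(S,-)\to\mathbb Z_2$ inductively: writing $z=c+Tc$, $\nu(z)=\mathrm{In}(c)$ if $q=0$ (where $\mathrm{In}(\sum n_i\sigma_i)=\sum n_i$ mod 2) and $\nu(z)=\nu(\partial c)$ if $q\ge1$. This is well defined, vanishes on boundaries and induces $\nu_*:H_q(S,-)\to\mathbb Z_2$. Then $\gamma(S)=\min\{k\in\mathbb Z^+:\nu_*H_k(S,-)=0\}$. Min-max eigenvalues: $\lambda_k(\Delta_p)=\inf_{\gamma(S)\ge k}\sup_{x\in S}F_p(x)$, $k=1,\dots,n$, the infimum over compact centrally symmetric $S\subset\mathbb R^n\setminus\{0\}$; $\lambda_k^\pm(\Delta_p)$ are defined in the same way with $\gamma^\pm$ in place of $\gamma$. Cheeger constants. $h_k=\min_{A_1,\dots,A_k}\max_{1\le i\le k}\frac{|\partial A_i|}{\mathrm{vol}(A_i)}$, the minimum over non-empty pairwise disjoint $A_1,\dots,A_k\subset V$. Let $\mathcal P_2(V)=\{(A,B):A,B\subset V,A\cap B=\varnothing,A\cup B\ne\varnothing\}$, partially ordered by $(A,B)\prec(A',B')$ iff $A\subset A'$ and $B\subset B'$, and let $K_n$ be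 its order complex; its geometric realization $|K_n|=\{x\in\mathbb R^n:\|x\|_\infty=1\}$ has the vertex $\mathbf 1_A-\mathbf 1_B$ for $(A,B)$ and the simplices $\mathrm{conv}\{\mathbf 1_{A_1}-\mathbf 1_{B_1},\dots,\mathbf 1_{A_m}-\mathbf 1_{B_m}\}$ for chains $(A_1,B_1)\prec\cdots\prec(A_m,B_m)$. For $\mathcal A\subset\mathcal P_2(V)$, the subcomplex of $K_n$ induced by $\mathcal A$ is the order complex of $(\mathcal A,\prec)$, whose simplices are the chains in $\mathcal A$; its index ($\gamma$, $\gamma^-$ or $\gamma^+$) is that of its geometric realization in $|K_n|$ (being $0$ if this is not centrally symmetric). Let $\mathcal S_k$ (resp. $\mathcal S_k^-$, $\mathcal S_k^+$) be the collection of all $\mathcal A\subset\mathcal P_2(V)$ whose induced subcomplex has $\gamma$ (resp. $\gamma^-$, $\gamma^+$) at least $k$. Then $$\hat h_k=\min_{\mathcal A\in\mathcal S_k}\max_{(A,B)\in\mathcal A}\frac{|\partial A|+|\partial B|}{\mathrm{vol}(A\cup B)},$$ and $\hat h_k^\pm$ are defined in the same way with $\mathcal S_k^\pm$ in place of $\mathcal S_k$. *)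

(* Defs.v *)
From HB Require Import structures.
From mathcomp.multinomials Require Import freeg.
From mathcomp Require Import all_boot all_order all_algebra.
From mathcomp Require Import all_classical all_reals all_analysis.

Set Implicit Arguments.
Unset Strict Implicit.
Unset Printing Implicit Defensive.

Import Order.TTheory GRing.Theory Num.Theory.
Import numFieldNormedType.Exports.

Local Open Scope classical_set_scope.
Local Open Scope ring_scope.

(* Minimum and maximum of a set of natural numbers. They take the value 0 when
   there is none, which does not happen in the situations considered below. *)
Definition nat_min (P : set nat) : nat :=
  xget 0%N [set k | P k /\ forall j, P j -> (k <= j)%N].

Definition nat_max (P : set nat) : nat :=
  xget 0%N [set k | P k /\ forall j, P j -> (j <= k)%N].

Section Graph.
Variables (R : realType) (n : nat).
(* The edge {i, j} is present when E i j; E is meant to be symmetric and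
   irreflexive. *)
Variable E : rel 'I_n.

Definition deg (i : 'I_n) : nat := #|[pred j | E i j]|.

Definition vol (A : {set 'I_n}) : nat := (\sum_(i in A) deg i)%N.

(* Each edge leaving A is counted once, as (endpoint in A, endpoint outside). *)
Definition cut (A : {set 'I_n}) : nat :=
  #|[pred u : 'I_n * 'I_n | [&& E u.1 u.2, u.1 \in A & u.2 \notin A]]|.

(* An unordered edge {i, j} is represented by its ordering i < j. *)
Definition Rayleigh (p : R) (x : 'rV[R]_n) : R :=
  (\sum_(i < n) \sum_(j < n | (i < j)%N && E i j)
     `|x ord0 i - x ord0 j| `^ p)
  / (\sum_(i < n) (deg i)%:R * `|x ord0 i| `^ p).

(* phi p t = |t|^(p-2) t; since 0 * _ = 0, phi p 0 = 0 for every p. *)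
Definition phi (p t : R) : R := `|t| `^ (p - 2) * t.

Definition Laplacian (p : R) (x : 'rV[R]_n) (i : 'I_n) : R :=
  \sum_(j < n | E i j) phi p (x ord0 i - x ord0 j).

Definition Sgn (t : R) : set R :=
  if 0 < t then [set 1] else if t < 0 then [set -1] else [set s | -1 <= s <= 1].

Definition eigenpair1 (lam : R) (x : 'rV[R]_n) : Prop :=
  x <> 0 /\
  exists z : 'I_n -> 'I_n -> R,
    (forall i j, E i j ->
       Sgn (x ord0 i - x ord0 j) (z i j) /\ z i j = - z j i) /\
    (forall i, exists2 s, Sgn (x ord0 i) s &
       \sum_(j < n | E i j) z i j = lam * (deg i)%:R * s).

Definition eigenpair_gt1 (p lam : R) (x : 'rV[R]_n) : Prop :=
  x <> 0 /\
  forall i, Laplacian p x i = lam * (deg i)%:R * phi p (x ord0 i).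

(* Meant for p >= 1. *)
Definition eigenpair (p lam : R) (x : 'rV[R]_n) : Prop :=
  if p == 1 then eigenpair1 lam x else eigenpair_gt1 p lam x.

(* Each relation is the adjacency of an induced subgraph, extended to all
   vertices by isolated points; n_comp counts its components inside the second
   argument. *)
Definition pos_adj (x : 'rV[R]_n) : rel 'I_n :=
  [rel i j | [&& E i j, 0 < x ord0 i & 0 < x ord0 j]].

Definition neg_adj (x : 'rV[R]_n) : rel 'I_n :=
  [rel i j | [&& E i j, x ord0 i < 0 & x ord0 j < 0]].

Definition nodal_domains (x : 'rV[R]_n) : nat :=
  (n_comp (pos_adj x) [pred i | (0 < x ord0 i)%R]
   + n_comp (neg_adj x) [pred i | (x ord0 i < 0)%R])%N.

End Graph.

Section SingularChains.
Variables (R : realType) (n : nat).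
Notation Rn := 'rV[R]_n.

Definition std_simplex (q : nat) : set 'rV[R]_q.+1 :=
  [set t | (forall i, 0 <= t ord0 i) /\ \sum_i t ord0 i = 1].

Arguments std_simplex q : clear implicits.

Definition singular (q : nat) : Type :=
  continuousType (set_type (std_simplex q)) Rn.

HB.instance Definition _ q := Choice.on (singular q).

(* Singular chains of the whole of R^n; those of S form the subgroup chain_in S
   spanned by the simplices with image in S. *)
Definition chain (q : nat) : Type := {freeg (singular q) / 'F_2}.

HB.instance Definition _ q := GRing.Lmodule.on (chain q).

Definition chain_in (S : set Rn) q (c : chain q) : Prop :=
  forall sg : singular q, sg \in freeg.dom c -> forall t, S (sg t).

Definition face_fun q (i : 'I_q.+2) (t : 'rV[R]_q.+1) : 'rV[R]_q.+2 :=
  \row_j (if unlift i j is Some k then t ord0 k else 0).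

Lemma face_in q (i : 'I_q.+2) (t : set_type (std_simplex q)) :
  face_fun i (set_val t) \in std_simplex q.+1.
Proof.
have [t0 t1] : std_simplex q (set_val t) by exact: set_valP.
rewrite inE; split=> [j|].
  by rewrite mxE; case: unliftP.
rewrite (bigD1_ord i) //= mxE unlift_none add0r -[RHS]t1.
by apply: eq_bigr => j _; rewrite mxE liftK.
Qed.

Definition face q (i : 'I_q.+2) (t : set_type (std_simplex q)) :
  set_type (std_simplex q.+1) := SigSub (face_in i t).

Lemma face_continuous q (i : 'I_q.+2) : continuous (@face q i).
Proof.
apply: continuous_comp_initial => t.
apply: (@continuous_comp _ _ _ set_val (@face_fun q i)).
  exact: initial_continuous.
move=> A [P Pt PA]; exists (fun r k => P r (lift i k)) => [r k|u uP].
  by rewrite [r]ord1; move: (Pt ord0 (lift i k)); rewrite mxE liftK.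
apply: PA => r j; rewrite [r]ord1 mxE; case: unliftP => [k ->|jE].
  exact: uP.
by apply: nbhs_singleton; move: (Pt ord0 j); rewrite mxE jE unlift_none.
Qed.

HB.instance Definition _ q i :=
  @isContinuous.Build _ _ (@face q i) (@face_continuous q i).

Definition antipode (x : Rn) : Rn := - x.

Lemma antipode_continuous : continuous antipode.
Proof. exact: opp_continuous. Qed.

HB.instance Definition _ := @isContinuous.Build _ _ antipode antipode_continuous.

Definition bd q : chain q.+1 -> chain q :=
  fglift (fun sg : singular q.+1 =>
            \sum_(i < q.+2) (<< (sg \o @face q i : singular q) >> : chain q)).

Definition chain_antipode q : chain q -> chain q :=
  fglift (fun sg : singular q => << (antipode \o sg : singular q) >> : chain q).

Definition augmentation : chain 0 -> 'F_2 := fglift (fun=> (1 : ('F_2)^o)).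

Definition is_cycle q : chain q -> Prop :=
  match q with 0 => fun=> True | q'.+1 => fun z => bd z = 0 end.

(* C_q(S,-), Z_q(S,-), B_q(S,-) and H_q(S,-), whose elements are the cosets of
   B_q(S,-) in Z_q(S,-). *)
Definition Csym (S : set Rn) q : set (chain q) :=
  [set c | chain_in S c /\ chain_antipode c = c].
Definition Zsym (S : set Rn) q : set (chain q) :=
  [set z | Csym S z /\ is_cycle z].
Definition Bsym (S : set Rn) q : set (chain q) :=
  [set bd c | c in @Csym S q.+1].
Definition Hsym (S : set Rn) q : set (set (chain q)) :=
  [set [set z' | Zsym S z' /\ Bsym S (z' - z)] | z in @Zsym S q].

(* Some chain c of S with z = c + Tc; one exists for every symmetric chain z when
   S does not contain 0, and nu does not depend on the choice for cycles z. *)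
Definition half (S : set Rn) q (z : chain q) : chain q :=
  xget 0 [set c | chain_in S c /\ z = c + chain_antipode c].

Fixpoint nu (S : set Rn) q : chain q -> 'F_2 :=
  match q with
  | 0 => fun z => augmentation (half S z)
  | q'.+1 => fun z => nu S (bd (half S z))
  end.

(* nu of a representative of the class h. *)
Definition nu_star (S : set Rn) q (h : set (chain q)) : 'F_2 :=
  nu S (xget 0 h).

End SingularChains.

Section Indices.
Variables (R : realType) (n : nat).
Notation Rn := 'rV[R]_n.
Implicit Type S : set Rn.

Definition centrally_symmetric S : Prop := forall x, S x -> S (- x).

(* The unit sphere of R^k for the Euclidean norm (the norm of the library on
   'rV[R]_k is the sup norm). *)
Definition sphere k : set 'rV[R]_k := [set x | \sum_i x ord0 i ^+ 2 = 1].

Definition odd_map m1 m2 (A : set 'rV[R]_m1) (B : set 'rV[R]_m2)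
    (f : 'rV[R]_m1 -> 'rV[R]_m2) : Prop :=
  [/\ {within A, continuous f}, (forall x, A x -> B (f x)) &
      forall x, A x -> f (- x) = - f x].

Definition index_or0 S (i : nat) : nat :=
  if `[< S !=set0 /\ centrally_symmetric S >] then i else 0%N.

Definition genus_minus S : nat := index_or0 S
  (nat_min [set k | (1 <= k)%N /\ exists f, odd_map S (@sphere k) f]).

Definition genus_plus S : nat := index_or0 S
  (nat_max [set k | (1 <= k)%N /\ exists f, odd_map (@sphere k) S f]).

Definition yang S : nat := index_or0 S
  (nat_min [set k | (1 <= k)%N /\ forall h, @Hsym R n S k h -> nu_star S h = 0]).

End Indices.

Section Constants.
Variables (R : realType) (n : nat) (E : rel 'I_n).
Notation Rn := 'rV[R]_n.

(* inf and sup are those of the reals: 0 <= Rayleigh <= 2^(p-1) on R^n \ {0} for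
   p >= 1, so all the sets involved are bounded. *)
Definition minmax (ind : set Rn -> nat) (p : R) (k : nat) : R :=
  inf [set sup [set Rayleigh E p x | x in S] | S in
    [set S : set Rn | [/\ compact S, centrally_symmetric S, ~ S 0 &
                          (k <= ind S)%N]]].

(* inf of a finite set, hence a minimum, nonempty when k <= n; the ratios are
   nonnegative, so 0 is neutral in the maximum. *)
Definition cheeger (k : nat) : R :=
  inf [set \big[Num.max/0]_(i < k) ((cut E (A i))%:R / (vol E (A i))%:R) |
    A in [set A : 'I_k -> {set 'I_n} |
      (forall i, A i != finset.set0) /\
      (forall i j, i != j -> (A i :&: A j)%SET = finset.set0)]].

Notation spair := ({set 'I_n} * {set 'I_n})%type.

Definition P2 : {set spair} :=
  [set u : spair | (u.1 :&: u.2 == finset.set0) && (u.1 :|: u.2 != finset.set0)]%SET.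

Definition prec (u v : spair) : bool :=
  (u.1 \subset v.1) && (u.2 \subset v.2).

Definition is_chain (c : {set spair}) : bool :=
  [forall u in c, [forall v in c, prec u v || prec v u]].

Definition vertex (u : spair) : Rn :=
  \row_i ((i \in u.1)%:R - (i \in u.2)%:R).

(* Union of the simplices conv {vertex u | u in c}, for c a chain in AA. *)
Definition realization (AA : {set spair}) : set Rn :=
  [set x | exists2 c : {set spair}, (c \subset AA) && is_chain c &
    exists w : spair -> R,
      [/\ forall u, u \in c -> 0 <= w u, \sum_(u in c) w u = 1 &
          x = \sum_(u in c) w u *: vertex u]].

Definition pair_ratio (u : spair) : R :=
  (cut E u.1 + cut E u.2)%N%:R / (vol E (u.1 :|: u.2)%SET)%:R.

Definition hat_cheeger (ind : set Rn -> nat) (k : nat) : R :=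
  inf [set \big[Num.max/0]_(u in AA) pair_ratio u |
    AA in [set AA : {set spair} | (AA \subset P2) /\
                                  (k <= ind (realization AA))%N]].

Definition eigenvectors_upto (ind : set Rn -> nat) (k : nat) (q : R) : set Rn :=
  [set x | exists2 lam, eigenpair E q lam x & lam <= minmax ind q k].

Definition max_nodal (ind : set Rn -> nat) (p : R) (k : nat) : nat :=
  nat_max [set nodal_domains E x | x in
    \bigcup_(q in [set q : R | 1 <= q <= p]) eigenvectors_upto ind k q].

End Constants.

Arguments genus_minus {R n} S.
Arguments genus_plus {R n} S.
Arguments yang {R n} S.
Arguments cheeger R {n} E k.

(* Main.v *)
(** Signed powers x |-> |x|^(r-1) x are odd homeomorphisms of R^n which compare
    the Rayleigh quotients F_{rq} and F_q up to explicit constants, in both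
    directions. All min-max eigenvalues are thereby compared with those of the
    1-Laplacian. There, both terms of F_1 are additive along the layer-cake
    decomposition of x over the chain of pairs ({x >= t}, {x <= -t}), so that
    restricting the decomposition to the pairs of small ratio is an odd map from a
    sublevel set of F_1 to a subcomplex, and lambda_k(Delta_1) = \hat h_k for every
    index which is monotone under odd maps. The inequalities
    gamma^+ <= gamma <= gamma^- hold because nu is the evaluation of an explicit
    cup product of sign functions, which takes the value 1 on cross-polytopes and
    vanishes on k-cycles of the (k-1)-sphere by barycentric subdivision.

    On a nodal domain of an eigenvector, F_q is at most the eigenvalue; comparison
    with q = 1 and the coarea formula produce sets of small Cheeger ratio.

    For the last item it suffices to treat p = 2. A set of genus at least k meets the
    orthogonal complement of any k - 1 vectors, whence k orthonormal functions of
    energy at most lambda_k^-. They map the vertices to R^k isotropically. The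
    directions of the images are rounded to a lattice and partitioned greedily by
    superlevel sets of squared products of hat functions, chosen by averaging so that
    few edges are cut; by isotropy each part has mass slightly more than 1 at most,
    so the parts can be merged into k groups of mass at least 1/2, to which the coarea
    formula applies. *)
From HB Require Import structures.
From mathcomp Require Import all_fingroup.
From mathcomp.multinomials Require Import freeg.
Require Import Defs.
From mathcomp Require Import all_boot all_order all_algebra.
From mathcomp Require Import all_classical all_reals all_analysis.
From mathcomp Require Import lra ring zify.

Set Implicit Arguments.
Unset Strict Implicit.
Unset Printing Implicit Defensive.

Import Order.TTheory GRing.Theory Num.Theory.
Import numFieldNormedType.Exports.

Local Open Scope classical_set_scope.
Local Open Scope ring_scope.

(** * Signed powers *)

(** Two choices shape the estimates. Quotients are compared in the form 2F: the mean of |x_i|^p over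
    the ends of an edge then sums to half the mass, and the constants multiply when signed powers
    are composed. Passing through an intermediate exponent q in [1,p] therefore costs nothing in
    p^p, which lets eigenvectors for all such q enter one bound. The obstacle in the topological
    part is that nu is defined through arbitrary halves of cycles. Its cochain formula holds for
    every family of antisymmetric functions, continuous or not, so the family is chosen anew for
    each use: lexicographic signs for naturality, coordinate signs on spheres and cross-polytopes.
    The power k^4 is k^2 squared: one factor k because directions inside a part must agree up to
    squared distance 1/(4k), one from the total mass k and total energy k lambda of the frame. No
    further factor arises, since the squared products of hat functions vary by 5/m times the
    Euclidean distance, whatever the dimension. *)

Section PowR.
Variable R : realType.
Implicit Types (a b r s t x y : R).

Definition spow r t : R := Num.sg t * `|t| `^ r.

Lemma spow_ge0 r t : 0 <= t -> r != 0 -> spow r t = t `^ r.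
Proof.
rewrite le_eqVlt => /predU1P[<-|t0] r0; first by rewrite /spow sgr0 mul0r powR0.
by rewrite /spow gtr0_sg // mul1r gtr0_norm.
Qed.

Lemma spowN r t : spow r (- t) = - spow r t.
Proof. by rewrite /spow sgrN normrN mulNr. Qed.

Lemma sgr_powR r x : r != 0 -> 0 <= x -> Num.sg (x `^ r) = Num.sg x.
Proof.
move=> r0; rewrite le_eqVlt => /predU1P[<-|x0]; first by rewrite powR0 // sgr0.
by rewrite !gtr0_sg // powR_gt0.
Qed.

Lemma spow_norm r t : r != 0 -> `|spow r t| = `|t| `^ r.
Proof.
move=> r0; have [->|t0] := eqVneq t 0.
  by rewrite /spow sgr0 mul0r normr0 powR0.
by rewrite /spow normrM normr_sg t0 mul1r ger0_norm ?powR_ge0.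
Qed.

Lemma spowK r t : r != 0 -> spow r^-1 (spow r t) = t.
Proof.
move=> r0; rewrite {1}/spow spow_norm // -powRrM mulfV // powRr1 //.
rewrite {1}/spow sgrM sgr_id sgr_powR // sgr_norm.
by have [->|t0] := eqVneq t 0; rewrite ?sgr0 ?mul0r // mulr1 -numEsg.
Qed.

(** Young's inequality for x and 1 with the conjugate exponents r and r / (r - 1). *)
Lemma bernoulli_powR r x : 1 <= r -> 0 <= x -> 1 + r * (x - 1) <= x `^ r.
Proof.
rewrite le_eqVlt => /predU1P[<-|r1] x0.
  by rewrite powRr1 // mul1r addrC subrK.
have r0 : 0 < r by exact: lt_trans r1.
have q0 : 0 < r / (r - 1) by rewrite divr_gt0 // subr_gt0.
have qV : (r / (r - 1))^-1 = (r - 1) / r by rewrite invf_div.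
have pq : r^-1 + (r / (r - 1))^-1 = 1.
  by rewrite qV -{1}[r^-1]mul1r -mulrDl addrC subrK divff ?gt_eqF.
have := conjugate_powR x0 (ler01 : 0 <= 1 :> R) r0 q0 pq.
rewrite mulr1 powR1 qV mul1r => H.
have : r * x <= r * (x `^ r / r + (r - 1) / r) by rewrite ler_pM2l.
rewrite mulrDr [r * (_ / r)]mulrC divfK ?gt_eqF //.
rewrite [r * ((r - 1) / r)]mulrC divfK ?gt_eqF //; lra.
Qed.

(** The case h = 1 of [powR_sym_diff] for the exponent 1/r. Bernoulli at r/2 gives (r/2)^r >= 1/2 +
    (r - 1)^2 / 2, and r-th roots are taken. *)
Lemma two_le_mul_powR r : 1 <= r -> 2 <= r * 2 `^ r^-1.
Proof.
move=> r1; have r0 : 0 < r by exact: lt_le_trans r1.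
have : 2^-1 <= (r / 2) `^ r.
  apply: le_trans (bernoulli_powR r1 _); last by rewrite divr_ge0 // ltW.
  have : 0 <= (r - 1) ^+ 2 by exact: sqr_ge0.
  rewrite expr2; lra.
move=> H; have rV0 : 0 <= r^-1 by rewrite invr_ge0 ltW.
have := ge0_ler_powR rV0 _ _ H; rewrite !nnegrE invr_ge0 powR_ge0 ler0n => /(_ erefl erefl).
rewrite -powRrM mulfV ?gt_eqF // powRr1 ?divr_ge0 ?ler0n ?(ltW r0) //.
have -> : (2^-1 : R) `^ r^-1 = (2 `^ r^-1)^-1.
  by rewrite -powR_inv1 ?ler0n // -powRrM mulrC powRrM powR_inv1 // powR_ge0.
rewrite -(ler_pM2r (powR_gt0 r^-1 (ltr0n R 2))) mulVf ?gt_eqF ?powR_gt0 ?ltr0n //.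
lra.
Qed.

Lemma superadd_powR r x y : 1 <= r -> 0 <= x -> 0 <= y ->
  x `^ r + y `^ r <= (x + y) `^ r.
Proof.
move=> r1 x0 y0; have r0 : 0 < r by exact: lt_le_trans r1.
have [s0|] := ltP 0 (x + y); last first.
  move=> xy; have [-> ->] : x = 0 /\ y = 0 by split; lra.
  by rewrite !addr0 !powR0 ?gt_eqF // addr0.
have key z : 0 <= z <= x + y -> z `^ r <= z / (x + y) * (x + y) `^ r.
  move=> /andP[]; rewrite le_eqVlt => /predU1P[<- _|z0 zs].
    by rewrite powR0 ?gt_eqF // !mul0r.
  rewrite -{1}[z](divfK (lt0r_neq0 s0)) powRM ?divr_ge0 ?(ltW z0) ?(ltW s0) //.
  rewrite ler_wpM2r ?powR_ge0 // ge1r_powR // divr_gt0 //=.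
  by rewrite ler_pdivrMr // mul1r.
apply: le_trans (lerD (key x _) (key y _)) _; rewrite ?x0 ?y0 ?lerDl ?lerDr //.
by rewrite -mulrDl -mulrDl divff ?gt_eqF // mul1r.
Qed.

(** Convexity through the tangent at the mean: Bernoulli is applied to x and y divided by their
    mean, where the linear terms cancel. *)
Lemma powR_mean r x y : 1 <= r -> 0 <= x -> 0 <= y ->
  ((x + y) / 2) `^ r <= (x `^ r + y `^ r) / 2.
Proof.
move=> r1 x0 y0.
have [s0|] := ltP 0 (x + y); last first.
  move=> xy; have [-> ->] : x = 0 /\ y = 0 by split; lra.
  rewrite addr0 mul0r powR0 ?addr0 ?mul0r // gt_eqF //; exact: lt_le_trans r1.
have m0 : 0 < (x + y) / 2 by rewrite divr_gt0.
have hx : 0 <= x / ((x + y) / 2) by rewrite divr_ge0 // ltW.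
have hy : 0 <= y / ((x + y) / 2) by rewrite divr_ge0 // ltW.
have E z : 0 <= z -> z `^ r = (z / ((x + y) / 2)) `^ r * ((x + y) / 2) `^ r.
  move=> z0; rewrite -powRM ?(ltW m0) ?divfK ?gt_eqF //.
  by rewrite divr_ge0 // ltW.
rewrite (E x x0) (E y y0) -mulrDl mulrAC -[leLHS]mul1r ler_wpM2r ?powR_ge0 //.
have := lerD (bernoulli_powR r1 hx) (bernoulli_powR r1 hy).
have : x / ((x + y) / 2) + y / ((x + y) / 2) = 2 by field; rewrite gt_eqF.
nra.
Qed.

Lemma powR_sum_le r x y : 1 <= r -> 0 <= x -> 0 <= y ->
  (x + y) `^ r <= 2 `^ (r - 1) * (x `^ r + y `^ r).
Proof.
move=> r1 x0 y0.
have -> : x + y = 2 * ((x + y) / 2) by rewrite mulrC divfK.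
rewrite powRM ?divr_ge0 ?addr_ge0 //.
have -> : 2 `^ r = 2 `^ (r - 1) * 2 :> R.
  by rewrite mulrC mulr_powRB1 // (lt_le_trans ltr01 r1).
rewrite -mulrA ler_wpM2l ?powR_ge0 //.
have := powR_mean r1 x0 y0; lra.
Qed.

(** Only opposite signs cost the constant, through convexity of the power; for equal signs
    superadditivity gives the constant 1. *)
Lemma powR_dist_le r a b : 1 <= r ->
  `|a - b| `^ r <= 2 `^ (r - 1) * `|spow r a - spow r b|.
Proof.
move=> r1; have r0 : 0 < r by exact: lt_le_trans r1.
have rn0 : r != 0 by rewrite gt_eqF.
have one : 1 <= 2 `^ (r - 1) :> R.
  by rewrite -{1}(powRr0 2) ler_powR ?subr_ge0 // ler1n.
wlog : a b / 0 <= a.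
  move=> H; have [|a0] := leP 0 a; first exact: H.
  have := H (- a) (- b); rewrite !spowN -!opprD !normrN; apply; lra.
move=> a0; have [b0|b0] := leP 0 b; last first.
  have bE : spow r b = - ((- b) `^ r).
    by rewrite -[b in LHS]opprK spowN spow_ge0 //; lra.
  rewrite bE opprK spow_ge0 // ger0_norm; last by lra.
  rewrite [X in _ * X]ger0_norm ?addr_ge0 ?powR_ge0 //.
  apply: powR_sum_le => //; lra.
wlog : a b a0 b0 / b <= a.
  move=> H; have [|ab] := leP b a; first exact: H.
  by rewrite distrC [X in _ * X]distrC; apply: H => //; exact: ltW.
move=> ba; rewrite !spow_ge0 //.
have ab0 : 0 <= a - b by rewrite subr_ge0.
have H : (a - b) `^ r <= a `^ r - b `^ r.
  by rewrite lerBrDr -{2}(subrK b a) superadd_powR.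
rewrite ger0_norm // ger0_norm; last by apply: le_trans H; exact: powR_ge0.
by apply: le_trans H _; rewrite ler_peMl // subr_ge0 ge0_ler_powR ?nnegrE // ltW.
Qed.

Lemma is_derive_powR s t : 0 < t -> is_derive t 1 (@powR R ^~ s) (s * t `^ (s - 1)).
Proof.
move=> t0; have ti : t \in `]0, +oo[ by rewrite in_itv /= t0.
split; first exact: derivable_powR.
by rewrite -derive1E powR_derive1.
Qed.
(* The difference of the two sides vanishes at [h = 0] and is nondecreasing, as
   its derivative is [s ((1 + h)^(s-1) + (1 - h)^(s-1) - 2) >= 0]. *)
Lemma powR_sym_diff s h : 0 < s <= 1 -> 0 <= h <= 1 ->
  2 * s * h <= (1 + h) `^ s - (1 - h) `^ s.
Proof.
move=> /andP[s0 s1] /andP[]; rewrite le_eqVlt => /predU1P[<- _|h0].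
  by rewrite mulr0 addr0 subr0 subrr.
(* At h = 1 the base 1 - h vanishes and the derivative formula fails, so this end is treated
   apart. *)
rewrite le_eqVlt => /predU1P[->|h1].
  have sV : 1 <= s^-1 by rewrite invf_ge1.
  have := ler_wpM2l (ltW s0) (two_le_mul_powR sV).
  by rewrite mulrA divff ?gt_eqF // mul1r invrK subrr powR0 ?gt_eqF // subr0 mulr1 mulrC.
pose f : R -> R := ((@powR R ^~ s) \o (cst 1 + id)) -
  ((@powR R ^~ s) \o (cst 1 - id)) - (2 * s) \*: id.
have fE t : f t = (1 + t) `^ s - (1 - t) `^ s - (2 * s) * t by [].
pose df t := s * (1 + t) `^ (s - 1) + s * (1 - t) `^ (s - 1) - 2 * s.
have fd t : t \in `[0, h] -> is_derive t 1 f (df t).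
  rewrite in_itv /= => /andP[t0 th].
  have d1 : is_derive t 1 (cst 1 + id) (1:R).
    by apply: is_derive_eq; rewrite add0r.
  have d2 : is_derive t 1 (cst 1 - id) (-1:R).
    by apply: is_derive_eq; rewrite add0r.
  have t1 : 0 < (cst 1 + id) t by change (0 < 1 + t); lra.
  have t2 : 0 < (cst 1 - id) t by change (0 < 1 - t); lra.
  have e1 := is_derive1_comp (is_derive_powR s t1) d1.
  have e2 := is_derive1_comp (is_derive_powR s t2) d2.
  have e3 := is_deriveZ (2 * s) (is_derive_id t (1 : R)).
  have e4 := is_deriveB (is_deriveB e1 e2) e3.
  apply: (is_derive_eq e4).
  change (s * (1 + t) `^ (s - 1) * 1 - s * (1 - t) `^ (s - 1) * -1 - 2 * s * 1
          = df t).
  rewrite /df; ring.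
have cf : {within `[0, h], continuous f}.
  apply: derivable_within_continuous => t th.
  by case: (fd t th).
have fd' t : t \in `]0, h[ -> is_derive t 1 f (df t).
  by move=> th; apply: fd; apply: subset_itv_oo_cc.
have [c ch E] := @MVT R f df 0 h h0 fd' cf.
have f0 : f 0 = 0 by rewrite fE addr0 subr0 mulr0 subrr subr0.
have : 0 <= f h - f 0; last by rewrite f0 fE; lra.
rewrite E subr0 mulr_ge0 ?(ltW h0) //.
move: ch; rewrite in_itv /= => /andP[c0 ch].
have t1 : 0 < 1 + c by lra.
have t2 : 0 < 1 - c by lra.
rewrite /df.
set u := (1 + c) `^ (s - 1); set v := (1 - c) `^ (s - 1).
have u0 : 0 < u by exact: powR_gt0.
have v0 : 0 < v by exact: powR_gt0.
(* u v is the power s - 1 <= 0 of 1 - c^2 <= 1; then u + v >= 2 by the arithmetic-geometric mean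
   inequality. *)
have uv : 1 <= u * v.
  rewrite -powRM ?(ltW t1) ?(ltW t2) //.
  have : 1 `^ (s - 1) <= ((1 + c) * (1 - c)) `^ (s - 1).
    have sE : s - 1 = - (1 - s) by lra.
    rewrite sE !powRN powR1 invr1 -[X in X <= _]invr1 lef_pV2 ?posrE ?powR_gt0 ?mulr_gt0 //.
    have H1 : (1 + c) * (1 - c) <= 1.
      have := mulr_ge0 (ltW c0) (ltW c0); rewrite mulrDl mulrBr mulr1; lra.
    have s2 : 0 <= 1 - s by rewrite subr_ge0.
    have := ge0_ler_powR s2 _ _ H1; rewrite powR1 !nnegrE ler01.
    by rewrite mulr_ge0 ?(ltW t1) ?(ltW t2) //; apply.
  by rewrite powR1.
have uv2 : 2 <= u + v.
  rewrite -(@ler_pXn2r _ 2) ?nnegrE ?addr_ge0 ?(ltW u0) ?(ltW v0) //.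
  have := sqr_ge0 (u - v); rewrite sqrrB sqrrD expr2; lra.
have : s * 2 <= s * (u + v) by rewrite ler_pM2l.
rewrite mulrDr; lra.
Qed.

(** For a, b >= 0, dividing by the mean m of the r-th powers turns a^r and b^r into 1 + h and 1 - h,
    and the claim becomes [powR_sym_diff] with s = 1/r. A mean on the right, rather than a maximum,
    is what later sums to the mass. *)
Lemma spow_dist_le r a b : 1 <= r ->
  `|spow r a - spow r b| <=
  r * `|a - b| * ((`|a| `^ r + `|b| `^ r) / 2) `^ (1 - r^-1).
Proof.
move=> r1; have r0 : 0 < r by exact: lt_le_trans r1.
have rn0 : r != 0 by rewrite gt_eqF.
wlog : a b / 0 <= a.
  move=> H; have [|a0] := leP 0 a; first exact: H.
  have := H (- a) (- b); rewrite !spowN -!opprD !normrN; apply; lra.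
move=> a0; have [m mdef] : exists m, m = (`|a| `^ r + `|b| `^ r) / 2 by eexists.
rewrite -mdef.
have m0 : 0 <= m by rewrite mdef divr_ge0 ?addr_ge0 ?powR_ge0.
have [mz|mn0] := eqVneq m 0.
  have [A0 B0] : `|a| `^ r = 0 /\ `|b| `^ r = 0.
    have := powR_ge0 `|a| r; have := powR_ge0 `|b| r.
    by move: mz; rewrite mdef => *; split; lra.
  have aE : a = 0 by apply/normr0_eq0/(powR_eq0_eq0 A0).
  have bE : b = 0 by apply/normr0_eq0/(powR_eq0_eq0 B0).
  by rewrite aE bE /spow sgr0 !mul0r subrr normr0 !(mulr0, mul0r).
have mp : 0 < m by rewrite lt_def mn0.
have mE : m = m `^ (1 - r^-1) * m `^ r^-1.
  rewrite -powRD ?subrK ?powRr1 //.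
  by rewrite mn0 implybT.
(* Opposite signs: the left side is exactly 2 m, superadditivity gives |a - b| >= (2 m)^(1/r), and
   the missing factor is [two_le_mul_powR]. *)
have [b0|b0] := leP 0 b; last first.
  have bE : spow r b = - ((- b) `^ r).
    by rewrite -[b in LHS]opprK spowN spow_ge0 //; lra.
  rewrite bE opprK spow_ge0 // ger0_norm ?addr_ge0 ?powR_ge0 //.
  rewrite (ger0_norm (_ : 0 <= a - b)); last by lra.
  have -> : a `^ r + (- b) `^ r = 2 * m.
    by rewrite mdef ger0_norm // ltr0_norm // mulrC divfK.
  rewrite {1}mE mulrCA [leRHS]mulrC ler_wpM2l ?powR_ge0 //.
  have H : (2 * m) `^ r^-1 <= a - b.
    have -> : a - b = ((a - b) `^ r) `^ r^-1.
      by rewrite -powRrM mulfV // powRr1 //; lra.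
    apply: ge0_ler_powR; rewrite ?nnegrE ?invr_ge0 ?(ltW r0) ?mulr_ge0 ?powR_ge0 //.
    rewrite mdef mulrC divfK // ger0_norm // ltr0_norm //.
    by apply: superadd_powR => //; lra.
  apply: le_trans (ler_wpM2l (ltW r0) H).
  by rewrite (@powRM R 2 m) ?ler0n // mulrA ler_wpM2r ?powR_ge0 // two_le_mul_powR.
wlog : a b mdef a0 b0 / b <= a.
  move=> H; have [ba|ab] := leP b a; first exact: H.
  rewrite distrC [X in _ * X * _]distrC.
  by apply: H => //; rewrite ?(ltW ab) // mdef addrC.
move=> ba; rewrite !spow_ge0 // ger0_norm ?subr_ge0 ?ge0_ler_powR ?nnegrE ?(ltW r0) //.
rewrite (ger0_norm (_ : 0 <= a - b)) ?subr_ge0 //.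
have mE2 : 2 * m = a `^ r + b `^ r.
  by rewrite mdef !ger0_norm // mulrC divfK.
pose h := (a `^ r - b `^ r) / (2 * m).
have m2 : 0 < 2 * m by rewrite mulr_gt0.
have hb : 0 <= h <= 1.
  rewrite /h divr_ge0 ?(ltW m2) ?subr_ge0 ?ge0_ler_powR ?nnegrE ?(ltW r0) //=.
  rewrite ler_pdivrMr // mul1r mE2; have := powR_ge0 b r; lra.
have hm : 2 * (h * m) = a `^ r - b `^ r by rewrite mulrCA /h divfK // gt_eqF.
have sV : 0 < r^-1 <= 1 by rewrite invr_gt0 r0 invf_le1.
have {sV} H := powR_sym_diff sV hb.
have rK z : 0 <= z -> z = (z `^ r) `^ r^-1.
  by move=> z0; rewrite -powRrM mulfV // powRr1.
have h1 : 0 <= 1 + h by lra.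
have h2 : 0 <= 1 - h by lra.
have aE : a = (1 + h) `^ r^-1 * m `^ r^-1.
  rewrite -(@powRM R _ m) // {1}(rK a a0); congr (_ `^ _); lra.
have bE : b = (1 - h) `^ r^-1 * m `^ r^-1.
  rewrite -(@powRM R _ m) // {1}(rK b b0); congr (_ `^ _); lra.
rewrite -hm aE bE -mulrBl {1}mE.
set M := m `^ r^-1; set N := m `^ (1 - r^-1).
have -> : 2 * (h * (N * M)) = r * (2 * r^-1 * h * M) * N.
  by rewrite [r * _]mulrC; field; rewrite gt_eqF.
rewrite ler_wpM2r ?powR_ge0 //; apply: (ler_wpM2l (ltW r0)).
by rewrite ler_wpM2r ?powR_ge0.
Qed.

(** The right side is a product of powers 1/r and 1 - 1/r of quantities homogeneous of degree r q,
    the shape that Hoelder's inequality over the edges needs. *)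
Lemma spow_dist_powR r q a b : 1 <= r -> 1 <= q ->
  `|spow r a - spow r b| `^ q <= r `^ q * (`|a - b| `^ (r * q)) `^ r^-1 *
     ((`|a| `^ (r * q) + `|b| `^ (r * q)) / 2) `^ (1 - r^-1).
Proof.
move=> r1 q1; have r0 : 0 < r by exact: lt_le_trans r1.
have q0 : 0 < q by exact: lt_le_trans q1.
have d0 : 0 <= 1 - r^-1 by rewrite subr_ge0 invf_le1.
have m0 : 0 <= (`|a| `^ r + `|b| `^ r) / 2.
  by rewrite divr_ge0 ?addr_ge0 ?powR_ge0.
have H := spow_dist_le a b r1.
have H2 : `|spow r a - spow r b| `^ q <=
    (r * `|a - b| * ((`|a| `^ r + `|b| `^ r) / 2) `^ (1 - r^-1)) `^ q.
  apply: ge0_ler_powR H; rewrite ?(ltW q0) // nnegrE //.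
  by rewrite !mulr_ge0 ?powR_ge0 ?(ltW r0).
apply: le_trans H2 _.
have rd : 0 <= r * `|a - b| by rewrite mulr_ge0 ?(ltW r0).
have P u v : 0 <= u -> 0 <= v ->
    (r * u * v `^ (1 - r^-1)) `^ q = r `^ q * u `^ q * (v `^ q) `^ (1 - r^-1).
  move=> u0 v0; have ru : 0 <= r * u by rewrite mulr_ge0 ?(ltW r0).
  by rewrite (powRM q ru (powR_ge0 _ _)) (powRM q (ltW r0) u0) [in LHS]powRAC.
rewrite (P _ _ (normr_ge0 _) m0).
have -> : (`|a - b| `^ (r * q)) `^ r^-1 = `|a - b| `^ q.
  by rewrite -powRrM mulrAC mulfV ?mul1r // gt_eqF.
rewrite ler_wpM2l ?mulr_ge0 ?powR_ge0 //.
apply: ge0_ler_powR; rewrite ?d0 // ?nnegrE ?powR_ge0 ?divr_ge0 ?addr_ge0 ?powR_ge0 //.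
by rewrite !powRrM; apply: powR_mean; rewrite ?powR_ge0.
Qed.

Lemma young_powR s x y : 0 < s <= 1 -> 0 <= x -> 0 <= y ->
  x `^ s * y `^ (1 - s) <= s * x + (1 - s) * y.
Proof.
move=> /andP[s0]; rewrite le_eqVlt => /predU1P[->|s1] x0 y0.
  by rewrite subrr powRr0 powRr1 // !(mulr1, mul0r, addr0, mul1r).
have s2 : 0 < 1 - s by rewrite subr_gt0.
have := @conjugate_powR R (x `^ s) (y `^ (1 - s)) s^-1 (1 - s)^-1 (powR_ge0 _ _)
  (powR_ge0 _ _); rewrite !invr_gt0 !invrK s0 s2 addrC subrK.
rewrite -!powRrM !mulfV ?gt_eqF // !powRr1 // => /(_ erefl erefl erefl).
by rewrite ![_ * s]mulrC ![_ * (1 - s)]mulrC.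
Qed.

(** Young's inequality for the normalised terms, summed. Vanishing sums are split off because the
    normalisation divides by them, and s = 1 is allowed because it is used with s = 1/r and r =
    1. *)
Lemma hoelder_sum (I : eqType) (l : seq I) (P : pred I) (f g : I -> R) s :
  0 < s <= 1 -> (forall i, 0 <= f i) -> (forall i, 0 <= g i) ->
  \sum_(i <- l | P i) f i `^ s * g i `^ (1 - s) <=
  (\sum_(i <- l | P i) f i) `^ s * (\sum_(i <- l | P i) g i) `^ (1 - s).
Proof.
move=> s01 f0 g0; have /andP[s0 s1] := s01.
set A := \sum_(i <- l | P i) f i; set B := \sum_(i <- l | P i) g i.
have A0 : 0 <= A by exact: sumr_ge0.
have B0 : 0 <= B by exact: sumr_ge0.
have [Az|An] := eqVneq A 0.
  suff -> : \sum_(i <- l | P i) f i `^ s * g i `^ (1 - s) = 0.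
    by rewrite mulr_ge0 ?powR_ge0.
  apply: big1_seq => i /andP[Pi il].
  have -> : f i = 0.
    have := Az; rewrite /A => /eqP; rewrite psumr_eq0; last by [].
    by move=> /allP /(_ i il); rewrite Pi => /eqP.
  by rewrite powR0 ?mul0r // gt_eqF.
have Ap : 0 < A by rewrite lt_def An.
have [s_1|sn1] := eqVneq s 1.
  rewrite s_1 subrr powRr0 mulr1 powRr1 // le_eqVlt; apply/orP; left; apply/eqP.
  by apply: eq_bigr => i _; rewrite powRr0 powRr1 // mulr1.
have s2 : 0 < 1 - s by rewrite subr_gt0 lt_neqAle sn1.
have [Bz|Bn] := eqVneq B 0.
  suff -> : \sum_(i <- l | P i) f i `^ s * g i `^ (1 - s) = 0.
    by rewrite mulr_ge0 ?powR_ge0.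
  apply: big1_seq => i /andP[Pi il].
  have -> : g i = 0.
    have := Bz; rewrite /B => /eqP; rewrite psumr_eq0; last by [].
    by move=> /allP /(_ i il); rewrite Pi => /eqP.
  by rewrite [0 `^ _]powR0 ?mulr0 // gt_eqF.
have Bp : 0 < B by rewrite lt_def Bn.
set K := A `^ s * B `^ (1 - s).
apply: (@le_trans _ _ (\sum_(i <- l | P i) K * (s * (f i / A) + (1 - s) * (g i / B)))).
  apply: ler_sum => i _.
  have hA : 0 <= f i / A by rewrite divr_ge0.
  have hB : 0 <= g i / B by rewrite divr_ge0.
  have := ler_wpM2l (mulr_ge0 (powR_ge0 A s) (powR_ge0 B (1 - s))) (young_powR s01 hA hB).
  apply: le_trans; rewrite -/K.
  by rewrite mulrACA -!powRM // ![_ * (_ / _)]mulrC !divfK.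
rewrite -mulr_sumr big_split /= -!mulr_sumr -!mulr_suml -/A -/B !divff //.
by rewrite !mulr1 addrC subrK mulr1.
Qed.

End PowR.

(** * Edge sums and Rayleigh quotients under signed powers *)

Section Edges.
Variables (R : realType) (n : nat) (E : rel 'I_n).
Implicit Types (p q r c : R) (x : 'rV[R]_n).
Hypotheses (Esym : symmetric E) (Eirr : irreflexive E).

Definition esum (f : 'I_n -> 'I_n -> R) : R :=
  \sum_(i < n) \sum_(j < n | (i < j)%N && E i j) f i j.

Lemma esum_double f : (forall i j, f i j = f j i) ->
  \sum_(i < n) \sum_(j < n | E i j) f i j = 2 * esum f.
Proof.
move=> fC; rewrite mulrDl mul1r /esum.
transitivity (\sum_(i < n) \sum_(j < n | (i < j)%N && E i j) f i j +
              \sum_(i < n) \sum_(j < n | (j < i)%N && E i j) f i j).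
  rewrite -big_split /=; apply: eq_bigr => i _.
  rewrite (bigID (fun j : 'I_n => (i < j)%N)) /=; congr (_ + _).
    by apply: eq_bigl => j; rewrite andbC.
  apply: eq_bigl => j; rewrite -leqNgt andbC; case Eij: (E i j); rewrite ?andbF //.
  rewrite !andbT leq_eqVlt; have [/val_inj ji|//] := eqVneq (val j) (val i).
  by rewrite ji Eirr in Eij.
congr (_ + _); rewrite (exchange_big_dep predT) //=.
by apply: eq_bigr => j _; apply: eq_big => [i|i _]; rewrite // Esym.
Qed.

Lemma degE (i : 'I_n) : (deg E i)%:R = \sum_(j < n | E i j) (1 : R).
Proof. by rewrite sumr_const. Qed.

(** Handshake counting: every edge hands f i to i and f j to j, so the vertex i receives f i once
    per incident edge. *)
Lemma esum_add (f : 'I_n -> R) :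
  esum (fun i j => f i + f j) = \sum_i (deg E i)%:R * f i.
Proof.
apply: (@mulfI R 2); first by rewrite pnatr_eq0.
rewrite -esum_double; last by move=> i j; rewrite addrC.
have -> : \sum_(i < n) \sum_(j < n | E i j) (f i + f j) =
   \sum_(i < n) \sum_(j < n | E i j) f i + \sum_(i < n) \sum_(j < n | E i j) f j.
  by rewrite -big_split; apply: eq_bigr => i _; rewrite big_split.
rewrite [X in _ + X](exchange_big_dep predT) //= mulrDl mul1r.
congr (_ + _); apply: eq_bigr => i _; rewrite degE mulr_suml.
  by under [RHS]eq_bigr do rewrite mul1r.
under [RHS]eq_bigr do rewrite mul1r.
by apply: eq_bigl => j; rewrite Esym.
Qed.

Lemma esum_ge0 f : (forall i j, 0 <= f i j) -> 0 <= esum f.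
Proof. by move=> f0; apply: sumr_ge0 => i _; apply: sumr_ge0. Qed.

Lemma ler_esum f g : (forall i j, E i j -> f i j <= g i j) -> esum f <= esum g.
Proof.
by move=> fg; apply: ler_sum => i _; apply: ler_sum => j /andP[_]; exact: fg.
Qed.

Lemma esum_pair (f : 'I_n -> 'I_n -> R) :
  esum f = \sum_(u : 'I_n * 'I_n | (u.1 < u.2)%N && E u.1 u.2) f u.1 u.2.
Proof. by rewrite /esum pair_big_dep. Qed.

Lemma esumZ c f : esum (fun i j => c * f i j) = c * esum f.
Proof. by rewrite !esum_pair mulr_sumr. Qed.

Lemma esumD f g : esum (fun i j => f i j + g i j) = esum f + esum g.
Proof. by rewrite !esum_pair big_split. Qed.

Definition energy p (x : 'rV[R]_n) : R :=
  esum (fun i j => `|x ord0 i - x ord0 j| `^ p).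

Definition mass p (x : 'rV[R]_n) : R :=
  \sum_(i < n) (deg E i)%:R * `|x ord0 i| `^ p.

Lemma RayleighE p x : Rayleigh E p x = energy p x / mass p x.
Proof. by []. Qed.

Lemma energy_ge0 p x : 0 <= energy p x.
Proof. by apply: esum_ge0 => i j; exact: powR_ge0. Qed.

Lemma mass_ge0 p x : 0 <= mass p x.
Proof. by apply: sumr_ge0 => i _; rewrite mulr_ge0 ?powR_ge0. Qed.

Lemma Rayleigh_ge0 p x : 0 <= Rayleigh E p x.
Proof. by rewrite RayleighE divr_ge0 ?energy_ge0 ?mass_ge0. Qed.

Lemma Rayleigh_le p x : 1 <= p -> Rayleigh E p x <= 2 `^ (p - 1).
Proof.
move=> p1; rewrite RayleighE.
have H : energy p x <= 2 `^ (p - 1) * mass p x.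
  rewrite /mass -esum_add -esumZ; apply: ler_esum => i j _.
  apply: le_trans (powR_sum_le _ _ _) => //; apply: ge0_ler_powR.
  - exact: le_trans p1.
  - by rewrite nnegrE.
  - by rewrite nnegrE addr_ge0.
  - exact: ler_normB.
have [m0|mn] := eqVneq (mass p x) 0; first by rewrite m0 invr0 mulr0 powR_ge0.
by rewrite ler_pdivrMr // lt_def mn mass_ge0.
Qed.

Hypothesis deg_gt0 : forall i, (1 <= deg E i)%N.

Lemma mass_gt0 p x : p != 0 -> x != 0 -> 0 < mass p x.
Proof.
move=> p0 x0; have [i xi] : exists i, x ord0 i != 0.
  apply/existsP; apply: contraNT x0 => /existsPn H; apply/eqP/rowP => i.
  by rewrite mxE; apply/eqP; rewrite -[_ == _]negbK H.
rewrite /mass (bigD1 i) //= ltr_wpDr //.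
  by apply: sumr_ge0 => j _; rewrite mulr_ge0 ?powR_ge0.
by rewrite mulr_gt0 ?ltr0n ?deg_gt0 // powR_gt0 // normr_gt0.
Qed.

Definition mspow r (x : 'rV[R]_n) : 'rV[R]_n := \row_i spow r (x ord0 i).

Lemma mspowN r x : mspow r (- x) = - mspow r x.
Proof. by apply/rowP => i; rewrite !mxE spowN. Qed.

Lemma mspowK r x : r != 0 -> mspow r^-1 (mspow r x) = x.
Proof. by move=> r0; apply/rowP => i; rewrite !mxE spowK. Qed.

Lemma mspow0 r : mspow r 0 = 0.
Proof. by apply/rowP => i; rewrite !mxE /spow sgr0 mul0r. Qed.

Lemma mspow_eq0 r x : r != 0 -> (mspow r x == 0) = (x == 0).
Proof.
move=> r0; apply/eqP/eqP => [x0|->]; last exact: mspow0.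
by rewrite -(mspowK x r0) x0 mspow0.
Qed.

Lemma mass_mspow r q x : r != 0 -> mass q (mspow r x) = mass (r * q) x.
Proof.
by move=> r0; apply: eq_bigr => i _; rewrite mxE spow_norm // powRrM.
Qed.

(** Hoelder over the edges. By [esum_add] the means over the ends of the edges sum to half the mass;
    the factor 2 on both quotients absorbs this half. *)
Lemma Rayleigh_mspow_le r q x : 1 <= r -> 1 <= q -> x != 0 ->
  2 * Rayleigh E q (mspow r x) <= r `^ q * (2 * Rayleigh E (r * q) x) `^ r^-1.
Proof.
move=> r1 q1 x0; have r0 : 0 < r by exact: lt_le_trans r1.
have q0 : 0 < q by exact: lt_le_trans q1.
have rn0 : r != 0 by rewrite gt_eqF.
rewrite !RayleighE mass_mspow // mulrA.
have M0 : 0 < mass (r * q) x by apply: mass_gt0; rewrite ?mulf_neq0 // gt_eqF.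
set M := mass _ _ in M0 *.
have rV : 0 < r^-1 <= 1 by rewrite invr_gt0 r0 invf_le1.
have /andP[rV0 rV1] := rV.
have d0 : 0 <= 1 - r^-1 by rewrite subr_ge0.
have H : energy q (mspow r x) <=
    r `^ q * ((energy (r * q) x) `^ r^-1 * (M / 2) `^ (1 - r^-1)).
  have -> : M / 2 = esum (fun i j => (`|x ord0 i| `^ (r * q) + `|x ord0 j| `^ (r * q)) / 2).
    by rewrite /M /mass -esum_add mulrC -esumZ; congr esum; apply/funext => i;
       apply/funext => j; rewrite mulrC.
  rewrite /energy.
  apply: (@le_trans _ _ (esum (fun i j => r `^ q * ((`|x ord0 i - x ord0 j| `^ (r * q)) `^ r^-1 *
     ((`|x ord0 i| `^ (r * q) + `|x ord0 j| `^ (r * q)) / 2) `^ (1 - r^-1))))).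
    by apply: ler_esum => i j _; rewrite !mxE mulrA; exact: spow_dist_powR.
  rewrite esumZ; apply: ler_wpM2l; first exact: powR_ge0.
  rewrite !esum_pair; apply: (hoelder_sum _ _ rV).
  - by move=> u; exact: powR_ge0.
  - by move=> u; rewrite divr_ge0 ?addr_ge0 ?powR_ge0.
rewrite ler_pdivrMr //.
have -> : 2 * (energy (r * q) x / M) = energy (r * q) x / (M / 2).
  by field; rewrite gt_eqF.
apply: le_trans (ler_wpM2l (ler0n R 2) H) _.
rewrite mulrCA -[X in _ <= X](mulrA (r `^ q)); apply: ler_wpM2l; first exact: powR_ge0.
have M2 : 0 < M / 2 by rewrite divr_gt0.
have P : (energy (r * q) x / (M / 2)) `^ r^-1 =
    energy (r * q) x `^ r^-1 * ((M / 2) `^ r^-1)^-1.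
  rewrite powRM ?energy_ge0 ?invr_ge0 ?(ltW M2) // -(powR_inv1 (ltW M2)).
  by rewrite powRAC powR_inv1 ?powR_ge0.
have Q : 2 * (M / 2) `^ (1 - r^-1) = M * ((M / 2) `^ r^-1)^-1.
  have c : (1 == r^-1) ==> (M / 2 != 0) by rewrite (gt_eqF M2) implybT.
  rewrite (powRB c) powRr1 ?(ltW M2) // mulrA; congr (_ * _).
  by rewrite mulrC divfK ?pnatr_eq0.
by rewrite P mulrCA Q mulrAC mulrA.
Qed.

Lemma Rayleigh_mspow_ge r q x : 1 <= r -> 1 <= q -> x != 0 ->
  Rayleigh E (r * q) x <= 2 `^ (r * q - q) * Rayleigh E q (mspow r x).
Proof.
move=> r1 q1 x0; have r0 : 0 < r by exact: lt_le_trans r1.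
have q0 : 0 < q by exact: lt_le_trans q1.
have rn0 : r != 0 by rewrite gt_eqF.
rewrite !RayleighE mass_mspow // mulrA ler_wpM2r ?invr_ge0 ?mass_ge0 //.
rewrite /energy -esumZ; apply: ler_esum => i j _; rewrite !mxE.
rewrite powRrM (_ : r * q - q = (r - 1) * q); last by rewrite mulrBl mul1r.
rewrite powRrM -powRM ?powR_ge0 //.
apply: ge0_ler_powR; rewrite ?nnegrE ?mulr_ge0 ?powR_ge0 ?(ltW q0) //.
exact: powR_dist_le.
Qed.

End Edges.

(** * The homomorphism nu as a cochain *)

Section Cochains.
Variable A : Type.
Implicit Types (eps : nat -> A -> 'F_2) (v : nat -> A).

Lemma addF2 (x : 'F_2) : x + x = 0.
Proof. by rewrite -mulr2n -mulr_natr pchar_Fp_0 ?mulr0. Qed.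

Definition cobd q eps v : 'F_2 := \prod_(i < q) (eps i (v i) + eps i (v i.+1)).

(* The cup product of [eps 0] with the coboundaries of [eps 1], ..., [eps q],
   evaluated on the simplex with vertices v 0, ..., v q. When the eps i are
   antisymmetric on S, this cochain computes nu on symmetric cycles of S. *)
Definition precup q eps v : 'F_2 :=
  eps 0%N (v 0%N) * cobd q (fun i => eps i.+1) v.

Definition vface j v : nat -> A := fun i => v (bump j i).

Lemma cobdS q eps v : cobd q.+1 eps v =
  (eps 0%N (v 0%N) + eps 0%N (v 1%N)) *
  cobd q (fun i => eps i.+1) (fun i => v i.+1).
Proof. by rewrite /cobd big_ord_recl. Qed.

Lemma eq_cobd q eps v w : (forall i, (i <= q)%N -> v i = w i) ->
  cobd q eps v = cobd q eps w.
Proof. by move=> vw; apply: eq_bigr => i _; rewrite !vw // ltnW. Qed.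

Lemma vfaceS j v : (fun i => vface j.+1 v i.+1) = vface j (fun i => v i.+1).
Proof. by apply/funext => i; rewrite /vface bumpS. Qed.

(** Let x0, x1, x2 be the values of [eps 0] at the first three vertices. Faces 0 and 1 have leading
    factors x1 + x2 and x0 + x2, all others x0 + x1. By induction on the tail, the cofactors of the
    others add up to the common cofactor of the first two, and the three leading factors have sum
    0. *)
Lemma cobd_cocycle q eps v : \sum_(j < q.+2) cobd q eps (vface j v) = 0.
Proof.
elim: q eps v => [|q IH] eps v.
  by rewrite !big_ord_recl big_ord0 /cobd !big_ord0 addr0 addF2.
have H := IH (fun i => eps i.+1) (fun i => v i.+1).
rewrite big_ord_recl in H; move/eqP: H; rewrite addr_eq0 => /eqP H.
rewrite big_ord_recl big_ord_recl !cobdS.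
rewrite (eq_bigr (fun j : 'I_q.+1 => (eps 0%N (v 0%N) + eps 0%N (v 1%N)) *
  cobd q (fun i => eps i.+1) (vface (lift ord0 j) (fun i => v i.+1)))); last first.
  by move=> j _; rewrite cobdS vfaceS.
rewrite -mulr_sumr -[\sum_(_ < _) _]opprK -H.
have -> x : - x = x :> 'F_2 by apply/eqP; rewrite eq_sym -addr_eq0 addF2.
rewrite /vface /= -!mulrDl.
set a := eps _ _; set b := eps _ _; set c := eps _ _; set d := cobd _ _ _.
have -> : a + b + (c + b + (c + a)) = (a + a) + (b + b) + (c + c) by ring.
by rewrite (addF2 a) (addF2 b) (addF2 c) !addr0 mul0r.
Qed.

(** Leibniz rule mod 2: the factors after the first form a cocycle, so only [eps 0] is
    differentiated. *)
Lemma precup_cobd q eps v :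
  \sum_(j < q.+2) precup q eps (vface j v) = cobd q.+1 eps v.
Proof.
have H := cobd_cocycle q (fun i => eps i.+1) v.
rewrite big_ord_recl in H; move/eqP: H; rewrite addr_eq0 => /eqP H.
rewrite big_ord_recl cobdS mulrDl addrC; congr (_ + _).
rewrite /precup (eq_bigr (fun j : 'I_q.+1 => eps 0%N (v 0%N) *
  cobd q (fun i => eps i.+1) (vface (lift ord0 j) v))) //.
rewrite -mulr_sumr -[\sum_(_ < _) _]opprK -H.
by have -> x : - x = x :> 'F_2 by apply/eqP; rewrite eq_sym -addr_eq0 addF2.
Qed.

Lemma cobd_shift1 q eps v w : 
  (forall i j, (i <= q)%N -> eps j (w i) = eps j (v i) + 1) ->
  cobd q eps w = cobd q eps v.
Proof.
move=> H; apply: eq_bigr => i _; rewrite (H i _ (ltnW (ltn_ord i))) (H i.+1 _ (ltn_ord i)).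
by rewrite addrACA (addF2 1) addr0.
Qed.

(** The antipode adds 1 to every sign. This cancels in each coboundary and survives only in the
    leading factor. *)
Lemma precup_shift1 q eps v w :
  (forall i j, (i <= q)%N -> eps j (w i) = eps j (v i) + 1) ->
  precup q eps v + precup q eps w = cobd q (fun i => eps i.+1) v.
Proof.
move=> H; rewrite /precup (@cobd_shift1 _ _ v w) => [|i j iq]; last exact: H.
by rewrite (H 0%N 0%N (leq0n q)) -mulrDl addrA (addF2 (eps _ _)) add0r mul1r.
Qed.

End Cochains.

(** * Chains over the field with two elements and affine singular simplices *)

Section Chains.
Variable R : realType.

Lemma cvg_rV (T : Type) (F : set_system T) n (f : T -> 'rV[R]_n) (x : 'rV[R]_n) :
  Filter F -> (forall j, (fun t => f t ord0 j) @ F --> x ord0 j) -> f @ F --> x.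
Proof.
move=> FF H A [P Px PA]; have HP j : F [set t | P ord0 j (f t ord0 j)].
  by apply: (H j); exact: (Px ord0 j).
have HF : F [set t | forall j, P ord0 j (f t ord0 j)] by apply: filter_forall.
apply: (@filterS _ F FF _ (f @^-1` A) _ HF) => t Ht; apply: PA => i j.
by rewrite [i]ord1; exact: Ht.
Qed.

Lemma rV_continuous (T : topologicalType) n (f : T -> 'rV[R]_n) :
  (forall j, continuous (fun t => f t ord0 j)) -> continuous f.
Proof. by move=> H x; apply: cvg_rV => j; exact: H. Qed.

Lemma cvg_bigsum (T : Type) (F : set_system T) (I : Type) (r : seq I) (P : pred I)
    (f : I -> T -> R) (l : I -> R) {FF : Filter F} :
  (forall i, P i -> f i @ F --> l i) ->
  (fun t => \sum_(i <- r | P i) f i t) @ F --> \sum_(i <- r | P i) l i.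
Proof.
move=> H; elim: r => [|i r IH].
  rewrite big_nil; under eq_fun do rewrite big_nil; exact: cvg_cst.
rewrite big_cons; under eq_fun do rewrite big_cons.
by case: ifP => // Pi; apply: cvgD => //; exact: H.
Qed.

Lemma mulmx_continuous m n (M : 'M[R]_(m, n)) :
  continuous (fun t : 'rV[R]_m => t *m M).
Proof.
apply: rV_continuous => j.
have -> : (fun t : 'rV[R]_m => (t *m M) ord0 j) = (fun t => \sum_i t ord0 i * M i j).
  by apply/funext => t; rewrite mxE.
move=> t; apply: (@cvg_bigsum _ (nbhs t)) => i _.
apply: (@cvgM _ _ (nbhs t)); [exact: coord_continuous|exact: cvg_cst].
Qed.

Section Lift.
Variables (K : choiceType) (M : lmodType 'F_2) (f : K -> M).
Implicit Types c d : {freeg K / 'F_2}.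

Lemma F2_neq0 (x : 'F_2) : x != 0 -> x = 1.
Proof.
case: x => [[|[|m]] i] H; first by [].
  exact: val_inj.
by [].
Qed.

(** Over two elements a chain is the plain sum of the generators in its support, so the induction
    needs no scalars. *)
Lemma freeg_ind_gen (Q : K -> Prop) (P : {freeg K / 'F_2} -> Prop) c :
  P 0 -> (forall c d, P c -> P d -> P (c + d)) ->
  (forall x, Q x -> P << x >>) -> (forall x, x \in dom c -> Q x) -> P c.
Proof.
move=> P0 PD PU cQ; rewrite -(freeg_sumE c) big_seq.
elim/big_ind: _ => // x xc; have := xc; rewrite mem_dom => /F2_neq0 ->.
exact/PU/cQ.
Qed.

Lemma fglift0 : fglift f 0 = 0.
Proof. by have := lift_is_additive f 0 0; rewrite subr0 subrr. Qed.

Lemma fgliftD c d : fglift f (c + d) = fglift f c + fglift f d.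
Proof.
have H := lift_is_additive f 0 d; rewrite fglift0 !sub0r in H.
by have := lift_is_additive f c (- d); rewrite H !opprK.
Qed.

Lemma fgliftU x : fglift f << x >> = f x.
Proof. by rewrite liftU scale1r. Qed.

Lemma lmodF2_add (x : M) : x + x = 0.
Proof. by rewrite -[x]scale1r -scalerDl (addF2 1) scale0r. Qed.

Lemma fglift_sum (I : Type) (r : seq I) (P : pred I) (F : I -> {freeg K / 'F_2}) :
  fglift f (\sum_(i <- r | P i) F i) = \sum_(i <- r | P i) fglift f (F i).
Proof. exact: (big_morph _ fgliftD fglift0). Qed.
End Lift.
End Chains.

Section SingularTheory.
Variable R : realType.

Notation simp q := (set_type (@std_simplex R q)).

Lemma simp_ge0 q (t : simp q) i : 0 <= set_val t ord0 i.
Proof. by have [] : @std_simplex R q (set_val t) by exact: set_valP. Qed.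

Lemma simp_sum q (t : simp q) : \sum_i set_val t ord0 i = 1.
Proof. by have [] : @std_simplex R q (set_val t) by exact: set_valP. Qed.

(** Row a holds the barycentric coordinates of the image of vertex a. Faces and pieces of
    subdivisions are all of this kind, so identities between composites reduce to matrix
    products. *)
Definition stoch p q (M : 'M[R]_(p.+1, q.+1)) : Prop :=
  (forall i j, 0 <= M i j) /\ (forall i, \sum_j M i j = 1).

Lemma aff_in p q (M : 'M[R]_(p.+1, q.+1)) (h : stoch M) (t : simp p) :
  set_val t *m M \in @std_simplex R q.
Proof.
case: h => M0 M1; rewrite inE; split=> [j|].
  by rewrite mxE sumr_ge0 // => i _; rewrite mulr_ge0 ?simp_ge0.
under eq_bigr do rewrite mxE.
rewrite exchange_big /= -[RHS](simp_sum t); apply: eq_bigr => i _.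
by rewrite -mulr_sumr M1 mulr1.
Qed.

Definition aff p q (M : 'M[R]_(p.+1, q.+1)) (h : stoch M) (t : simp p) : simp q :=
  SigSub (aff_in h t).

Lemma affE p q (M : 'M[R]_(p.+1, q.+1)) (h : stoch M) (t : simp p) :
  set_val (aff h t) = set_val t *m M.
Proof. by []. Qed.

Lemma aff_continuous p q (M : 'M[R]_(p.+1, q.+1)) (h : stoch M) :
  continuous (aff h).
Proof.
apply: continuous_comp_initial => t.
apply: (@continuous_comp _ _ _ set_val (fun u : 'rV[R]_p.+1 => u *m M)).
  exact: initial_continuous.
exact: mulmx_continuous.
Qed.

HB.instance Definition _ p q M h :=
  @isContinuous.Build _ _ (@aff p q M h) (@aff_continuous p q M h).

Lemma simp_inj q (s t : simp q) : set_val s = set_val t -> s = t.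
Proof. exact: val_inj. Qed.

Definition facemx q (i : 'I_q.+2) : 'M[R]_(q.+1, q.+2) :=
  \matrix_(a, b) (b == lift i a)%:R.

Lemma stoch_face q (i : 'I_q.+2) : stoch (facemx i).
Proof.
split=> [a b|a]; first by rewrite mxE.
rewrite (bigD1 (lift i a)) //= mxE eqxx big1 ?addr0 // => b /negbTE ba.
by rewrite mxE ba.
Qed.

Lemma faceE q (i : 'I_q.+2) (t : simp q) : face i t = aff (stoch_face i) t.
Proof.
apply: simp_inj; apply/rowP => b; rewrite !mxE; case: unliftP => [k ->|->].
  rewrite (bigD1 k) //= mxE eqxx mulr1 big1 ?addr0 // => a ak.
  by rewrite mxE (inj_eq lift_inj) eq_sym (negbTE ak) mulr0.
by rewrite big1 // => a _; rewrite mxE (negbTE (neq_lift _ _)) mulr0.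
Qed.

Lemma stochM p q r (M : 'M[R]_(p.+1, q.+1)) (N : 'M[R]_(q.+1, r.+1)) :
  stoch M -> stoch N -> stoch (M *m N).
Proof.
case=> M0 M1 [N0 N1]; split=> [i j|i].
  by rewrite mxE sumr_ge0 // => k _; rewrite mulr_ge0.
under eq_bigr do rewrite mxE.
rewrite exchange_big /= -[RHS](M1 i); apply: eq_bigr => k _.
by rewrite -mulr_sumr N1 mulr1.
Qed.

Lemma aff_comp p q r (M : 'M[R]_(p.+1, q.+1)) (N : 'M[R]_(q.+1, r.+1))
  (hM : stoch M) (hN : stoch N) (hMN : stoch (M *m N)) t :
  aff hN (aff hM t) = aff hMN t.
Proof. by apply: simp_inj; rewrite !affE mulmxA. Qed.

Lemma eq_aff p q (M N : 'M[R]_(p.+1, q.+1)) (hM : stoch M) (hN : stoch N) t :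
  M = N -> aff hM t = aff hN t.
Proof. by move=> MN; apply: simp_inj; rewrite !affE MN. Qed.

Lemma vtx_in q (i : 'I_q.+1) : (delta_mx 0 i : 'rV[R]_q.+1) \in @std_simplex R q.
Proof.
rewrite inE; split=> [j|]; first by rewrite mxE.
rewrite (bigD1 i) //= mxE !eqxx big1 ?addr0 // => j /negbTE ji.
by rewrite mxE ji andbF.
Qed.

Definition vtx q (i : 'I_q.+1) : simp q := SigSub (vtx_in i).

Lemma face_vtx q (i : 'I_q.+2) (a : 'I_q.+1) : face i (vtx a) = vtx (lift i a).
Proof.
apply: simp_inj; apply/rowP => b; rewrite !mxE; case: unliftP => [k ->|->].
  by rewrite mxE (inj_eq lift_inj).
by rewrite (negbTE (neq_lift _ _)).
Qed.

Section Dim.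
Variable n : nat.
Notation Rn := 'rV[R]_n.
Implicit Types (S : set Rn).

(** Indexed by [nat] to match the cochains; indices above q fall back to vertex 0. *)
Definition vert q (sg : singular R n q) (i : nat) : Rn := sg (vtx (inord i)).

Lemma vert_face q (sg : singular R n q.+1) (j : 'I_q.+2) i : (i <= q)%N ->
  vert (sg \o @face R q j) i = vface j (vert sg) i.
Proof.
move=> iq; rewrite /vert /vface /= face_vtx; congr (sg (vtx _)).
have bq : (bump j i < q.+2)%N by rewrite ltnS; apply: (@leq_add _ _ 1 q); rewrite ?leq_b1.
by apply: val_inj; rewrite /= (inordK bq) inordK.
Qed.

Lemma vert_antipode q (sg : singular R n q) i :
  vert (@antipode R n \o sg) i = - vert sg i.
Proof. by []. Qed.

Definition feval q (f : singular R n q -> 'F_2) : chain R n q -> 'F_2 :=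
  fglift (f : _ -> ('F_2)^o).

Lemma fevalD q f (c d : chain R n q) : feval f (c + d) = feval f c + feval f d.
Proof. exact: (@fgliftD _ ('F_2)^o f c d). Qed.

Lemma feval0 q f : feval f (0 : chain R n q) = 0.
Proof. exact: (@fglift0 _ ('F_2)^o f). Qed.

Lemma fevalU q f (sg : singular R n q) : feval f << sg >> = f sg.
Proof. exact: (@fgliftU _ ('F_2)^o f). Qed.

Lemma feval_sum q f (I : Type) (r : seq I) (P : pred I) (F : I -> chain R n q) :
  feval f (\sum_(i <- r | P i) F i) = \sum_(i <- r | P i) feval f (F i).
Proof. exact: (@fglift_sum _ ('F_2)^o f). Qed.

Lemma bdD q (c d : chain R n q.+1) : bd (c + d) = bd c + bd d.
Proof. exact: fgliftD. Qed.

Lemma bdU q (sg : singular R n q.+1) : bd << sg >> =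
  \sum_(i < q.+2) << (sg \o @face R q i : singular R n q) >>.
Proof. exact: fgliftU. Qed.

Lemma bd0 q : bd (0 : chain R n q.+1) = 0.
Proof. exact: fglift0. Qed.

Lemma antiD q (c d : chain R n q) :
  chain_antipode (c + d) = chain_antipode c + chain_antipode d.
Proof. exact: fgliftD. Qed.

Lemma antiU q (sg : singular R n q) : chain_antipode << sg >> =
  << (@antipode R n \o sg : singular R n q) >>.
Proof. exact: fgliftU. Qed.

Lemma anti0 q : chain_antipode (0 : chain R n q) = 0.
Proof. exact: fglift0. Qed.

Lemma anti_sum q (I : Type) (r : seq I) (P : pred I) (F : I -> chain R n q) :
  chain_antipode (\sum_(i <- r | P i) F i) =
  \sum_(i <- r | P i) chain_antipode (F i).
Proof. exact: fglift_sum. Qed.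

Lemma bd_sum q (I : Type) (r : seq I) (P : pred I) (F : I -> chain R n q.+1) :
  bd (\sum_(i <- r | P i) F i) = \sum_(i <- r | P i) bd (F i).
Proof. exact: fglift_sum. Qed.

Lemma chainDD q (c : chain R n q) : c + c = 0.
Proof. exact: lmodF2_add. Qed.

Definition chain_sup q (P : singular R n q -> Prop) (c : chain R n q) : Prop :=
  forall sg, sg \in dom c -> P sg.

Lemma chain_supD q P (c d : chain R n q) :
  chain_sup P c -> chain_sup P d -> chain_sup P (c + d).
Proof.
by move=> Pc Pd sg /domD_subset; rewrite mem_cat => /orP[/Pc|/Pd].
Qed.

Lemma chain_sup0 q P : @chain_sup q P 0.
Proof. by move=> sg; rewrite dom0. Qed.

Lemma chain_supU q (P : singular R n q -> Prop) sg : P sg -> chain_sup P << sg >>.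
Proof. by move=> Psg sg'; rewrite domU1 inE => /eqP ->. Qed.

Lemma chain_sup_sum q P (I : Type) (r : seq I) (Q : pred I) (F : I -> chain R n q) :
  (forall i, Q i -> chain_sup P (F i)) -> chain_sup P (\sum_(i <- r | Q i) F i).
Proof.
by move=> PF; elim/big_ind: _ => //; [exact: chain_sup0|exact: chain_supD].
Qed.

Lemma chain_ind q (Q : singular R n q -> Prop) (P : chain R n q -> Prop) :
  P 0 -> (forall c d, P c -> P d -> P (c + d)) ->
  (forall sg, Q sg -> P << sg >>) -> forall c, chain_sup Q c -> P c.
Proof. by move=> P0 PD PU c cQ; apply: freeg_ind_gen PU cQ. Qed.

Lemma chain_indT q (P : chain R n q -> Prop) :
  P 0 -> (forall c d, P c -> P d -> P (c + d)) ->
  (forall sg, P << sg >>) -> forall c, P c.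
Proof. by move=> P0 PD PU c; apply: (@chain_ind q (fun=> True)). Qed.

Lemma chain_in_bd S q (c : chain R n q.+1) : chain_in S c -> chain_in S (bd c).
Proof.
move: c; apply: chain_ind => [|c' d'|sg Ssg]; first by rewrite bd0; exact: chain_sup0.
  by rewrite bdD; exact: chain_supD.
by rewrite bdU; apply: chain_sup_sum => i _; apply: chain_supU => t; exact: Ssg.
Qed.

Lemma bd_anti q (c : chain R n q.+1) :
  bd (chain_antipode c) = chain_antipode (bd c).
Proof.
elim/chain_indT: c => [|c d IHc IHd|sg].
- by rewrite anti0 bd0 anti0.
- by rewrite antiD bdD IHc IHd bdD antiD.
rewrite antiU !bdU anti_sum; apply: eq_bigr => i _; rewrite antiU.
by congr (<< _ >>); apply/continuousEP.
Qed.

Lemma sum_offdiag_sym m (V : lmodType 'F_2) (G : 'I_m -> 'I_m -> V) :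
  (forall i j, i != j -> G i j = G j i) ->
  \sum_(i < m) \sum_(j < m | j != i) G i j = 0.
Proof.
move=> Gs.
have -> : \sum_(i < m) \sum_(j < m | j != i) G i j =
   \sum_(i < m) \sum_(j < m | (j < i)%N) G i j +
   \sum_(i < m) \sum_(j < m | (i < j)%N) G i j.
  rewrite -big_split; apply: eq_bigr => i _.
  rewrite (bigID (fun j : 'I_m => (j < i)%N)) /=; congr (_ + _); apply: eq_bigl => j.
    by rewrite andbC andb_idr // => ji; rewrite neq_ltn ji.
  by rewrite -leqNgt ltn_neqAle eq_sym.
rewrite [X in _ + X](exchange_big_dep predT) //=.
have -> : \sum_(j < m) \sum_(i < m | (i < j)%N) G i j =
          \sum_(i < m) \sum_(j < m | (j < i)%N) G i j.
  by apply: eq_bigr => j _; apply: eq_bigr => i ij; rewrite Gs // neq_ltn ij.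
exact: lmodF2_add.
Qed.

Lemma bd_bd q (c : chain R n q.+2) : bd (bd c) = 0.
Proof.
elim/chain_indT: c => [|c d IHc IHd|sg]; first by rewrite !bd0.
  by rewrite !bdD IHc IHd addr0.
rewrite bdU bd_sum.
(* [G i i'] is the face without the vertices i and i', with i deleted first. It does not depend on
   the order, so the terms cancel in pairs. *)
pose G (i i' : 'I_q.+3) : chain R n q :=
  if unlift i i' is Some j then
    << ((sg \o @face R q.+1 i) \o @face R q j : singular R n q) >> else 0.
rewrite -[RHS](@sum_offdiag_sym q.+3 _ G) => [|i i' ii'].
  apply: eq_bigr => i _; rewrite bdU.
  have -> : \sum_(j < q.+3 | j != i) G i j = \sum_(j < q.+2) G i (lift i j).
    by rewrite big_mkcond (bigD1_ord i) //= eqxx add0r; apply: eq_bigr => j _;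
       rewrite eq_sym neq_lift.
  by apply: eq_bigr => j _; rewrite /G liftK.
rewrite /G; case: unliftP ii' => [j i'E _|->]; last by rewrite eqxx.
case: unliftP => [j' iE|iE]; last first.
  by move: i'E; rewrite iE => /eqP; rewrite (negbTE (neq_lift _ _)).
congr (<< _ >>); apply/continuousEP => t /=; congr (sg _).
rewrite !faceE; set M1 := stoch_face _; set M2 := stoch_face _.
set M3 := stoch_face _; set M4 := stoch_face _.
rewrite (aff_comp _ _ (stochM M2 M1)) (aff_comp _ _ (stochM M4 M3)).
apply: eq_aff; apply/matrixP => a b; rewrite !mxE.
have sumE (k : 'I_q.+3) (l : 'I_q.+2) :
    \sum_j0 facemx l a j0 * facemx k j0 b = (b == lift k (lift l a))%:R.
  rewrite (bigD1 (lift l a)) //= !mxE eqxx mul1r big1 ?addr0 // => c cl.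
  by rewrite !mxE (negbTE cl) mul0r.
rewrite !sumE; congr (b == _)%:R; apply: val_inj => /=.
have := congr1 val i'E; have := congr1 val iE; rewrite /= /bump.
have := ltn_ord a; have := ltn_ord j; have := ltn_ord j'.
move: (val a) (val j) (val j') (val i) (val i') => A J J' I I'.
by lia.
Qed.

End Dim.
End SingularTheory.

Section Nu.
Variable R : realType.

Section Signs.
Variable n : nat.
Implicit Types x : 'rV[R]_n.

Definition lexsign x : 'F_2 :=
  [exists i, (0 < x ord0 i) && [forall j : 'I_n, (j < i)%N ==> (x ord0 j == 0)]]%R%:R.

Lemma lexsignE x i : x ord0 i != 0 ->
  (forall j : 'I_n, (j < i)%N -> x ord0 j = 0) -> lexsign x = (0 < x ord0 i)%R%:R.
Proof.
move=> xi H; rewrite /lexsign; congr (_%:R); congr nat_of_bool; apply/existsP/idP.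
  move=> [k /andP[xk /forallP Hk]].
  have [ki|ik|/val_inj <- //] := ltngtP k i.
    by rewrite H // ltxx in xk.
  by have := Hk i; rewrite ik /= (negbTE xi).
move=> x0; exists i; rewrite x0 /=; apply/forallP => j; apply/implyP => /H ->.
by rewrite eqxx.
Qed.

Lemma first_nonzero x : x != 0 ->
  exists2 i, x ord0 i != 0 & forall j : 'I_n, (j < i)%N -> x ord0 j = 0.
Proof.
move=> x0; have [i0 xi0] : exists i, x ord0 i != 0.
  apply/existsP; apply: contraNT x0 => /existsPn H; apply/eqP/rowP => i.
  by rewrite mxE; apply/eqP; rewrite -[_ == _]negbK H.
case: (@arg_minnP _ i0 (fun i => x ord0 i != 0) val xi0) => i xi H.
exists i => // j ji; apply/eqP; apply: contraTT ji => xj.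
by rewrite -leqNgt H.
Qed.

Lemma lexsignN x : x != 0 -> lexsign (- x) = lexsign x + 1.
Proof.
move=> x0; have [i xi H] := first_nonzero x0.
rewrite (lexsignE xi H) (@lexsignE (- x) i); last first.
- by move=> j ji; rewrite mxE H // oppr0.
- by rewrite mxE oppr_eq0.
rewrite mxE oppr_gt0; case: ltgtP xi => //= _ _; rewrite ?add0r //.
by rewrite (addF2 1).
Qed.

(* The sign of coordinate k, with a fallback making it antisymmetric away from 0;
   if it differs at two close points then their coordinate k is small. *)
Definition coordsign (k : nat) x : 'F_2 :=
  if insub k is Some i then
    if x ord0 i == 0 then lexsign x else (0 < x ord0 i)%R%:R
  else lexsign x.

Lemma coordsignN k x : x != 0 -> coordsign k (- x) = coordsign k x + 1.
Proof.
move=> x0; rewrite /coordsign; case: insub => [i|]; last exact: lexsignN.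
rewrite mxE oppr_eq0; case: eqVneq => xi; first exact: lexsignN.
rewrite oppr_gt0; case: ltgtP xi => //= _ _; rewrite ?add0r //.
by rewrite (addF2 1).
Qed.

End Signs.

Section NuFormula.
Variable n : nat.
Variable S : set 'rV[R]_n.
Hypotheses (Ssym : centrally_symmetric S) (S0 : ~ S 0).

Lemma mem_neq0 x : S x -> x != 0.
Proof. by move=> Sx; apply/eqP => x0; apply: S0; rewrite -x0. Qed.

Lemma half_exists q (z : chain R n q) : Csym S z ->
  exists c : chain R n q, chain_in S c /\ z = c + chain_antipode c.
Proof.
move=> [zS Tz].
(* Antipodal simplices are told apart by the lexicographic sign of their first vertex, which is not
   0 because it lies in S. One simplex of each pair is kept. *)
pose pr (sg : singular R n q) : chain R n q :=
  if lexsign (vert sg 0) == 1 then << sg >> else 0.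
pose P : chain R n q -> chain R n q := fglift pr.
have PS : chain_in S (P z).
  rewrite /P; move: (z) zS; apply: chain_ind => [|c d Hc Hd|sg Ssg].
  - by rewrite fglift0; exact: chain_sup0.
  - by rewrite fgliftD; exact: chain_supD.
  - rewrite fgliftU /pr; case: ifP => _; last exact: chain_sup0.
    exact: chain_supU.
exists (P z); split => //.
suff H c : chain_in S c -> c = P c + chain_antipode (P (chain_antipode c)).
  by rewrite {1}(H z zS) Tz.
move: c; apply: chain_ind => [|c d Hc Hd|sg Ssg].
- by rewrite anti0 /P fglift0 anti0 addr0.
- rewrite antiD /P !fgliftD antiD {1}Hc {1}Hd /P -!addrA; congr (_ + _).
  by rewrite addrCA.
- rewrite antiU /P !fgliftU /pr vert_antipode lexsignN; last exact/mem_neq0/Ssg.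
  have [->|/eqP l1] := eqVneq (lexsign (vert sg 0)) 1.
    by rewrite (addF2 1) /= anti0 addr0.
  have -> : lexsign (vert sg 0) = 0.
    by apply/eqP/negPn/negP => /F2_neq0.
  rewrite !add0r eqxx /= antiU; congr (<< _ >>); apply/continuousEP => t /=.
  by rewrite /antipode opprK.
Qed.

Lemma halfP q (z : chain R n q) : Csym S z ->
  chain_in S (Defs.half S z) /\ z = Defs.half S z + chain_antipode (Defs.half S z).
Proof.
move=> zS; have [c cP] := half_exists zS.
by rewrite /Defs.half; case: xgetP => [d -> //|/(_ c)].
Qed.

(** The half c satisfies bd c + T (bd c) = bd z = 0, so bd c is symmetric although c need not be. *)
Lemma Zsym_bd_half q (z : chain R n q.+1) : Zsym S z -> Zsym S (bd (Defs.half S z)).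
Proof.
move=> [zS bz]; have [hS zE] := halfP zS; split; last first.
  by case: q z zS bz hS zE => // q z *; exact: bd_bd.
split; first exact: chain_in_bd.
rewrite -bd_anti.
have -> : chain_antipode (Defs.half S z) = z + Defs.half S z.
  by rewrite {2}zE addrAC chainDD add0r.
by rewrite bdD [bd z]bz add0r.
Qed.

Variable eps : nat -> 'rV[R]_n -> 'F_2.
Hypothesis epsN : forall i x, S x -> eps i (- x) = eps i x + 1.

(** Symmetrising trades the factor [eps 0] for 1. The coboundaries left over belong to the shifted
    family, ready to be moved onto the boundary of c. *)
Lemma feval_precup_sym q (c : chain R n q) : chain_in S c ->
  feval (fun sg => precup q eps (vert sg)) (c + chain_antipode c) =
  feval (fun sg => cobd q (fun i => eps i.+1) (vert sg)) c.
Proof.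
move: c; apply: chain_ind => [|c d Hc Hd|sg Ssg].
- by rewrite anti0 addr0 !feval0.
- by rewrite antiD addrACA !fevalD; congr (_ + _); rewrite -fevalD.
- rewrite antiU fevalD !fevalU; apply: precup_shift1 => i j _.
  by rewrite vert_antipode epsN //; exact: Ssg.
Qed.

End NuFormula.

Lemma feval_precup_bd n q (eps : nat -> 'rV[R]_n -> 'F_2) (c : chain R n q.+1) :
  feval (fun sg => precup q eps (vert sg)) (bd c) =
  feval (fun sg => cobd q.+1 eps (vert sg)) c.
Proof.
elim/chain_indT: c => [|c d Hc Hd|sg]; first by rewrite bd0 !feval0.
  by rewrite bdD !fevalD Hc Hd.
rewrite bdU feval_sum fevalU -precup_cobd; apply: eq_bigr => j _.
rewrite fevalU /precup; congr (eps _ _ * _); first by rewrite vert_face.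
by apply: eq_cobd => i iq; rewrite vert_face.
Qed.

Lemma precup0 n (eps : nat -> 'rV[R]_n -> 'F_2) (c : chain R n 0) :
  feval (fun sg => cobd 0 eps (vert sg)) c = augmentation c.
Proof.
elim/chain_indT: c => [|c d Hc Hd|sg].
- by rewrite feval0 /augmentation fglift0.
- by rewrite fevalD /augmentation fgliftD Hc Hd.
- by rewrite fevalU /augmentation fgliftU /cobd big_ord0.
Qed.

Section NuMap.
Variables (n1 n2 : nat) (S1 : set 'rV[R]_n1) (S2 : set 'rV[R]_n2).
Hypotheses (S1sym : centrally_symmetric S1) (S10 : ~ S1 0).
Variable Psi : forall q, chain R n1 q -> chain R n2 q.
Hypothesis PsiD : forall q (c d : chain R n1 q), Psi (c + d) = Psi c + Psi d.
Hypothesis PsiS : forall q (c : chain R n1 q), chain_in S1 c -> chain_in S2 (Psi c).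
Hypothesis PsiT : forall q (c : chain R n1 q), chain_in S1 c ->
  Psi (chain_antipode c) = chain_antipode (Psi c).
Hypothesis Psib : forall q (c : chain R n1 q.+1), chain_in S1 c ->
  Psi (bd c) = bd (Psi c).
Hypothesis Psia : forall c : chain R n1 0, chain_in S1 c ->
  augmentation (Psi c) = augmentation c.

(* Antisymmetric families eps are arbitrary here, which allows the induction: one
   step peels off [eps 0], replacing z by the boundary of half of it. *)
Lemma nu_map q (z : chain R n1 q) (eps : nat -> 'rV[R]_n2 -> 'F_2) :
  (forall i x, S2 x -> eps i (- x) = eps i x + 1) -> Zsym S1 z ->
  nu S1 z = feval (fun sg => precup q eps (vert sg)) (Psi z).
Proof.
elim: q z eps => [|q IH] z eps epsN zZ.
  have [hS zE] := halfP S10 zZ.1.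
  rewrite {2}zE PsiD PsiT // (feval_precup_sym epsN); last exact: PsiS.
  by rewrite precup0 Psia.
have [hS zE] := halfP S10 zZ.1.
rewrite {2}zE PsiD PsiT // (feval_precup_sym epsN); last exact: PsiS.
rewrite -feval_precup_bd -Psib // -IH => [//||]; last exact: (Zsym_bd_half S10).
by move=> i x; exact: epsN.
Qed.

Lemma Zsym_map q (z : chain R n1 q) : Zsym S1 z -> Zsym S2 (Psi z).
Proof.
move=> [[zS Tz] bz]; split; last first.
  case: q z zS Tz bz => // q z zS Tz bz /=; rewrite -Psib // bz.
  by apply: (addrI (Psi 0)); rewrite -PsiD !addr0.
by split; [exact: PsiS|rewrite -PsiT // Tz].
Qed.

End NuMap.

Section NuOne.
Variable n : nat.
Variable S : set 'rV[R]_n.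
Hypotheses (Ssym : centrally_symmetric S) (S0 : ~ S 0).

Lemma nuE q (z : chain R n q) (eps : nat -> 'rV[R]_n -> 'F_2) :
  (forall i x, S x -> eps i (- x) = eps i x + 1) -> Zsym S z ->
  nu S z = feval (fun sg => precup q eps (vert sg)) z.
Proof. by move=> *; apply: (@nu_map n n S S S0 (fun=> id)). Qed.

Lemma nu_lex q (z : chain R n q) : Zsym S z ->
  nu S z = feval (fun sg => precup q (fun=> @lexsign n) (vert sg)) z.
Proof. by apply: nuE => _ x Sx; rewrite lexsignN //; exact: (mem_neq0 S0). Qed.

Definition nu_nonzero q : Prop := exists2 z : chain R n q, Zsym S z & nu S z != 0.

Lemma coset_self q (z : chain R n q) : Zsym S z -> Zsym S z /\ Bsym S (z - z).
Proof.
move=> zZ; split => //; exists 0; last by rewrite bd0 subrr.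
by split; [exact: chain_sup0|exact: anti0].
Qed.

Lemma nu_star_eq0 q :
  (forall h, @Hsym R n S q h -> nu_star S h = 0) <-> ~ nu_nonzero q.
Proof.
split=> [H [z zZ /eqP]|H h [z zZ <-]]; last first.
  rewrite /nu_star; case: xgetP => [z' _ [z'Z _]|/(_ z)]; last first.
    by case; exact: coset_self.
  by apply/eqP/negPn/negP => nz; apply: H; exists z'.
apply; rewrite -[RHS](H [set z' | Zsym S z' /\ Bsym S (z' - z)]); last by exists z.
rewrite /nu_star; case: xgetP => [z' _ [z'Z [d dS dE]]|/(_ z)]; last first.
  by case; exact: coset_self.
rewrite (nu_lex zZ) (nu_lex z'Z).
have -> : z' = bd d + z by rewrite dE subrK.
(* On a boundary bd d the cochain becomes a product of coboundaries evaluated on d, which takes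
   equal values on a half of d and on its antipode. *)
rewrite fevalD feval_precup_bd.
have [eS eE] := halfP S0 dS; rewrite eE fevalD.
suff -> : feval (fun sg => cobd q.+1 (fun=> @lexsign n) (vert sg))
   (chain_antipode (Defs.half S d)) =
   feval (fun sg => cobd q.+1 (fun=> @lexsign n) (vert sg)) (Defs.half S d).
  by rewrite addF2 add0r.
move: (Defs.half S d) eS; apply: chain_ind => [|c e Hc He|sg Ssg].
- by rewrite anti0.
- by rewrite antiD !fevalD Hc He.
- rewrite antiU !fevalU; apply: cobd_shift1 => i _ _.
  by rewrite vert_antipode lexsignN //; exact/(mem_neq0 S0)/Ssg.
Qed.

End NuOne.
End Nu.

(** * Odd maps and the cross-polytope *)

Section Push.
Variable R : realType.

Lemma odd_map_comp_singular n1 n2 (S : set 'rV[R]_n1) (f : 'rV[R]_n1 -> 'rV[R]_n2)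
    q (sg : singular R n1 q) :
  {within S, continuous f} -> (forall t, S (sg t)) -> continuous (f \o sg).
Proof.
move=> /subspace_continuousP cf Ssg t U Ufx.
have := cf _ (Ssg t) U Ufx; rewrite /= /within /= => H.
have csg : continuous sg by exact: cts_fun.
have H' := csg t _ H.
apply: (@filterS _ (nbhs t) _ _ _ _ H') => u /=; apply; exact: Ssg.
Qed.

(* Junk value: the constant simplex, when the composition is not continuous. *)
Definition push n1 n2 (f : 'rV[R]_n1 -> 'rV[R]_n2) q (sg : singular R n1 q) :
    singular R n2 q :=
  match pselect (continuous (f \o sg)) with
  | left h => mkcts h
  | right _ => cst 0
  end.

Lemma pushE n1 n2 (S : set 'rV[R]_n1) (f : 'rV[R]_n1 -> 'rV[R]_n2)
    q (sg : singular R n1 q) :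
  {within S, continuous f} -> (forall t, S (sg t)) -> push f sg =1 f \o sg.
Proof.
move=> cf Ssg; rewrite /push; case: pselect => // nc.
by case: nc; exact: odd_map_comp_singular cf Ssg.
Qed.

Definition pushc n1 n2 (f : 'rV[R]_n1 -> 'rV[R]_n2) q :
    chain R n1 q -> chain R n2 q :=
  fglift (fun sg => << push f sg >> : chain R n2 q).

(** The cochain of S2 evaluated on pushed chains computes nu on both sides, so the value is
    preserved whatever becomes of the chosen halves. *)
Lemma nu_nonzero_odd_map n1 n2 (S1 : set 'rV[R]_n1) (S2 : set 'rV[R]_n2) f q :
  centrally_symmetric S1 -> ~ S1 0 -> ~ S2 0 -> odd_map S1 S2 f ->
  nu_nonzero S1 q -> nu_nonzero S2 q.
Proof.
move=> S1sym S10 S20 [cf fS fodd] [z zZ znz].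
have PD q' (c d : chain R n1 q') : pushc f (c + d) = pushc f c + pushc f d.
  exact: fgliftD.
have P0 q' : pushc f (0 : chain R n1 q') = 0 by exact: fglift0.
have PU q' (sg : singular R n1 q') : pushc f << sg >> = << push f sg >>.
  exact: fgliftU.
have Psum q' (I : Type) (r : seq I) (P : pred I) (F : I -> chain R n1 q') :
    pushc f (\sum_(i <- r | P i) F i) = \sum_(i <- r | P i) pushc f (F i).
  exact: fglift_sum.
have PS q' (c : chain R n1 q') : chain_in S1 c -> chain_in S2 (pushc f c).
  move: c; apply: chain_ind => [|c d Hc Hd|sg Ssg].
  - by rewrite P0; exact: chain_sup0.
  - by rewrite PD; exact: chain_supD.
  - rewrite PU; apply: chain_supU => t; rewrite (pushE cf Ssg) /=; exact/fS/Ssg.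
have PT q' (c : chain R n1 q') : chain_in S1 c ->
    pushc f (chain_antipode c) = chain_antipode (pushc f c).
  move: c; apply: chain_ind => [|c d Hc Hd|sg Ssg].
  - by rewrite anti0 P0 anti0.
  - by rewrite antiD !PD Hc Hd antiD.
  - rewrite antiU !PU antiU; congr (<< _ >>); apply/continuousEP => t /=.
    rewrite (pushE cf Ssg) (pushE cf) /=; last by move=> u; apply/S1sym/Ssg.
    by rewrite /antipode fodd.
have Pb q' (c : chain R n1 q'.+1) : chain_in S1 c ->
    pushc f (bd c) = bd (pushc f c).
  move: c; apply: chain_ind => [|c d Hc Hd|sg Ssg].
  - by rewrite bd0 !P0 bd0.
  - by rewrite bdD !PD Hc Hd bdD.
  - rewrite PU !bdU Psum; apply: eq_bigr => i _.
    rewrite PU; congr (<< _ >>); apply/continuousEP => t /=.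
    by rewrite (pushE cf Ssg) (pushE cf) // => u; exact: Ssg.
have Pa (c : chain R n1 0) : chain_in S1 c ->
    augmentation (pushc f c) = augmentation c.
  move: c; apply: chain_ind => [|c d Hc Hd|sg Ssg].
  - by rewrite P0 /augmentation !fglift0.
  - by rewrite PD /augmentation !fgliftD -!/(augmentation _) Hc Hd.
  - by rewrite PU /augmentation !fgliftU.
exists (pushc f z); first exact: (Zsym_map PD PS PT Pb).
have eN (i : nat) (x : 'rV[R]_n2) : S2 x -> lexsign (- x) = lexsign x + 1.
  by move=> Sx; rewrite lexsignN //; exact: (mem_neq0 S20).
rewrite nu_lex //; last exact: (Zsym_map PD PS PT Pb).
by rewrite -(nu_map S10 PD PS PT Pb Pa (eps := fun=> @lexsign R n2) eN zZ).
Qed.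

Lemma linsg_continuous q n (A : 'M[R]_(q.+1, n)) :
  continuous (fun t : set_type (@std_simplex R q) => set_val t *m A).
Proof.
move=> t; apply: (@continuous_comp _ _ _ set_val (fun u : 'rV[R]_q.+1 => u *m A)).
  exact: initial_continuous.
exact: mulmx_continuous.
Qed.

Definition linsg q n (A : 'M[R]_(q.+1, n)) : singular R n q :=
  mkcts (@linsg_continuous q n A).

Lemma linsgE q n (A : 'M[R]_(q.+1, n)) t : linsg A t = set_val t *m A.
Proof. by []. Qed.

Lemma linsg_face q n (A : 'M[R]_(q.+2, n)) (i : 'I_q.+2) :
  (linsg A \o @face R q i : singular R n q) = linsg (facemx R i *m A).
Proof.
by apply/continuousEP => t /=; rewrite !linsgE faceE affE mulmxA.
Qed.

Lemma linsg_antipode q n (A : 'M[R]_(q.+1, n)) :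
  (@antipode R n \o linsg A : singular R n q) = linsg (- A).
Proof. by apply/continuousEP => t /=; rewrite /antipode !linsgE mulmxN. Qed.

Lemma vert_linsg q n (A : 'M[R]_(q.+1, n)) i : vert (linsg A) i = row (inord i) A.
Proof. by rewrite /vert linsgE rowE. Qed.

Section CrossPolytope.
Variables (k q : nat).
Hypothesis qk : (q < k)%N.

Definition crossmx (s : {ffun 'I_q.+1 -> bool}) : 'M[R]_(q.+1, k) :=
  \matrix_(a, b) ((val a == val b)%:R * (-1) ^+ s a).

(* The boundary of the cross-polytope of dimension q+1, a symmetric cycle with
   nu = 1. *)
Definition cross : chain R k q := \sum_s << linsg (crossmx s) >>.

Lemma crossmx_coord s (t : 'rV[R]_q.+1) (a : 'I_q.+1) :
  (t *m crossmx s) ord0 (widen_ord qk a) = t ord0 a * (-1) ^+ s a.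
Proof.
rewrite mxE (bigD1 a) //= mxE /= eqxx mul1r big1 ?addr0 // => c ca.
by rewrite mxE /= (inj_eq val_inj) (negbTE ca) mul0r mulr0.
Qed.

Lemma cross_in : chain_in [set x | x <> 0] cross.
Proof.
apply: chain_sup_sum => s _; apply: chain_supU => t /=; rewrite linsgE => t0.
have : \sum_i set_val t ord0 i = 0.
  apply: big1 => a _; have /rowP/(_ (widen_ord qk a)) := t0.
  rewrite crossmx_coord mxE => /eqP; rewrite mulf_eq0 expf_eq0 oppr_eq0 oner_eq0 andbF orbF.
  by move=> /eqP.
by rewrite simp_sum => /eqP; rewrite oner_eq0.
Qed.

Definition flip (s : {ffun 'I_q.+1 -> bool}) : {ffun 'I_q.+1 -> bool} :=
  [ffun a => ~~ s a].

Lemma flipK : involutive flip.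
Proof. by move=> s; apply/ffunP => a; rewrite !ffunE negbK. Qed.

Lemma crossmx_flip s : crossmx (flip s) = - crossmx s.
Proof.
by apply/matrixP => a b; rewrite !mxE ffunE; case: (s a); rewrite /= ?mulrN ?opprK ?expr1 ?expr0 ?mulrN ?opprK.
Qed.

Lemma cross_sym : chain_antipode cross = cross.
Proof.
rewrite /cross anti_sum [RHS](reindex_inj (can_inj flipK)) /=.
by apply: eq_bigr => s _; rewrite antiU linsg_antipode crossmx_flip.
Qed.

End CrossPolytope.

(** P splits the indices into two classes exchanged by h, so h has no fixed point and equal terms
    cancel mod 2. *)
Lemma sum_invol0 n q (I : finType) (P : pred I) (h : I -> I) (G : I -> chain R n q) :
  involutive h -> (forall i, P (h i) = ~~ P i) -> (forall i, G (h i) = G i) ->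
  \sum_i G i = 0.
Proof.
move=> hK Ph Gh; rewrite (bigID P) /= [X in _ + X](reindex_inj (can_inj hK)) /=.
have -> : \sum_(i | ~~ P (h i)) G (h i) = \sum_(i | P i) G i.
  by apply: eq_big => i; rewrite ?Ph ?negbK.
exact: chainDD.
Qed.

(** Face i does not see the sign of vertex i, so flipping that sign pairs the faces off. *)
Lemma cross_cycle k q : is_cycle (cross k q).
Proof.
case: q => [//|q] /=; rewrite /cross bd_sum.
under eq_bigr do rewrite bdU.
rewrite exchange_big big1 //= => i _.
pose h (s : {ffun 'I_q.+2 -> bool}) : {ffun 'I_q.+2 -> bool} :=
  [ffun a => if a == i then ~~ s a else s a].
apply: (@sum_invol0 _ _ _ (fun s : {ffun 'I_q.+2 -> bool} => s i) h) => [s|s|s].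
- by apply/ffunP => a; rewrite !ffunE; case: eqP => //; rewrite negbK.
- by rewrite ffunE eqxx.
- rewrite !linsg_face; congr (<< linsg _ >>); apply/matrixP => a b; rewrite !mxE.
  apply: eq_bigr => c _; rewrite !mxE ffunE; case: (c =P i) => [->|//].
  by rewrite (negbTE (neq_lift _ _)) !mul0r.
Qed.

Lemma nu_cross k q : (q < k)%N -> nu_nonzero (R := R) [set x : 'rV[R]_k | x <> 0] q.
Proof.
move=> qk.
have sym : centrally_symmetric [set x : 'rV[R]_k | x <> 0].
  by move=> x /= x0 /eqP; rewrite oppr_eq0 => /eqP.
have n0 : ~ [set x : 'rV[R]_k | x <> 0] 0 by move=> /=; apply.
have zZ : Zsym [set x : 'rV[R]_k | x <> 0] (cross k q).
  by split; [split; [exact: cross_in|exact: cross_sym]|exact: cross_cycle].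
exists (cross k q) => //.
have eN i x : [set x : 'rV[R]_k | x <> 0] x -> coordsign i (- x) = coordsign i x + 1.
  by move=> /= /eqP x0; exact: coordsignN.
rewrite (nuE n0 eN zZ) /cross feval_sum.
have coordE (s : {ffun 'I_q.+1 -> bool}) (a : 'I_q.+1) (b : nat) : (b < k)%N ->
    coordsign b (row a (crossmx k s)) = (~~ s a)%:R.
  move=> bk.
  have rE (c : 'I_k) : (row a (crossmx k s)) ord0 c = (val a == val c)%:R * (-1) ^+ s a.
    by rewrite !mxE.
  have lE : lexsign (row a (crossmx k s)) = (~~ s a)%:R.
    rewrite (@lexsignE _ _ _ (widen_ord qk a)) ?rE /= ?eqxx ?mul1r.
    - by case: (s a); rewrite /= ?expr1 ?expr0 ?oppr_gt0 ?ltr10 ?ltr01.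
    - by rewrite expf_neq0 // oppr_eq0 oner_eq0.
    - by move=> j ja; rewrite rE eq_sym (ltn_eqF ja) mul0r.
  rewrite /coordsign insubT rE; case: eqVneq => //= ab.
  have -> : (val a == b) = true by apply: contraNT ab => /negbTE /= ->; rewrite mul0r.
  by rewrite mul1r; case: (s a); rewrite /= ?expr1 ?expr0 ?oppr_gt0 ?ltr10 ?ltr01.
have termE (s : {ffun 'I_q.+1 -> bool}) :
    feval (fun sg => precup q (@coordsign R k) (vert sg)) << linsg (crossmx k s) >> =
    (~~ s ord0)%:R * \prod_(i < q) ((~~ s (inord i))%:R + (~~ s (inord i.+1))%:R).
  rewrite fevalU /precup vert_linsg coordE; last exact: leq_ltn_trans qk.
  congr ((~~ s _)%:R * _); first by apply: val_inj; rewrite /= inordK.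
  apply: eq_bigr => i _; rewrite !vert_linsg !coordE //;
    by apply: leq_ltn_trans qk; exact: ltn_ord.
(* The factors force the first sign to be positive and consecutive signs to differ, so a single
   alternating pattern contributes. *)
pose s0 : {ffun 'I_q.+1 -> bool} := [ffun a : 'I_q.+1 => odd a].
rewrite (bigD1 s0) //= termE ffunE /= mul1r.
have -> : \prod_(i < q) ((~~ s0 (inord i))%:R + (~~ s0 (inord i.+1))%:R) = 1 :> 'F_2.
  apply: big1 => i _; rewrite !ffunE !inordK ?ltnS //; last by rewrite ltnW.
  by rewrite /= negbK; case: odd; rewrite /= ?addr0 ?add0r.
rewrite big1 ?addr0 ?oner_neq0 // => s ss0; rewrite termE; apply/eqP.
apply: contraNT ss0; rewrite mulf_eq0 negb_or => /andP[sh sp].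
have s00 : s ord0 = false by move: sh; case: (s ord0) => //; rewrite eqxx.
apply/eqP/ffunP => a; rewrite ffunE.
have H j : (j <= q)%N -> s (inord j) = odd j.
  elim: j => [_|j IH jq].
    by rewrite /= -s00; congr (s _); apply: val_inj; rewrite /= inordK.
  have := sp; rewrite prodf_seq_neq0 => /allP /(_ (Ordinal jq)).
  rewrite mem_index_enum => /(_ isT) /=; rewrite IH ?(ltnW jq) //.
  case: odd; case: (s _) => //=; rewrite ?(addF2 1) ?addr0 ?eqxx //.
by rewrite -(H a) ?inord_val // -ltnS.
Qed.
End Push.

(** * Compactness and uniform continuity of singular simplices *)

Section Subdivision.
Variable R : realType.

Lemma closed_ge0 (T : topologicalType) (f : T -> R) :
  continuous f -> closed [set x | 0 <= f x].
Proof.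
move=> cf; have -> : [set x | 0 <= f x] = f @^-1` [set y | 0 <= y] by [].
by apply: closed_comp; [move=> x _; exact: cf|exact: closed_ge].
Qed.

Lemma closed_level (T : topologicalType) (f : T -> R) (c : R) :
  continuous f -> closed [set x | f x = c].
Proof.
move=> cf; have -> : [set x | f x = c] = f @^-1` [set y | y = c] by [].
by apply: closed_comp; [move=> x _; exact: cf|exact: closed_eq].
Qed.

Lemma closed_forall (T : topologicalType) (I : Type) (P : I -> T -> Prop) :
  (forall i, closed [set x | P i x]) -> closed [set x | forall i, P i x].
Proof.
move=> H; have -> : [set x | forall i, P i x] = \bigcap_i [set x | P i x].
  by apply/seteqP; split=> [x Hx i _|x Hx i]; [exact: Hx|exact: (Hx i Logic.I)].
by apply: closed_bigI => i _; exact: H.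
Qed.

Lemma compact_rV n (A : set 'rV[R]_n) (M : R) : closed A ->
  (forall x i, A x -> `|x ord0 i| <= M) -> compact A.
Proof.
move=> Acl AM.
have cM : compact [set v : 'rV[R]_n | forall i, v ord0 i \in `[(- M), M]].
  apply: (@rV_compact _ _ (fun=> `[(- M), M]%classic)) => _.
  exact: segment_compact.
by apply: subclosed_compact Acl cM _ => v Av i /=; rewrite in_itv /= -ler_norml AM.
Qed.

Lemma continuous_rsum (T : topologicalType) (I : Type) (r : seq I) (P : pred I) (f : I -> T -> R) :
  (forall i, P i -> continuous (f i)) ->
  continuous (fun x => \sum_(i <- r | P i) f i x).
Proof. by move=> cf x; apply: (@cvg_bigsum R T (nbhs x)) => i Pi; exact: cf. Qed.

Lemma compact_std_simplex q : compact (@std_simplex R q).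
Proof.
apply: (@compact_rV _ _ 1) => [|x i [x0 x1]].
  have -> : @std_simplex R q = [set t | forall i, 0 <= t ord0 i] `&`
      [set t | \sum_i t ord0 i = 1] by [].
  apply: closedI.
    by apply: closed_forall => i; apply: closed_ge0; exact: coord_continuous.
  by apply: closed_level; apply: continuous_rsum => i _; exact: coord_continuous.
rewrite ger0_norm // -x1 (bigD1 i) //= lerDl; exact: sumr_ge0.
Qed.

(** Heine-Cantor on the compact simplex. It is stated coordinatewise because the size of subdivision
    pieces and the sign changes are both controlled coordinate by coordinate. *)
Lemma singular_unif_continuous n q (sg : singular R n q) (d : R) : 0 < d ->
  exists2 e : R, 0 < e & forall t u : set_type (@std_simplex R q),
    (forall b, `|set_val t ord0 b - set_val u ord0 b| < e) ->
    forall i, `|sg t ord0 i - sg u ord0 i| < d.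
Proof.
move=> d0; pose A := @std_simplex R q.
pose g : 'rV[R]_q.+1 -> 'rV[R]_n := valL (sg : set_type A -> 'rV[R]_n).
have cg : {within A, continuous g}.
  by apply/subspace_valL_continuousP; exact: cts_fun.
have gE t : g (set_val t) = sg t.
  by have /(congr1 (fun f => f t)) := valLK point (sg : set_type A -> 'rV[R]_n).
have nc : near_covering_within A.
  apply/near_covering_withinP/compact_near_coveringP; exact: compact_std_simplex.
pose P (e : R) (t : 'rV[R]_q.+1) := forall u, A u ->
   (forall b, `|t ord0 b - u ord0 b| < e) -> forall i, `|g t ord0 i - g u ord0 i| < d.
have : \forall e \near 0^'+, A `<=` P e.
  apply: nc => x Ax.
  have d2 : 0 < d / 2 by rewrite divr_gt0.
  have [r r0 rP] : exists2 r : R, 0 < r & forall u, A u ->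
      (forall b, `|x ord0 b - u ord0 b| < r) -> forall i, `|g x ord0 i - g u ord0 i| < d / 2.
    have /subspace_continuousP /(_ x Ax) := cg.
    move=> /(_ (ball (g x) (d / 2)) (nbhsx_ballx _ _ d2)).
    rewrite /= /within /= => /nbhs_ballP [r /= r0 rP]; exists r => // u Au xu i.
    have [_ /(_ ord0 i)] : ball (g x) (d / 2) (g u).
      apply: rP => //; split => // a b; rewrite [a]ord1; exact: xu.
    by [].
  have r2 : 0 < r / 2 by rewrite divr_gt0.
  have N1 : nbhs x [set t : 'rV[R]_q.+1 | forall b, `|x ord0 b - t ord0 b| < r / 2].
    by apply: filterS (nbhsx_ballx x _ r2) => t [_ H] b; exact: (H ord0 b).
  have N2 : \forall e \near (0 : R)^'+, e < r / 2.
    by apply: nbhs_right_lt.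
  exists ([set t : 'rV[R]_q.+1 | forall b, `|x ord0 b - t ord0 b| < r / 2],
    [set e | e < r / 2]) => // -[t e] /= [H1 H2] At u Au tu i.
  have hx : `|g x ord0 i - g t ord0 i| < d / 2.
    apply: rP => // b; apply: lt_trans (H1 b) _; lra.
  have hu : `|g x ord0 i - g u ord0 i| < d / 2.
    apply: rP => // b; have := H1 b; have := tu b.
    have := ler_distD (t ord0 b) (x ord0 b) (u ord0 b); lra.
  have := ler_distD (g x ord0 i) (g t ord0 i) (g u ord0 i).
  rewrite [`|g t _ _ - g x _ _|]distrC; lra.
move=> H; have [e [He e0]] : exists e : R, A `<=` P e /\ 0 < e.
  apply: (@filter_ex _ (0 : R)^'+); apply: filterI H _.
  exact: nbhs_right_gt.
exists e => // t u tu i; rewrite -!gE; apply: He => //; exact: set_valP.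
Qed.
End Subdivision.

(** * Barycentric subdivision *)

Section Barycentric.
Variable R : realType.

(* Row a is the barycentre of the vertices s 0, ..., s a. *)
Definition barymx q (s : 'S_q.+1) : 'M[R]_q.+1 :=
  \matrix_(a, b) (((s^-1)%g b <= a)%N%:R / a.+1%:R).

Lemma barymxE q (s : 'S_q.+1) a c : barymx s a (s c) = (c <= a)%N%:R / a.+1%:R.
Proof. by rewrite mxE permK. Qed.

Lemma stoch_bary q (s : 'S_q.+1) : stoch (barymx s).
Proof.
split=> [a b|a]; first by rewrite mxE divr_ge0.
rewrite (reindex_inj (@perm_inj _ s)) /=; under eq_bigr do rewrite barymxE.
rewrite -mulr_suml.
have -> : \sum_(c < q.+1) (c <= a)%N%:R = a.+1%:R :> R.
  rewrite (eq_bigr (fun c : 'I_q.+1 => if (c < a.+1)%N then 1 else 0)) => [|c _].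
    by rewrite -big_mkcond big_ord_narrow /= ?ltn_ord // sumr_const card_ord.
  by rewrite ltnS; case: leq.
by rewrite divff // pnatr_eq0.
Qed.

Definition osc p q (M : 'M[R]_(p, q)) (d : R) : Prop :=
  forall b, exists lo, forall c, lo <= M c b <= lo + d.

(* All the rows of a barycentric matrix put mass at least 1/(q+1) on column
   [s 0]; hence multiplication by it contracts oscillations. *)
Lemma osc_bary q p (s : 'S_q.+1) (M : 'M[R]_(q.+1, p)) d : osc M d ->
  osc (barymx s *m M) ((1 - q.+1%:R^-1) * d).
Proof.
move=> oM b; have [lo loP] := oM b; pose eta : R := q.+1%:R^-1.
pose c0 := s ord0; exists (eta * M c0 b + (1 - eta) * lo) => a.
have [B0 B1] := stoch_bary s.
have etaB : eta <= barymx s a c0.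
  by rewrite barymxE leq0n mul1r lef_pV2 ?posrE ?ltr0n // ler_nat.
have E : (barymx s *m M) a b - (eta * M c0 b + (1 - eta) * lo) =
    (barymx s a c0 - eta) * (M c0 b - lo) +
    \sum_(c | c != c0) barymx s a c * (M c b - lo).
  have -> : (barymx s *m M) a b =
      \sum_c barymx s a c * (M c b - lo) + (\sum_c barymx s a c) * lo.
    rewrite mxE mulr_suml -big_split; apply: eq_bigr => c _ /=.
    by rewrite mulrBr subrK.
  by rewrite B1 (bigD1 c0) //=; ring.
have lM c : 0 <= M c b - lo by have /andP[] := loP c; rewrite subr_ge0.
have uM c : M c b - lo <= d by have /andP[_] := loP c; rewrite lerBlDl.
have T0 : 0 <= \sum_(c | c != c0) barymx s a c * (M c b - lo).
  by apply: sumr_ge0 => c _; rewrite mulr_ge0.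
have T1 : \sum_(c | c != c0) barymx s a c * (M c b - lo) <=
          (\sum_(c | c != c0) barymx s a c) * d.
  by rewrite mulr_suml; apply: ler_sum => c _; rewrite ler_wpM2l.
have T2 : barymx s a c0 + \sum_(c | c != c0) barymx s a c = 1.
  by rewrite -(B1 a) [RHS](bigD1 c0).
have h0 : 0 <= (barymx s a c0 - eta) * (M c0 b - lo) by rewrite mulr_ge0 ?lM // subr_ge0.
have h1 : (barymx s a c0 - eta) * (M c0 b - lo) <= (barymx s a c0 - eta) * d.
  by rewrite ler_wpM2l ?subr_ge0.
apply/andP; split; first by rewrite -subr_ge0 E addr_ge0.
rewrite -lerBlDl E -/eta; apply: le_trans (lerD h1 T1) _.
by rewrite -mulrDl addrAC T2.
Qed.

Section Sd.
Variable n : nat.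

Definition sd q : chain R n q -> chain R n q :=
  fglift (fun sg : singular R n q =>
    \sum_(s : 'S_q.+1) (<< (sg \o @aff R q q _ (stoch_bary s) : singular R n q) >>
      : chain R n q)).

Lemma sdD q (c d : chain R n q) : sd (c + d) = sd c + sd d.
Proof. exact: fgliftD. Qed.

Lemma sd0 q : sd (0 : chain R n q) = 0.
Proof. exact: fglift0. Qed.

Lemma sdU q (sg : singular R n q) : sd << sg >> =
  \sum_(s : 'S_q.+1) << (sg \o @aff R q q _ (stoch_bary s) : singular R n q) >>.
Proof. exact: fgliftU. Qed.

Lemma sd_sum q (I : Type) (r : seq I) (P : pred I) (F : I -> chain R n q) :
  sd (\sum_(i <- r | P i) F i) = \sum_(i <- r | P i) sd (F i).
Proof. exact: fglift_sum. Qed.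

Lemma sd_in S q (c : chain R n q) : chain_in S c -> chain_in S (sd c).
Proof.
move: c; apply: chain_ind => [|c d Hc Hd|sg Ssg].
- by rewrite sd0; exact: chain_sup0.
- by rewrite sdD; exact: chain_supD.
- by rewrite sdU; apply: chain_sup_sum => s _; apply: chain_supU => t; exact: Ssg.
Qed.

Lemma sd_anti q (c : chain R n q) : sd (chain_antipode c) = chain_antipode (sd c).
Proof.
elim/chain_indT: c => [|c d Hc Hd|sg]; first by rewrite anti0 !sd0 anti0.
  by rewrite antiD !sdD Hc Hd antiD.
rewrite antiU !sdU anti_sum; apply: eq_bigr => s _; rewrite antiU.
by congr (<< _ >>); apply/continuousEP.
Qed.

Lemma sd_aug (c : chain R n 0) : augmentation (sd c) = augmentation c.
Proof.
elim/chain_indT: c => [|c d Hc Hd|sg]; first by rewrite sd0.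
  by rewrite sdD /augmentation !fgliftD -!/(augmentation _) Hc Hd.
rewrite sdU /augmentation fglift_sum !fgliftU.
under eq_bigr do rewrite fgliftU.
rewrite (bigD1 1%g) //= big1 ?addr0 // => s; case/eqP; apply/perm.permP => i.
by rewrite !ord1.
Qed.

Lemma sg_aff_face q (sg : singular R n q.+1) (s : 'S_q.+2) (j : 'I_q.+2) t :
  (sg \o @aff R _ _ _ (stoch_bary s)) (@face R q j t) =
  sg (aff (stochM (stoch_face R j) (stoch_bary s)) t).
Proof.
by rewrite /= faceE (aff_comp _ _ (stochM (stoch_face R j) (stoch_bary s))).
Qed.

Lemma facemx_mul q p (j : 'I_q.+2) (B : 'M[R]_(q.+2, p)) a b :
  (facemx R j *m B) a b = B (lift j a) b.
Proof.
rewrite mxE (bigD1 (lift j a)) //= mxE eqxx mul1r big1 ?addr0 // => c cl.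
by rewrite mxE (negbTE cl) mul0r.
Qed.

(** A full flag of the simplex is a facet, given by the vertex added last, with a full flag of that
    facet. Injectivity suffices by counting factorials. *)
Lemma lift_perm_bij q :
  bijective (fun u : 'I_q.+2 * 'S_q.+1 => lift_perm ord_max u.1 u.2).
Proof.
apply: inj_card_bij; last first.
  by rewrite card_prod card_ord !card_Sn -factS.
move=> [i s] [j t] /= E; have ij : i = j.
  by have := congr1 (fun p : 'S_q.+2 => p ord_max) E; rewrite /= !lift_perm_id.
rewrite -ij in E *; congr (_, _); apply/perm.permP => a.
have := congr1 (fun p : 'S_q.+2 => p (lift ord_max a)) E.
by rewrite /= !lift_perm_lift => /lift_inj.
Qed.

(** A face omitting any barycentre but the top one is shared by two flags that differ by an adjacent
    transposition, hence cancels. The faces omitting the top barycentre make up the subdivisions of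
    the facets. *)
Lemma sd_bd q (c : chain R n q.+1) : sd (bd c) = bd (sd c).
Proof.
elim/chain_indT: c => [|c d Hc Hd|sg]; first by rewrite bd0 !sd0 bd0.
  by rewrite bdD !sdD Hc Hd bdD.
rewrite bdU sd_sum sdU bd_sum; under [RHS]eq_bigr do rewrite bdU.
rewrite [RHS]exchange_big [RHS]big_ord_recr /=.
rewrite [X in _ = X + _]big1 ?add0r => [|j _]; last first.
  set j' := widen_ord _ j; pose j1 : 'I_q.+2 := Ordinal (ltn_ord (lift ord0 j)).
  pose h (s : 'S_q.+2) : 'S_q.+2 := (tperm j' j1 * s)%g.
  apply: (@sum_invol0 _ _ _ _ (fun s : 'S_q.+2 => (s j' < s j1)%N) h) => [s|s|s].
  - by rewrite /h mulgA tperm2 mul1g.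
  - rewrite !permM tpermL tpermR -leqNgt [RHS]leq_eqVlt.
    have ne : (s j1 == s j') = false.
      by rewrite (inj_eq perm_inj) -(inj_eq val_inj) /= gtn_eqF.
    by rewrite -(inj_eq val_inj) in ne; rewrite [X in X || _]ne.
  - congr (<< _ >>); apply/continuousEP => t; rewrite [LHS]sg_aff_face [RHS]sg_aff_face.
    congr (sg _); apply: eq_aff; apply/matrixP => a b; rewrite !facemx_mul !mxE.
    congr (_%:R / _); congr nat_of_bool.
    have := neq_lift j' a; rewrite /h invMg permM tpermV; set l := lift j' a.
    move: ((s^-1)%g b) => c jl.
    have jl' : (nat_of_ord j == nat_of_ord l) = false by apply/negbTE.
    have E : (j1 <= l)%N = (j' <= l)%N.
      by change ((j < l)%N = (j <= l)%N); rewrite [RHS]leq_eqVlt jl'.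
    by case: tpermP => [->|->|//].
under eq_bigr do rewrite sdU.
rewrite pair_big /= [RHS](reindex _ (onW_bij _ (lift_perm_bij q))) /=.
apply: eq_bigr => -[i s] _ /=; congr (<< _ >>); apply/continuousEP => t.
rewrite [RHS]sg_aff_face /= faceE.
rewrite (aff_comp _ _ (stochM (stoch_bary s) (stoch_face R i))).
congr (sg _); apply: eq_aff; apply/matrixP => a b; rewrite facemx_mul.
rewrite !mxE; case: (unliftP i b) => [c ->|->].
  rewrite (bigD1 c) //= !mxE eqxx mulr1 big1 ?addr0 => [|c' c'c].
    have -> : ((lift_perm ord_max i s)^-1)%g (lift i c) = lift ord_max ((s^-1)%g c).
      by apply: (@perm_inj _ (lift_perm ord_max i s)); rewrite permKV lift_perm_lift permKV.
    by rewrite lift_max -[bump q.+1 a]/(nat_of_ord (lift ord_max a)) lift_max.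
  by rewrite !mxE (inj_eq lift_inj) eq_sym (negbTE c'c) mulr0.
rewrite big1 => [|c _]; last by rewrite !mxE (negbTE (neq_lift _ _)) mulr0.
have -> : ((lift_perm ord_max i s)^-1)%g i = ord_max.
  by apply: (@perm_inj _ (lift_perm ord_max i s)); rewrite permKV lift_perm_id.
by rewrite lift_max leqNgt (ltn_ord a) mul0r.
Qed.

Definition theta q : R := 1 - q.+1%:R^-1.

Lemma theta01 q : 0 <= theta q < 1.
Proof.
rewrite /theta subr_ge0 invf_le1 ?ltr0n // ler1n /= ltrBlDr ltrDl invr_gt0.
by rewrite ltr0n.
Qed.

Definition piece q (sg : singular R n q) m (tau : singular R n q) : Prop :=
  exists (M : 'M[R]_q.+1) (h : stoch M), osc M (theta q ^+ m) /\
    tau =1 sg \o @aff R q q M h.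

Lemma piece_sd q (sg : singular R n q) m :
  chain_sup (piece sg m) (iter m (@sd q) << sg >>).
Proof.
elim: m => [|m IH] /=.
  have h1 : stoch (1%:M : 'M[R]_q.+1).
    split=> [a b|a]; first by rewrite mxE.
    rewrite (bigD1 a) //= mxE eqxx big1 ?addr0 // => b /negbTE ba.
    by rewrite mxE eq_sym ba.
  apply: chain_supU; exists 1%:M, h1; split=> [b|t].
    by exists 0 => c; rewrite mxE add0r expr0; case: eqP; rewrite /= ?lexx ?ler01.
  by rewrite /=; congr (sg _); apply: simp_inj; rewrite affE mulmx1.
move: (iter m _ _) IH; apply: chain_ind => [|c d Hc Hd|tau [M [h [oM tauE]]]].
- by rewrite sd0; exact: chain_sup0.
- by rewrite sdD; exact: chain_supD.
- rewrite sdU; apply: chain_sup_sum => s _; apply: chain_supU.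
  exists (barymx s *m M), (stochM (stoch_bary s) h); split.
    by rewrite exprS; exact: osc_bary.
  by move=> t; rewrite /= tauE /= (aff_comp _ _ (stochM (stoch_bary s) h)).
Qed.

End Sd.
End Barycentric.

(** * Comparison of the indices *)

Section BorsukUlam.
Variable R : realType.

Lemma expr_lt_small (x e : R) : 0 <= x < 1 -> 0 < e ->
  exists m0, forall m, (m0 <= m)%N -> x ^+ m < e.
Proof.
move=> /andP[x0 x1] e0.
have cv : (fun m => x ^+ m) @ \oo --> (0 : R) by apply: cvg_expr; rewrite ger0_norm.
have /cvgrPdist_lt /(_ e e0) [m0 _ H] := cv.
by exists m0 => m /H /=; rewrite sub0r normrN ger0_norm ?exprn_ge0.
Qed.

Lemma coordsign_close k (b : 'I_k) (x y : 'rV[R]_k) (d : R) :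
  `|x ord0 b - y ord0 b| < d -> coordsign b x + coordsign b y != 0 ->
  `|x ord0 b| < d.
Proof.
move=> xy; apply: contraNT; rewrite -leNgt => dx; rewrite /coordsign.
rewrite valK; have [x0|x0] := eqVneq (x ord0 b) 0.
  have := le_lt_trans (normr_ge0 _) xy; rewrite x0 normr0 in dx; lra.
have xy' : `|x ord0 b - y ord0 b| < `|x ord0 b| by exact: lt_le_trans dx.
have [y0|y0] := eqVneq (y ord0 b) 0; first by rewrite y0 subr0 ltxx in xy'.
suff -> : (0 < x ord0 b) = (0 < y ord0 b) by rewrite addF2.
move: xy' x0 y0; have [xp|xn|->] := ltgtP 0 (x ord0 b); rewrite ?eqxx // => H _ _.
  by apply/esym; rewrite (gtr0_norm xp) ltr_norml in H *; move: H => /andP[_]; lra.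
apply/esym/negbTE; rewrite -leNgt; rewrite (ltr0_norm xn) ltr_norml in H.
move: H => /andP[+ _]; lra.
Qed.

(* Take for the eps i the signs of the k coordinates. After enough subdivisions,
   a simplex on which the cochain does not vanish has all its coordinates small,
   which is impossible on the sphere. *)
Lemma sphere_nu_zero k : ~ nu_nonzero (@sphere R k) k.
Proof.
move=> [z zZ]; apply/negP; rewrite negbK; apply/eqP.
have ssym : centrally_symmetric (@sphere R k).
  by move=> x; rewrite /sphere /= => <-; apply: eq_bigr => i _; rewrite mxE sqrrN.
have s0 : ~ @sphere R k 0.
  rewrite /sphere /= big1 => [/esym/eqP|i _]; first by rewrite oner_eq0.
  by rewrite mxE expr0n.
(* The shift by one makes the k coboundary factors use each of the coordinates 0, ..., k - 1 once;
   the leading factor repeats coordinate 0. *)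
pose eps i := @coordsign R k i.-1.
have eN i x : @sphere R k x -> eps i (- x) = eps i x + 1.
  by move=> Sx; apply: coordsignN; exact: (mem_neq0 s0).
pose f (sg : singular R k k) := precup k eps (vert sg).
have E m : nu (@sphere R k) z = feval f (iter m (@sd R k k) z).
  apply: (@nu_map R k k _ (@sphere R k) s0 (fun q => iter m (@sd R k q))) => //.
  - by move=> q; elim: m => //= m IH c d; rewrite IH sdD.
  - by move=> q c cS; elim: m => //= m IH; exact: sd_in.
  - by move=> q c _; elim: m => //= m ->; rewrite sd_anti.
  - by move=> q c _; elim: m => //= m ->; rewrite sd_bd.
  - by move=> c _; elim: m => //= m IH; rewrite sd_aug.
have [m0 Hm] : exists m0, forall m, (m0 <= m)%N -> feval f (iter m (@sd R k k) z) = 0.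
  have itD m c d : iter m (@sd R k k) (c + d) = iter m (@sd R k k) c + iter m (@sd R k k) d.
    by elim: m => //= m ->; rewrite sdD.
  move: z zZ {E} => z [[zS _] _]; move: z zS; apply: chain_ind => [|c d|sg Ssg].
  - exists 0%N => m _; have -> : iter m (@sd R k k) 0 = 0.
      by elim: m => //= m ->; rewrite sd0.
    exact: feval0.
  - move=> [m1 H1] [m2 H2]; exists (maxn m1 m2) => m.
    by rewrite geq_max => /andP[h1 h2]; rewrite itD fevalD H1 // H2 // addr0.
  (* Each coordinate of vertex 0 will be below 1/(k+1), half of it from the sign change and half
     from moving to vertex 0. The squares then sum to at most k/(k+1) < 1. *)
  have d0 : 0 < (k.+1%:R^-1 / 2 : R) by rewrite divr_gt0 // invr_gt0 ltr0n.
  have [e e0 eP] := singular_unif_continuous sg d0.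
  have [m0 Hm0] := expr_lt_small (theta01 R k) e0.
  exists m0 => m /Hm0 th.
  move: (iter m _ _) (@piece_sd R k k sg m); apply: chain_ind => [|c d Hc Hd|].
  - exact: feval0.
  - by rewrite fevalD Hc Hd addr0.
  move=> tau [M [h [oM tauE]]]; rewrite fevalU /f /precup.
  have close i j b : `|vert tau i ord0 b - vert tau j ord0 b| < k.+1%:R^-1 / 2.
    rewrite /vert !tauE /=; apply: eP => c; apply: le_lt_trans th.
    have [lo loP] := oM c.
    have vE (a : 'I_k.+1) : set_val (aff h (vtx R a)) ord0 c = M a c.
      by rewrite affE /= -rowE mxE.
    rewrite !vE ler_norml.
    have /andP[a1 a2] := loP (inord i); have /andP[a3 a4] := loP (inord j).
    by apply/andP; split; lra.
  apply/eqP; rewrite mulf_eq0; apply/orP; right; apply/negPn/negP => nz.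
  have Sv : @sphere R k (vert tau 0) by rewrite /vert tauE; exact: Ssg.
  have sm b : `|vert tau 0 ord0 b| < k.+1%:R^-1.
    move: nz; rewrite /cobd prodf_seq_neq0 => /allP /(_ b).
    rewrite mem_index_enum => /(_ isT) /= nzb.
    have h1 := coordsign_close (close b b.+1 b) nzb.
    have h2 := close 0%N b b.
    have h3 := ler_normD (vert tau 0 ord0 b - vert tau b ord0 b) (vert tau b ord0 b).
    rewrite subrK in h3; apply: le_lt_trans h3 _.
    by rewrite [ltRHS]splitr ltrD.
  move: Sv; rewrite /sphere /= => /eqP; apply/negP; rewrite neq_lt.
  apply/orP; left.
  have k0 : 0 < k.+1%:R^-1 :> R by rewrite invr_gt0 ltr0n.
  apply: (@le_lt_trans _ _ (\sum_(i < k) k.+1%:R^-1)).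
    apply: ler_sum => i _; rewrite -real_normK ?num_real //.
    have k1 : k.+1%:R^-1 <= 1 :> R by rewrite invf_le1 ?ltr0n // ler1n.
    apply: (@le_trans _ _ `|vert tau 0 ord0 i|); last exact: ltW.
    rewrite expr2 ler_piMr // ltW //; exact: lt_le_trans k1.
  rewrite sumr_const card_ord -[X in X *+ _]mul1r -mulrnAl ltr_pdivrMr ?ltr0n //.
  by rewrite mul1r ltr_nat.
by rewrite (E m0) Hm.
Qed.

Definition nrm2 n (x : 'rV[R]_n) : R := Num.sqrt (\sum_i x ord0 i ^+ 2).

Lemma nrm2_gt0 n (x : 'rV[R]_n) : x != 0 -> 0 < nrm2 x.
Proof.
move=> x0; have [i xi _] := first_nonzero x0.
rewrite /nrm2 sqrtr_gt0 (bigD1 i) //= ltr_wpDr //.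
  by apply: sumr_ge0 => j _; exact: sqr_ge0.
by rewrite exprn_even_gt0.
Qed.

Lemma nrm2_continuous n : continuous (@nrm2 n).
Proof.
move=> x; rewrite /nrm2.
apply: (@continuous_comp _ _ _ (fun x : 'rV[R]_n => \sum_i x ord0 i ^+ 2) Num.sqrt).
  apply: continuous_rsum => i _ y; rewrite /=.
  apply: (@cvgM _ _ (nbhs y)); exact: coord_continuous.
exact: sqrt_continuous.
Qed.

Definition normalize n (x : 'rV[R]_n) : 'rV[R]_n := (nrm2 x)^-1 *: x.

Lemma odd_normalize n (S : set 'rV[R]_n) : ~ S 0 ->
  odd_map S (@sphere R n) (@normalize n).
Proof.
move=> S0; split=> [|x Sx|x Sx].
- apply/subspace_continuousP => x Sx; apply: cvg_within_filter.
  apply: cvg_rV => j; rewrite /normalize.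
  have -> : (fun t : 'rV[R]_n => ((nrm2 t)^-1 *: t) ord0 j) =
     (fun t => (nrm2 t)^-1 * t ord0 j) by apply/funext => t; rewrite mxE.
  rewrite mxE; apply: (@cvgM _ _ (nbhs x)); last exact: coord_continuous.
  apply: cvgV; first by rewrite gt_eqF // nrm2_gt0 // (mem_neq0 S0).
  exact: nrm2_continuous.
- have x0 := nrm2_gt0 (mem_neq0 S0 Sx); rewrite /sphere /=.
  under eq_bigr do rewrite mxE exprMn.
  rewrite -mulr_sumr; have -> : \sum_i x ord0 i ^+ 2 = nrm2 x ^+ 2.
    by rewrite sqr_sqrtr // sumr_ge0 // => i _; exact: sqr_ge0.
  by rewrite -exprMn mulVf ?expr1n // gt_eqF.
- rewrite /normalize scalerN; congr (- (_^-1 *: _)); rewrite /nrm2.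
  by congr Num.sqrt; apply: eq_bigr => i _; rewrite mxE sqrrN.
Qed.

Lemma odd_map_comp n1 n2 n3 (A : set 'rV[R]_n1) (B : set 'rV[R]_n2)
    (C : set 'rV[R]_n3) f g :
  odd_map A B f -> odd_map B C g -> odd_map A C (g \o f).
Proof.
move=> [/subspace_continuousP cf fA fo] [/subspace_continuousP cg gB go].
split=> [|x Ax|x Ax]; last by rewrite /= fo // go //; exact: fA.
  apply/subspace_continuousP => x Ax U Ugf.
  have H := cg _ (fA _ Ax) U Ugf; rewrite /= /within /= in H.
  have H' := cf _ Ax _ H; rewrite /= /within /= in H'.
  apply: (@filterS _ (nbhs x) _ _ _ _ H') => u /= Hu Au; exact: (Hu Au (fA _ Au)).
exact/gB/fA.
Qed.

(** Nonemptiness rules out the default value 0. *)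
Lemma nat_minP (P : set nat) : P !=set0 ->
  P (nat_min P) /\ forall j, P j -> (nat_min P <= j)%N.
Proof.
move=> [k0 Pk0]; have ex : exists k, `[< P k >] by exists k0; apply/asboolP.
rewrite /nat_min; case: xgetP => [m _ //|/(_ (ex_minn ex))].
case; case: ex_minnP => m /asboolP Pm H; split => // j Pj.
by apply: H; apply/asboolP.
Qed.

Lemma nat_maxP (P : set nat) b : P !=set0 -> (forall j, P j -> (j <= b)%N) ->
  P (nat_max P) /\ forall j, P j -> (j <= nat_max P)%N.
Proof.
move=> [k0 Pk0] Pb; have ex : exists k, `[< P k >] by exists k0; apply/asboolP.
have ub j : `[< P j >] -> (j <= b)%N by move=> /asboolP; exact: Pb.
rewrite /nat_max; case: xgetP => [m _ //|/(_ (ex_maxn ex ub))].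
case; case: ex_maxnP => m /asboolP Pm H; split => // j Pj.
by apply: H; apply/asboolP.
Qed.

Definition good n (S : set 'rV[R]_n) : Prop :=
  [/\ S !=set0, centrally_symmetric S & ~ S 0].

Lemma sphere_sym k : centrally_symmetric (@sphere R k).
Proof.
by move=> x; rewrite /sphere /= => <-; apply: eq_bigr => i _; rewrite mxE sqrrN.
Qed.

Lemma sphere_n0 k : ~ @sphere R k 0.
Proof.
rewrite /sphere /= big1 => [/esym/eqP|i _]; first by rewrite oner_eq0.
by rewrite mxE expr0n.
Qed.

Lemma sphere_neq0 k : (1 <= k)%N -> @sphere R k !=set0.
Proof.
case: k => // k _; exists (delta_mx 0 ord0); rewrite /sphere /=.
rewrite (bigD1 ord0) //= mxE !eqxx expr1n big1 ?addr0 // => i /negbTE i0.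
by rewrite mxE i0 andbF expr0n.
Qed.

Lemma index_or0E n (S : set 'rV[R]_n) i : good S -> index_or0 S i = i.
Proof. by case=> S1 S2 _; rewrite /index_or0 asboolT. Qed.

Lemma index_or0_gt0 n (S : set 'rV[R]_n) i : (0 < index_or0 S i)%N ->
  S !=set0 /\ centrally_symmetric S.
Proof. by rewrite /index_or0; case: asboolP. Qed.

Lemma nu_sphere k q : (q < k)%N -> nu_nonzero (@sphere R k) q.
Proof.
move=> qk; apply: nu_nonzero_odd_map (nu_cross R qk).
- by move=> x /= x0 /eqP; rewrite oppr_eq0 => /eqP.
- by move=> /=; apply.
- exact: sphere_n0.
- exact: odd_normalize.
Qed.

(** Borsuk-Ulam: if l < k, the source carries a symmetric l-cycle with nonzero nu, which would be
    pushed to one on the (l-1)-sphere. *)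
Lemma odd_sphere_le k l (f : 'rV[R]_k -> 'rV[R]_l) :
  odd_map (@sphere R k) (@sphere R l) f -> (k <= l)%N.
Proof.
move=> of_; rewrite leqNgt; apply/negP => lk; apply: (@sphere_nu_zero l).
apply: nu_nonzero_odd_map of_ (nu_sphere lk).
- exact: sphere_sym.
- exact: sphere_n0.
- exact: sphere_n0.
Qed.

Section Good.
Variables (n : nat) (S : set 'rV[R]_n).
Hypothesis gS : good S.

Lemma good_dim : (1 <= n)%N.
Proof.
case: gS => -[x Sx] _ S0; case: n S x Sx S0 => // S' x Sx S0; case: S0.
by have -> : 0 = x by apply/rowP => -[].
Qed.

Let minus_set := [set k | (1 <= k)%N /\ exists f, odd_map S (@sphere R k) f].
Let plus_set := [set k | (1 <= k)%N /\ exists f, odd_map (@sphere R k) S f].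

Lemma genus_minusP : (1 <= genus_minus S)%N /\
  exists f, odd_map S (@sphere R (genus_minus S)) f.
Proof.
rewrite /genus_minus index_or0E //; apply: (proj1 (@nat_minP minus_set _)).
by exists n; split; [exact: good_dim|exists (@normalize n); apply: odd_normalize; case: gS].
Qed.

Lemma genus_minus_le k f : (1 <= k)%N -> odd_map S (@sphere R k) f ->
  (genus_minus S <= k)%N.
Proof.
move=> k1 of_; rewrite /genus_minus index_or0E //.
have ne : minus_set !=set0 by exists k; split => //; exists f.
by apply: (proj2 (nat_minP ne)); split => //; exists f.
Qed.

Lemma plus_set_bound j : plus_set j -> (j <= n)%N.
Proof.
case: gS => _ _ S0 [_ [f of_]].
exact: odd_sphere_le (odd_map_comp of_ (odd_normalize S0)).
Qed.

Lemma plus_set_neq0 : plus_set !=set0.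
Proof.
case: gS => -[x Sx] Ss _; exists 1%N; split => //.
exists (fun y : 'rV[R]_1 => y ord0 ord0 *: x); split.
- apply: continuous_subspaceT; apply: rV_continuous => j y.
  have -> : (fun t : 'rV[R]_1 => (t ord0 ord0 *: x) ord0 j) =
     (fun t => t ord0 ord0 * x ord0 j) by apply/funext => t; rewrite mxE.
  apply: (@cvgM _ _ (nbhs y)); last exact: cvg_cst.
  exact: coord_continuous.
- move=> y; rewrite /sphere /= big_ord1 => /eqP; rewrite sqrf_eq1.
  by move=> /orP[/eqP ->|/eqP ->]; rewrite ?scale1r // scaleN1r; exact: Ss.
- by move=> y _; rewrite mxE scaleNr.
Qed.

Lemma genus_plusP : (1 <= genus_plus S)%N /\
  exists f, odd_map (@sphere R (genus_plus S)) S f.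
Proof.
rewrite /genus_plus index_or0E //.
exact: (proj1 (nat_maxP plus_set_neq0 plus_set_bound)).
Qed.

Lemma genus_plus_ge k f : (1 <= k)%N -> odd_map (@sphere R k) S f ->
  (k <= genus_plus S)%N.
Proof.
move=> k1 of_; rewrite /genus_plus index_or0E //.
by apply: (proj2 (nat_maxP plus_set_neq0 plus_set_bound)); split => //; exists f.
Qed.

Lemma nu_odd_sphere k f : odd_map S (@sphere R k) f -> ~ nu_nonzero S k.
Proof.
case: gS => _ Ss S0 of_ /(nu_nonzero_odd_map Ss S0 (@sphere_n0 k) of_).
exact: sphere_nu_zero.
Qed.

Lemma yangP : (1 <= yang S)%N /\ ~ nu_nonzero S (yang S) /\
  forall j, (1 <= j)%N -> ~ nu_nonzero S j -> (yang S <= j)%N.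
Proof.
case: (gS) => _ Ss S0; rewrite /yang index_or0E //; set P := [set k | _].
have PE k : P k <-> (1 <= k)%N /\ ~ nu_nonzero S k.
  by split=> -[k1 H]; split => //; apply/(nu_star_eq0 S0).
have [|[P1 P2] P3] := @nat_minP P.
  have [k1 [f of_]] := genus_minusP; exists (genus_minus S); apply/PE; split => //.
  exact: nu_odd_sphere of_.
have [_ H2] := (PE (nat_min P)).1 (conj P1 P2).
by do 2![split => //] => j j1 nj; apply: P3; apply/PE.
Qed.

Lemma yang_le_minus : (yang S <= genus_minus S)%N.
Proof.
have [_ [_ H]] := yangP; have [k1 [f of_]] := genus_minusP.
by apply: H => //; exact: nu_odd_sphere of_.
Qed.

Lemma plus_le_yang : (genus_plus S <= yang S)%N.
Proof.
have [_ [H _]] := yangP; have [k1 [f of_]] := genus_plusP.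
rewrite leqNgt; apply/negP => lk; apply: H.
apply: nu_nonzero_odd_map of_ (nu_sphere lk).
- exact: sphere_sym.
- exact: sphere_n0.
- by case: gS.
Qed.

End Good.

Section Monotone.
Variables (n : nat) (S S' : set 'rV[R]_n) (f : 'rV[R]_n -> 'rV[R]_n).
Hypotheses (gS : good S) (gS' : good S') (of_ : odd_map S S' f).

Lemma genus_minus_mono : (genus_minus S <= genus_minus S')%N.
Proof.
have [k1 [g og]] := genus_minusP gS'.
exact: (@genus_minus_le _ _ gS _ _ k1 (odd_map_comp of_ og)).
Qed.

Lemma genus_plus_mono : (genus_plus S <= genus_plus S')%N.
Proof.
have [k1 [g og]] := genus_plusP gS.
exact: (@genus_plus_ge _ _ gS' _ _ k1 (odd_map_comp og of_)).
Qed.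

Lemma yang_mono : (yang S <= yang S')%N.
Proof.
have [_ [_ H]] := yangP gS; have [k1 [H' _]] := yangP gS'.
apply: H => // nS; apply: H'; case: gS => _ Ss S0; case: gS' => _ _ S0'.
exact: nu_nonzero_odd_map of_ nS.
Qed.

End Monotone.
End BorsukUlam.

(** * Layer-cake decomposition and coarea *)

Section LayerCake.
Variables (R : realType) (n : nat).
Notation Rn := 'rV[R]_n.
Notation spair := ({set 'I_n} * {set 'I_n})%type.
Implicit Types (x : Rn) (u v : spair).

Definition usupp u : {set 'I_n} := (u.1 :|: u.2)%SET.

(** The default of the minimum dominates every term, hence is neutral on a nonempty support. For u
    in [P2] and hi < t <= lo, the sets {x >= t} and {x <= -t} are exactly u.1 and u.2, so the weight
    defined from [lo] and [hi] measures the levels at which u occurs. *)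
Definition lo x u : R :=
  \big[Num.min/ \sum_i `|x ord0 i|]_(i in usupp u) (vertex R u ord0 i * x ord0 i).

Definition hi x u : R := \big[Num.max/0]_(i | i \notin usupp u) `|x ord0 i|.

(* The pairs of positive weight form a chain, and x is the sum of the
   [wgt x u *: vertex R u]. *)
Definition wgt x u : R := Num.max 0 (lo x u - hi x u).

Lemma P2P u : u \in P2 n <->
  (forall i, i \in u.1 -> i \notin u.2) /\ exists i, i \in usupp u.
Proof.
rewrite inE; split=> [/andP[/eqP d /set0Pn]|[d [i iu]]].
  move=> [i iu]; split; last by exists i.
  by move=> j j1; apply/negP => j2; move/setP/(_ j): d; rewrite !inE j1 j2.
apply/andP; split; last by apply/set0Pn; exists i.
apply/eqP/setP => j; rewrite !inE; apply/negbTE; apply/negP => /andP[j1 j2].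
by have := d j j1; rewrite j2.
Qed.

Lemma vertex1 u i : u \in P2 n -> i \in u.1 -> vertex R u ord0 i = 1.
Proof. by move=> /P2P[d _] i1; rewrite mxE i1 (negbTE (d i i1)) subr0. Qed.

Lemma vertex2 u i : u \in P2 n -> i \in u.2 -> vertex R u ord0 i = -1.
Proof.
move=> /P2P[d _] i2; rewrite mxE i2.
have -> : i \in u.1 = false by apply/negP => /d; rewrite i2.
by rewrite sub0r.
Qed.

Lemma vertex0 u i : i \notin usupp u -> vertex R u ord0 i = 0.
Proof. by rewrite inE negb_or mxE => /andP[/negbTE -> /negbTE ->]; rewrite subrr. Qed.

Lemma vertex_abs u i : u \in P2 n -> `|vertex R u ord0 i| = (i \in usupp u)%:R.
Proof.
move=> uP; have [iu|iu] := boolP (i \in usupp u); last by rewrite vertex0 // normr0.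
move: iu; rewrite inE => /orP[i1|i2].
  by rewrite vertex1 // normr1.
by rewrite vertex2 // normrN normr1.
Qed.

Lemma vertex_mul_le u x i : u \in P2 n -> vertex R u ord0 i * x ord0 i <= `|x ord0 i|.
Proof.
move=> uP; apply: le_trans (ler_norm _) _; rewrite normrM vertex_abs //.
by case: (_ \in _); rewrite ?mul1r ?mul0r.
Qed.

Lemma lo_ge x u y : u \in P2 n ->
  y <= lo x u <-> forall i, i \in usupp u -> y <= vertex R u ord0 i * x ord0 i.
Proof.
move=> uP; split=> [/bigmin_geP[_ H] i iu|H]; first exact: H.
apply/bigmin_geP; split => //; have /P2P[_ [i iu]] := uP.
apply: le_trans (H i iu) _; apply: le_trans (vertex_mul_le _ _ uP) _.
by rewrite (bigD1 i) //= lerDl sumr_ge0.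
Qed.

Lemma hi_le x u y : hi x u <= y <->
  0 <= y /\ forall i, i \notin usupp u -> `|x ord0 i| <= y.
Proof. by split=> [/bigmax_leP|H]; last apply/bigmax_leP. Qed.

Lemma hi_ge0 x u : 0 <= hi x u.
Proof. by have [/(_ (lexx _)) []] := hi_le x u (hi x u). Qed.

Lemma hi_ge x u i : i \notin usupp u -> `|x ord0 i| <= hi x u.
Proof. by have [/(_ (lexx _)) [_ H] _] := hi_le x u (hi x u); exact: H. Qed.

Lemma lo_le x u i : u \in P2 n -> i \in usupp u -> lo x u <= vertex R u ord0 i * x ord0 i.
Proof. by move=> uP; have [/(_ (lexx _)) H _] := lo_ge x (lo x u) uP; exact: H. Qed.

Lemma wgt_ge0 x u : 0 <= wgt x u.
Proof. by rewrite /wgt le_max lexx. Qed.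

Lemma wgt_gt0 x u : (0 < wgt x u) = (hi x u < lo x u).
Proof. by rewrite /wgt lt_max ltxx subr_gt0. Qed.

Lemma wgt_gt0_lo x u : 0 < wgt x u -> 0 < lo x u.
Proof. by rewrite wgt_gt0; apply: le_lt_trans; exact: hi_ge0. Qed.

Lemma wgt_prec x u v : u \in P2 n -> v \in P2 n -> 0 < wgt x u -> 0 < wgt x v ->
  usupp u \subset usupp v -> prec u v.
Proof.
move=> uP vP wu wv suv.
have lu := wgt_gt0_lo wu; have lv := wgt_gt0_lo wv.
apply/andP; split; apply/fintype.subsetP => i iu.
  have isu : i \in usupp u by rewrite inE iu.
  have := fintype.subsetP suv i isu; rewrite inE => /orP[//|iv].
  have isv : i \in usupp v by rewrite inE iv orbT.
  have := lt_le_trans lu (lo_le x uP isu); rewrite vertex1 //.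
  have := lt_le_trans lv (lo_le x vP isv); rewrite vertex2 //; lra.
have isu : i \in usupp u by rewrite inE iu orbT.
have := fintype.subsetP suv i isu; rewrite inE => /orP[iv|//].
have isv : i \in usupp v by rewrite inE iv.
have := lt_le_trans lu (lo_le x uP isu); rewrite vertex2 //.
have := lt_le_trans lv (lo_le x vP isv); rewrite vertex1 //; lra.
Qed.

(** If neither support contained the other, then lo u <= hi v < lo v <= hi u < lo u. Nested supports
    carry compatible signs, namely those of x. *)
Lemma wgt_chain x u v : u \in P2 n -> v \in P2 n -> 0 < wgt x u -> 0 < wgt x v ->
  prec u v || prec v u.
Proof.
move=> uP vP wu wv.
have [suv|/fintype.subsetPn [i iu inv]] := boolP (usupp u \subset usupp v).
  by rewrite (wgt_prec uP vP wu wv).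
have [svu|/fintype.subsetPn [j jv jnu]] := boolP (usupp v \subset usupp u).
  by rewrite (wgt_prec vP uP wv wu) // orbT.
have h1 := le_trans (lo_le x uP iu) (vertex_mul_le _ _ uP).
have h2 := hi_ge x inv; have h3 := le_trans (lo_le x vP jv) (vertex_mul_le _ _ vP).
have h4 := hi_ge x jnu; move: wu wv; rewrite !wgt_gt0 => wu wv; lra.
Qed.

Lemma wgt_opp x u : wgt (- x) (u.2, u.1) = wgt x u.
Proof.
have sE : usupp (u.2, u.1) = usupp u by rewrite /usupp /= finset.setUC.
rewrite /wgt /lo /hi sE; congr (Num.max 0 (_ - _)).
  have -> : \sum_i `|(- x) ord0 i| = \sum_i `|x ord0 i|.
    by apply: eq_bigr => i _; rewrite mxE normrN.
  by apply: eq_bigr => i _; rewrite !mxE /= mulrN -mulNr opprB.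
by apply: eq_bigr => i _; rewrite mxE normrN.
Qed.

Definition xsupp x : spair :=
  ([set i | (0 < x ord0 i)%R]%SET, [set i | (x ord0 i < 0)%R]%SET).

Lemma xsuppP x i : i \in usupp (xsupp x) = (x ord0 i != 0).
Proof. by rewrite !inE; case: ltgtP. Qed.

Lemma xsupp_P2 x : x != 0 -> xsupp x \in P2 n.
Proof.
move=> x0; apply/P2P; split=> [i|].
  by rewrite !inE => xi; rewrite -leNgt ltW.
by have [i xi _] := first_nonzero x0; exists i; rewrite xsuppP.
Qed.

Lemma xsupp_sgn x i : vertex R (xsupp x) ord0 i = Num.sg (x ord0 i).
Proof. by rewrite mxE !inE; case: sgrP => _; rewrite ?subrr ?subr0 ?sub0r. Qed.

Lemma wgt_le0 x u i : u \in P2 n -> i \in usupp u ->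
  vertex R u ord0 i * x ord0 i <= 0 -> wgt x u = 0.
Proof.
move=> uP iu H; apply/eqP; rewrite eq_le wgt_ge0 andbT /wgt ge_max lexx /=.
by rewrite subr_le0; apply: le_trans (hi_ge0 x u); apply: le_trans H; exact: lo_le.
Qed.

Section Peel.
Variables (x : Rn) (t : R).
Hypotheses (x0 : x != 0) (t0 : 0 < t).
Hypothesis tx : forall i, x ord0 i != 0 -> t <= `|x ord0 i|.

Definition peel : Rn := x - t *: vertex R (xsupp x).

Lemma peelE i : peel ord0 i = x ord0 i - t * Num.sg (x ord0 i).
Proof. by rewrite /peel mxE [X in _ + X]mxE [X in _ - X]mxE xsupp_sgn. Qed.

Lemma peel_abs i : x ord0 i != 0 -> `|peel ord0 i| = `|x ord0 i| - t.
Proof.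
move=> xi; have := tx xi; rewrite peelE.
have /orP[h|h] : (x ord0 i < 0) || (0 < x ord0 i) by rewrite -neq_lt.
  rewrite (ltr0_sg h) mulrN1 opprK (ltr0_norm h) => tE.
  by rewrite ler0_norm; lra.
rewrite (gtr0_sg h) mulr1 (gtr0_norm h) => tE.
by rewrite ger0_norm; lra.
Qed.

Lemma peel0 i : x ord0 i = 0 -> peel ord0 i = 0.
Proof. by rewrite peelE => ->; rewrite sgr0 mulr0 subr0. Qed.

(** If u disagrees with the sign of x at a point of its support, both weights vanish. Otherwise some
    nonzero entry of x lies outside u, so hi >= t, and peeling lowers lo and hi by the same t. *)
Lemma wgt_peel u : u \in P2 n -> u != xsupp x -> wgt peel u = wgt x u.
Proof.
move=> uP ux.
have [H|] := boolP [forall i in usupp u, 0 < vertex R u ord0 i * x ord0 i]; last first.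
  rewrite negb_forall => /existsP[i]; rewrite negb_imply -leNgt => /andP[iu ile].
  rewrite (wgt_le0 uP iu ile) (@wgt_le0 _ _ i) //.
  have [xi|xi] := eqVneq (x ord0 i) 0; first by rewrite peel0 // mulr0.
  have := tx xi; have := iu; rewrite peelE inE => /orP[i1|i2].
    rewrite vertex1 // !mul1r in ile *.
    have {}ile : x ord0 i < 0 by rewrite lt_neqAle xi.
    by rewrite ltr0_sg // ltr0_norm //; lra.
  rewrite vertex2 // !mulN1r in ile *.
  have {}ile : 0 < x ord0 i by rewrite lt_neqAle eq_sym xi -oppr_le0.
  by rewrite gtr0_sg // gtr0_norm //; lra.
have {}H i : i \in usupp u -> 0 < vertex R u ord0 i * x ord0 i.
  by move=> iu; move/forallP/(_ i)/implyP: H; apply.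
have xn0 i : i \in usupp u -> x ord0 i != 0.
  by move=> /H; apply: contraTneq => ->; rewrite mulr0 ltxx.
have vE i : i \in usupp u -> vertex R u ord0 i * x ord0 i = `|x ord0 i|.
  move=> iu; rewrite -[LHS]ger0_norm ?ltW ?H // normrM vertex_abs // iu.
  by rewrite mul1r.
have vE' i : i \in usupp u -> vertex R u ord0 i * peel ord0 i = `|x ord0 i| - t.
  move=> iu; rewrite peelE mulrBr vE //; congr (_ - _).
  have := H i iu; have := iu; rewrite inE => /orP[i1|i2].
    by rewrite vertex1 // !mul1r => xi; rewrite gtr0_sg // mulr1.
  by rewrite vertex2 // !mulN1r oppr_gt0 => xi; rewrite ltr0_sg // mulrN1 opprK.
have [j xj ju] : exists2 j, x ord0 j != 0 & j \notin usupp u.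
  have : ~~ (usupp (xsupp x) \subset usupp u).
    apply: contra ux => /fintype.subsetP sxu; apply/eqP.
    have /P2P[d _] := uP.
    rewrite (surjective_pairing u) /xsupp; congr (_, _); apply/setP => i; rewrite !inE.
      apply/idP/idP => [i1|xi].
        by have := H i; rewrite inE i1 => /(_ isT); rewrite vertex1 // mul1r.
      have : i \in usupp u by apply: sxu; rewrite xsuppP gt_eqF.
      move=> iu; have := iu; rewrite inE => /orP[//|i2].
      by have := H i iu; rewrite vertex2 // mulN1r; lra.
    apply/idP/idP => [i2|xi].
      by have := H i; rewrite inE i2 orbT => /(_ isT); rewrite vertex2 // mulN1r oppr_gt0.
    have : i \in usupp u by apply: sxu; rewrite xsuppP lt_eqF.
    move=> iu; have := iu; rewrite inE => /orP[i1|//].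
    by have := H i iu; rewrite vertex1 // mul1r; lra.
  move=> /fintype.subsetPn [j]; rewrite xsuppP => xj ju; by exists j.
have hx : t <= hi x u by apply: le_trans (tx xj) (hi_ge x ju).
have loE : lo peel u = lo x u - t.
  apply/eqP; rewrite eq_le; apply/andP; split.
    rewrite lerBrDr; apply/(lo_ge _ _ uP) => i iu; rewrite vE // -lerBrDr -vE' //.
    exact: lo_le.
  apply/(lo_ge _ _ uP) => i iu; rewrite vE' // lerD2r -vE //; exact: lo_le.
have hiE : hi peel u = hi x u - t.
  apply/eqP; rewrite eq_le; apply/andP; split.
    apply/hi_le; split=> [|i iu]; first by rewrite subr_ge0.
    have [xi|xi] := eqVneq (x ord0 i) 0; first by rewrite peel0 // normr0 subr_ge0.
    by rewrite peel_abs // lerD2r; exact: hi_ge.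
  rewrite lerBlDr; apply/hi_le; split=> [|i iu].
    by rewrite addr_ge0 ?hi_ge0 ?ltW.
  have [->|xi] := eqVneq (x ord0 i) 0.
    by rewrite normr0 addr_ge0 ?hi_ge0 ?ltW.
  by rewrite -lerBlDr -peel_abs //; exact: hi_ge.
by rewrite /wgt loE hiE; congr Num.max; lra.
Qed.

Variable i0 : 'I_n.
Hypotheses (xi0 : x ord0 i0 != 0) (ti0 : `|x ord0 i0| = t).

Lemma peel_i0 : peel ord0 i0 = 0.
Proof. by apply/normr0_eq0; rewrite peel_abs // ti0 subrr. Qed.

Lemma wgt_peel_xsupp : wgt peel (xsupp x) = 0.
Proof.
apply: (@wgt_le0 _ _ i0); [exact: xsupp_P2|by rewrite xsuppP|].
by rewrite peel_i0 mulr0.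
Qed.

Lemma wgt_xsupp : wgt x (xsupp x) = t.
Proof.
have xP := xsupp_P2 x0.
have E i : vertex R (xsupp x) ord0 i * x ord0 i = `|x ord0 i|.
  by rewrite xsupp_sgn -normrEsg.
have -> : wgt x (xsupp x) = Num.max 0 (t - 0).
  congr (Num.max 0 (_ - _)); apply/eqP; rewrite eq_le; apply/andP; split.
  - by have := @lo_le x _ i0 xP; rewrite E ti0; apply; rewrite xsuppP.
  - by apply/(lo_ge _ _ xP) => i; rewrite xsuppP E => /tx.
  - apply/hi_le; split=> // i; rewrite xsuppP negbK => /eqP ->.
    by rewrite normr0.
  - exact: hi_ge0.
by rewrite subr0; apply/max_idPr; exact: ltW.
Qed.

Lemma card_peel : (#|[pred i | (peel ord0 i != 0)%R]| < #|[pred i | (x ord0 i != 0)%R]|)%N.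
Proof.
apply: proper_card; apply/fintype.properP; split.
  apply/fintype.subsetP => i; rewrite !inE; apply: contra => /eqP.
  by move=> /peel0 ->.
by exists i0; rewrite inE ?xi0 // peel_i0 eqxx.
Qed.

End Peel.

Lemma min_abs x : x != 0 -> exists i0, x ord0 i0 != 0 /\
  forall i, x ord0 i != 0 -> `|x ord0 i0| <= `|x ord0 i|.
Proof.
move=> x0; have [j xj _] := first_nonzero x0.
case: (@Order.TotalTheory.arg_minP _ _ _ j (fun i => x ord0 i != 0) (fun i => `|x ord0 i|) xj).
by move=> i xi H; exists i.
Qed.

Lemma layer_cake (G : Rn -> R) : G 0 = 0 ->
  (forall x t, 0 < t -> (forall i, x ord0 i != 0 -> t <= `|x ord0 i|) ->
     G x = G (peel x t) + t * G (vertex R (xsupp x))) ->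
  forall x, G x = \sum_(u in P2 n) wgt x u * G (vertex R u).
Proof.
move=> G0 GP x; move: {2}(#|_|.+1) (ltnSn #|[pred i | (x ord0 i != 0)%R]|) => m.
elim: m x => // m IH x xm; have [->|x0] := eqVneq x 0.
  rewrite G0 big1 // => u uP; have /P2P[_ [i iu]] := uP.
  have z : (0 : Rn) ord0 i = 0 by rewrite mxE.
  by rewrite (wgt_le0 uP iu) ?mul0r // z mulr0.
have [i0 [xi0 tx]] := min_abs x0.
set t := `|x ord0 i0| in tx.
have t0 : 0 < t by rewrite normr_gt0.
have xP := xsupp_P2 x0.
rewrite (GP x t t0 tx) IH; last first.
  by rewrite -ltnS (leq_trans _ xm) // ltnS (@card_peel x t tx i0).
rewrite (bigD1 (xsupp x)) //= [RHS](bigD1 (xsupp x)) //=.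
rewrite (@wgt_peel_xsupp x t x0 tx i0) // mul0r add0r addrC.
rewrite (@wgt_xsupp x t x0 t0 tx i0) //; congr (_ + _).
by apply: eq_bigr => u /andP[uP ux]; rewrite (wgt_peel t0 tx).
Qed.

End LayerCake.

Section GraphLayers.
Variables (R : realType) (n : nat) (E : rel 'I_n).
Notation Rn := 'rV[R]_n.
Notation spair := ({set 'I_n} * {set 'I_n})%type.
Implicit Types (x : Rn) (u v : spair).
Hypotheses (Esym : symmetric E) (Eirr : irreflexive E).

Lemma cut_sum (A : {set 'I_n}) : (Defs.cut E A)%:R =
  \sum_(i < n) \sum_(j < n | E i j) ((i \in A)%:R * (1 - (j \in A)%:R) : R).
Proof.
rewrite /Defs.cut -sum1_card natr_sum pair_big_dep /=.
rewrite (eq_bigl (fun u : 'I_n * 'I_n => E u.1 u.2 && ((u.1 \in A) && (u.2 \notin A)))) //.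
rewrite big_mkcondr; apply: eq_bigr => u _.
by case: (u.1 \in A); case: (u.2 \in A); rewrite /= ?subrr ?subr0 ?mulr0 ?mul0r ?mul1r.
Qed.

Lemma energy1 x : energy E 1 x = esum E (fun i j => `|x ord0 i - x ord0 j|).
Proof. by congr esum; apply/funext => i; apply/funext => j; rewrite powRr1. Qed.

Lemma mass1 x : mass E 1 x = \sum_i (deg E i)%:R * `|x ord0 i|.
Proof. by apply: eq_bigr => i _; rewrite powRr1. Qed.

(** An edge from u.1 to u.2 has difference 2 and is counted in both cuts. *)
Lemma energy_vertex u : u \in P2 n ->
  energy E 1 (vertex R u) = (Defs.cut E u.1 + Defs.cut E u.2)%N%:R.
Proof.
move=> uP; have /P2P[d _] := uP; rewrite energy1; apply: (@mulfI R 2).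
  by rewrite pnatr_eq0.
rewrite -esum_double //; last by move=> i j; rewrite distrC.
pose I (A : {set 'I_n}) i : R := (i \in A)%:R.
have -> : \sum_(i < n) \sum_(j < n | E i j) `|vertex R u ord0 i - vertex R u ord0 j| =
   \sum_(i < n) \sum_(j < n | E i j) I u.1 i * (1 - I u.1 j) +
   \sum_(i < n) \sum_(j < n | E i j) I u.1 j * (1 - I u.1 i) +
   (\sum_(i < n) \sum_(j < n | E i j) I u.2 i * (1 - I u.2 j) +
   \sum_(i < n) \sum_(j < n | E i j) I u.2 j * (1 - I u.2 i)).
  rewrite -!big_split; apply: eq_bigr => i _; rewrite -!big_split /=.
  apply: eq_bigr => j _; rewrite !mxE /I.
  have := d i; have := d j.
  case: (i \in u.1); case: (i \in u.2); case: (j \in u.1); case: (j \in u.2) => h1 h2;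
    rewrite ?(h1 isT) ?(h2 isT) /=;
    first [by have := h1 isT|by have := h2 isT|
      rewrite ?subrr ?subr0 ?mulr0 ?mul0r ?mulr1 ?addr0 ?add0r ?sub0r ?opprK ?normrN ?normr0 ?normr1 //].
  - by rewrite ger0_norm.
  - by rewrite -opprD normrN ger0_norm.
have swap A : \sum_(i < n) \sum_(j < n | E i j) I A j * (1 - I A i) =
    \sum_(i < n) \sum_(j < n | E i j) I A i * (1 - I A j).
  rewrite (exchange_big_dep predT) //=; apply: eq_bigr => i _.
  by apply: eq_bigl => j; rewrite Esym.
by rewrite !swap -!cut_sum natrD; ring.
Qed.

Lemma mass_vertex u : u \in P2 n -> mass E 1 (vertex R u) = (vol E (usupp u))%:R.
Proof.
move=> uP; rewrite mass1 /vol natr_sum [RHS]big_mkcond; apply: eq_bigr => i _.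
by rewrite vertex_abs //; case: (_ \in _); rewrite ?mulr1 ?mulr0.
Qed.

(** Neither number crosses 0 when moved towards it by t, so the triangle inequality is an
    equality. *)
Lemma dist_peel (a b t : R) : 0 < t -> (a != 0 -> t <= `|a|) -> (b != 0 -> t <= `|b|) ->
  `|a - b| = `|(a - t * Num.sg a) - (b - t * Num.sg b)| + t * `|Num.sg a - Num.sg b|.
Proof.
move=> t0.
have pos (c d : R) : 0 < c -> t <= `|c| -> (d != 0 -> t <= `|d|) -> `|c - d| =
    `|(c - t * Num.sg c) - (d - t * Num.sg d)| + t * `|Num.sg c - Num.sg d|.
  move=> c0; rewrite (gtr0_norm c0) (gtr0_sg c0) mulr1 => tc.
  case: (ltgtP d 0) => [d0|d0|->] td.
  - have := td isT; rewrite (ltr0_norm d0) => {}td; rewrite (ltr0_sg d0) mulrN1 !opprK.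
    rewrite ger0_norm; last by lra.
    rewrite ger0_norm; last by lra.
    by rewrite ger0_norm //; lra.
  - rewrite (gtr0_sg d0) mulr1 subrr normr0 mulr0 addr0; congr `|_|; lra.
  - rewrite sgr0 mulr0 !subr0 normr1 mulr1 !ger0_norm; lra.
move=> ta tb; have [a0|a0|a0] := ltgtP a 0.
- have := pos (- a) (- b); rewrite !sgrN !mulrN -!opprD !normrN oppr_gt0 oppr_eq0.
  by apply=> //; apply: ta; rewrite lt_eqF.
- by apply: pos => //; apply: ta; rewrite gt_eqF.
- rewrite a0; have [->|b0] := eqVneq b 0.
    by rewrite sgr0 mulr0 !subrr normr0 mulr0 addr0.
  have {}tb := tb b0; rewrite sgr0 mulr0 subrr !sub0r !normrN.
  have /orP[h|h] : (b < 0) || (0 < b) by rewrite -neq_lt.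
    rewrite (ltr0_norm h) in tb *; rewrite (ltr0_sg h) normrN normr1 mulrN1 opprK mulr1.
    by rewrite ler0_norm; lra.
  rewrite (gtr0_norm h) in tb *; rewrite (gtr0_sg h) normr1 !mulr1.
  by rewrite ger0_norm; lra.
Qed.

Lemma abs_peel (a t : R) : 0 < t -> (a != 0 -> t <= `|a|) ->
  `|a| = `|a - t * Num.sg a| + t * `|Num.sg a|.
Proof.
move=> t0 ta; have := @dist_peel a 0 t t0 ta; rewrite sgr0 mulr0 !subr0.
by apply; rewrite eqxx.
Qed.

Lemma energy_layers x :
  energy E 1 x = \sum_(u in P2 n) wgt x u * (Defs.cut E u.1 + Defs.cut E u.2)%N%:R.
Proof.
rewrite (@layer_cake R n (energy E 1)) => [||y t t0 ty].
- by apply: eq_bigr => u uP; rewrite energy_vertex.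
- rewrite energy1 esum_pair big1 // => u _.
  by rewrite !mxE subrr normr0.
- rewrite !energy1 -esumZ -esumD; congr esum; apply/funext => i; apply/funext => j.
  by rewrite !peelE !xsupp_sgn; apply: dist_peel => //; exact: ty.
Qed.

Lemma mass_layers x :
  mass E 1 x = \sum_(u in P2 n) wgt x u * (vol E (usupp u))%:R.
Proof.
rewrite (@layer_cake R n (mass E 1)) => [||y t t0 ty].
- by apply: eq_bigr => u uP; rewrite mass_vertex.
- by rewrite mass1 big1 // => i _; rewrite mxE normr0 mulr0.
- rewrite !mass1 mulr_sumr -big_split; apply: eq_bigr => i _ /=.
  rewrite mulrCA -mulrDr; congr (_ * _); rewrite peelE xsupp_sgn.
  by apply: abs_peel => //; exact: ty.
Qed.

Hypothesis deg_gt0 : forall i, (1 <= deg E i)%N.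

Lemma vol_gt0 u : u \in P2 n -> (0 < vol E (usupp u))%N.
Proof.
move=> /P2P[_ [i iu]]; rewrite /vol (bigD1 i) //=.
by rewrite ltn_addr // deg_gt0.
Qed.

(* If all layers had a larger ratio, so would the whole function, since energy
   and mass are the weighted sums of those of the layers. *)
Lemma good_layer x (M : R) : x != 0 -> energy E 1 x <= M * mass E 1 x ->
  exists2 u, u \in P2 n & 0 < wgt x u /\ pair_ratio R E u <= M.
Proof.
move=> x0 HM; have m0 : 0 < mass E 1 x by apply: mass_gt0; rewrite ?oner_eq0.
have [/existsP[u /and3P[uP wu rM]]|/existsPn H] :=
  boolP [exists u, [&& u \in P2 n, 0 < wgt x u & pair_ratio R E u <= M]].
  by exists u.
exfalso; move: HM; apply/negP; rewrite -ltNge.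
have W u : u \in P2 n -> M * (wgt x u * (vol E (usupp u))%:R) <=
    wgt x u * (Defs.cut E u.1 + Defs.cut E u.2)%N%:R ?= iff (wgt x u == 0).
  move=> uP; have v0 : 0 < (vol E (usupp u))%:R :> R by rewrite ltr0n vol_gt0.
  have [w0|w0] := eqVneq (wgt x u) 0; first by rewrite w0 !mul0r mulr0; exact/leifP.
  have wp : 0 < wgt x u by rewrite lt_def w0 wgt_ge0.
  apply/leifP; rewrite mulrCA ltr_pM2l // -ltr_pdivlMr //.
  by have := H u; rewrite uP wp /= -ltNge /pair_ratio.
rewrite energy_layers mass_layers mulr_sumr.
have [u uP wu] : exists2 u, u \in P2 n & wgt x u != 0.
  have [/existsP[u /andP[]]|/existsPn H0] := boolP [exists u, (u \in P2 n) && (wgt x u != 0)].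
    by exists u.
  move: m0; rewrite mass_layers big1 ?ltxx // => u uP.
  by have := H0 u; rewrite uP /= negbK => /eqP ->; rewrite mul0r.
rewrite lt_neqAle; apply/andP; split; last by apply: ler_sum => v /W[].
have [_ ->] := leif_sum W.
by rewrite negb_forall; apply/existsP; exists u; rewrite uP (negbTE wu).
Qed.

Lemma coarea x (M : R) : x != 0 -> (forall i, 0 <= x ord0 i) ->
  energy E 1 x <= M * mass E 1 x ->
  exists A : {set 'I_n}, [/\ A != finset.set0, forall i, i \in A -> 0 < x ord0 i &
    (Defs.cut E A)%:R / (vol E A)%:R <= M].
Proof.
move=> x0 xp HM; have [u uP [wu rM]] := good_layer x0 HM.
have lo0 := wgt_gt0_lo wu.
(* A layer of positive weight follows the signs of x, and x has no negative entry. *)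
have u20 : u.2 = finset.set0.
  apply/setP => i; rewrite inE; apply/negP => i2.
  have iu : i \in usupp u by rewrite inE i2 orbT.
  have := lt_le_trans lo0 (lo_le x uP iu); rewrite vertex2 // mulN1r.
  by rewrite oppr_gt0 ltNge xp.
have sE : usupp u = u.1 by rewrite /usupp u20 finset.setU0.
exists u.1; split.
- by have /P2P[_ [i]] := uP; rewrite sE => iu; apply/set0Pn; exists i.
- move=> i i1; have iu : i \in usupp u by rewrite sE.
  by have := lt_le_trans lo0 (lo_le x uP iu); rewrite vertex1 // mul1r.
- apply: le_trans rM; rewrite /pair_ratio u20 finset.setU0.
  by rewrite ler_wpM2r // ler_nat leq_addr.
Qed.

End GraphLayers.

(** * Sublevel sets retract onto subcomplexes *)

Section Retraction.
Variables (R : realType) (n : nat).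
Notation Rn := 'rV[R]_n.
Notation spair := ({set 'I_n} * {set 'I_n})%type.
Implicit Types (x : Rn) (u v : spair) (AA : {set spair}).

Lemma continuous_min2 (T : topologicalType) (f g : T -> R) :
  continuous f -> continuous g -> continuous (fun t => Num.min (f t) (g t)).
Proof. by move=> cf cg t; exact: (continuous_min (cf t) (cg t)). Qed.

Lemma continuous_max2 (T : topologicalType) (f g : T -> R) :
  continuous f -> continuous g -> continuous (fun t => Num.max (f t) (g t)).
Proof. by move=> cf cg t; exact: (continuous_max (cf t) (cg t)). Qed.

Lemma continuous_bigop (T : topologicalType) (I : Type) (r : seq I) (P : pred I)
    (op : R -> R -> R) (f : I -> T -> R) (c : T -> R) :
  (forall f g : T -> R, continuous f -> continuous g ->
     continuous (fun t => op (f t) (g t))) ->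
  continuous c -> (forall i, continuous (f i)) ->
  continuous (fun t => \big[op/c t]_(i <- r | P i) f i t).
Proof.
move=> cop cc cf; elim: r => [|i r IH].
  by under eq_fun do rewrite big_nil.
under eq_fun do rewrite big_cons.
by case: (P i) => //; exact: cop.
Qed.

Lemma coord_cont (i : 'I_n) : continuous (fun x : Rn => x ord0 i).
Proof. exact: coord_continuous. Qed.

Lemma abs_cont (i : 'I_n) : continuous (fun x : Rn => `|x ord0 i|).
Proof.
move=> x; apply: (@continuous_comp _ _ _ (fun y : Rn => y ord0 i) (fun a : R => `|a|)).
  exact: coord_cont.
exact: (@norm_continuous R R^o).
Qed.

Lemma wgt_continuous u : continuous (fun x => wgt x u).
Proof.
apply: continuous_max2; first exact: cst_continuous.
move=> x; apply: (@cvgB _ _ _ (nbhs x)).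
  apply: (@continuous_bigop _ _ _ _ Num.min (fun i x => vertex R u ord0 i * x ord0 i)
     (fun x => \sum_i `|x ord0 i|)) => [f g||i y].
  - exact: continuous_min2.
  - by apply: continuous_rsum => i _; exact: abs_cont.
  - by apply: (@cvgM _ _ (nbhs y)); [exact: cvg_cst|exact: coord_cont].
apply: (@continuous_bigop _ _ _ _ Num.max (fun i x => `|x ord0 i|) (fun=> 0)) => [f g||i].
- exact: continuous_max2.
- exact: cst_continuous.
- exact: abs_cont.
Qed.

Definition wtot AA x : R := \sum_(u in AA) wgt x u.

(** Division by [wtot] turns the weights that are kept into barycentric coordinates; it makes sense
    as soon as one layer of positive weight lies in [AA]. *)
Definition retr AA x : Rn := (wtot AA x)^-1 *: \sum_(u in AA) wgt x u *: vertex R u.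

Lemma retr_continuous AA x : 0 < wtot AA x -> {for x, continuous (retr AA)}.
Proof.
move=> w0; apply: (@cvg_rV R _ (nbhs x)) => j.
have -> : (fun y => retr AA y ord0 j) =
   (fun y => (wtot AA y)^-1 * \sum_(u in AA) wgt y u * vertex R u ord0 j).
  apply/funext => y; rewrite /retr mxE summxE; congr (_ * _).
  by apply: eq_bigr => u _; rewrite mxE.
rewrite /retr mxE summxE; apply: (@cvgM _ _ (nbhs x)).
  apply: cvgV; first by rewrite gt_eqF.
  by apply: (@cvg_bigsum R _ (nbhs x)) => u _; exact: wgt_continuous.
have -> : \sum_(u in AA) (wgt x u *: vertex R u) ord0 j =
          \sum_(u in AA) wgt x u * vertex R u ord0 j.
  by apply: eq_bigr => u _; rewrite mxE.
apply: (@cvg_bigsum R _ (nbhs x)) => u _; apply: (@cvgM _ _ (nbhs x)); last exact: cvg_cst.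
exact: wgt_continuous.
Qed.

Lemma retr_in AA x : AA \subset P2 n -> 0 < wtot AA x ->
  realization AA (retr AA x).
Proof.
move=> AP w0; pose c : {set spair} := [set u in AA | (0 < wgt x u)%R]%SET.
have sumc (V : lmodType R) (F : spair -> V) :
    \sum_(u in AA) wgt x u *: F u = \sum_(u in c) wgt x u *: F u.
  rewrite [LHS](bigID (fun u => 0 < wgt x u)) /= [X in _ + X]big1 ?addr0 => [|u].
    by apply: eq_bigl => u; rewrite inE.
  move=> /andP[_]; rewrite -leNgt => h.
  have -> : wgt x u = 0 by apply/eqP; rewrite eq_le h wgt_ge0.
  by rewrite scale0r.
exists c.
  apply/andP; split; first by apply/fintype.subsetP => u; rewrite inE => /andP[].
  apply/forall_inP => u; rewrite inE => /andP[uA wu].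
  apply/forall_inP => v; rewrite inE => /andP[vA wv].
  by apply: (wgt_chain _ _ wu wv); exact: (fintype.subsetP AP).
exists (fun u => (wtot AA x)^-1 * wgt x u); split.
- by move=> u _; rewrite mulr_ge0 ?wgt_ge0 // invr_ge0 ltW.
- have := sumc R^o (fun=> 1); rewrite /GRing.scale /=.
  under eq_bigr do rewrite mulr1; under [RHS]eq_bigr do rewrite mulr1.
  by rewrite -mulr_sumr => <-; rewrite mulVf // gt_eqF.
- rewrite /retr sumc scaler_sumr; apply: eq_bigr => u _; by rewrite scalerA.
Qed.

Definition swap_closed AA := forall u, u \in AA -> (u.2, u.1) \in AA.

Lemma swapK : involutive (fun u : spair => (u.2, u.1)).
Proof. by case. Qed.

Lemma sum_swap (V : zmodType) AA (F : spair -> V) : swap_closed AA ->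
  \sum_(u in AA) F u = \sum_(u in AA) F (u.2, u.1).
Proof.
move=> sA; rewrite (reindex_inj (can_inj swapK)) /=; apply: eq_bigl => u.
by apply/idP/idP => /sA; rewrite -?surjective_pairing; case: u.
Qed.

Lemma vertex_swap u : vertex R (u.2, u.1) = - vertex R u.
Proof. by apply/rowP => i; rewrite !mxE /= opprB. Qed.

Lemma retr_opp AA x : swap_closed AA -> retr AA (- x) = - retr AA x.
Proof.
move=> sA; rewrite /retr /wtot -scalerN; congr (_^-1 *: _).
  by rewrite sum_swap //; apply: eq_bigr => u _; rewrite wgt_opp.
rewrite sum_swap // -sumrN; apply: eq_bigr => u _.
by rewrite wgt_opp vertex_swap scalerN.
Qed.

Lemma realization_sym AA : swap_closed AA -> centrally_symmetric (realization (R := R) AA).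
Proof.
move=> sA x [c /andP[cA /forall_inP cc] [w [w0 w1 xE]]].
pose sw := fun u : spair => (u.2, u.1).
have swI : injective sw by exact: can_inj swapK.
have memc u : (u \in [set sw v | v in c]%SET) = (sw u \in c).
  by rewrite -{1}[u]swapK (finset.mem_imset _ _ swI).
exists [set sw v | v in c]%SET.
  apply/andP; split.
    by apply/fintype.subsetP => u; rewrite memc => /(fintype.subsetP cA) /sA; rewrite swapK.
  apply/forall_inP => u; rewrite memc => uc; apply/forall_inP => v; rewrite memc => vc.
  have /forall_inP /(_ _ vc) := cc _ uc.
  by rewrite /prec /= => /orP[/andP[-> ->]|/andP[-> ->]]; rewrite ?orbT.
exists (w \o sw); split.
- by move=> u; rewrite memc => /w0.
- rewrite -[RHS]w1 [RHS](reindex_inj swI) /=.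
  by apply: eq_big => [u|u _]; rewrite ?memc.
- rewrite xE [X in - X](reindex_inj swI) -sumrN /=.
  apply: eq_big => [u|u _]; first by rewrite memc.
  by rewrite /= /sw vertex_swap scalerN opprK.
Qed.

Section Chain.
Variables (c : {set spair}) (w : spair -> R).
Hypotheses (cP : c \subset P2 n) (cc : is_chain c) (w0 : forall u, u \in c -> 0 <= w u).

(** Comparable pairs never give the same vertex opposite signs, so nothing cancels. Hence mass is
    additive on a simplex; for the energy the triangle inequality suffices. *)
Lemma chain_coord_abs i :
  `|(\sum_(u in c) w u *: vertex R u) ord0 i| = \sum_(u in c) w u * `|vertex R u ord0 i|.
Proof.
rewrite summxE; under eq_bigr do rewrite mxE.
have P u : u \in c -> u \in P2 n by exact: (fintype.subsetP cP).
have [/existsP[u /andP[uc i1]]|/existsPn H1] := boolP [exists u, (u \in c) && (i \in u.1)].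
  have H v : v \in c -> 0 <= vertex R v ord0 i.
    move=> vc; rewrite mxE; have /P2P[du _] := P u uc; have /P2P[dv _] := P v vc.
    have : i \notin v.2.
      have /forall_inP /(_ _ uc) /forall_inP /(_ _ vc) := cc.
      move=> /orP[/andP[/fintype.subsetP s1 _]|/andP[_ /fintype.subsetP s2]].
        exact/dv/s1.
      by apply/negP => /s2; apply/negP; exact: du.
    by move=> /negbTE ->; rewrite subr0.
  rewrite ger0_norm ?sumr_ge0 // => [|v vc]; last by rewrite mulr_ge0 ?w0 ?H.
  by apply: eq_bigr => v vc; rewrite ger0_norm ?H.
have H v : v \in c -> vertex R v ord0 i <= 0.
  by move=> vc; rewrite mxE; have := H1 v; rewrite vc /= => /negbTE ->; rewrite sub0r oppr_le0.
rewrite ler0_norm; last first.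
  by apply: sumr_le0 => v vc; rewrite mulr_ge0_le0 ?w0 ?H.
by rewrite -sumrN; apply: eq_bigr => v vc; rewrite ler0_norm ?H // mulrN.
Qed.

Variable E : rel 'I_n.
Hypotheses (Esym : symmetric E) (Eirr : irreflexive E).

Lemma chain_mass : mass E 1 (\sum_(u in c) w u *: vertex R u) =
  \sum_(u in c) w u * (vol E (usupp u))%:R.
Proof.
rewrite mass1; under eq_bigr => i _ do rewrite chain_coord_abs mulr_sumr.
rewrite exchange_big /=; apply: eq_bigr => u uc.
rewrite -mass_vertex ?(fintype.subsetP cP) // mass1 mulr_sumr.
by apply: eq_bigr => i _; rewrite mulrCA.
Qed.

Lemma chain_energy : energy E 1 (\sum_(u in c) w u *: vertex R u) <=
  \sum_(u in c) w u * (Defs.cut E u.1 + Defs.cut E u.2)%N%:R.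
Proof.
rewrite energy1.
have -> : \sum_(u in c) w u * (Defs.cut E u.1 + Defs.cut E u.2)%N%:R =
  esum E (fun i j => \sum_(u in c) w u * `|vertex R u ord0 i - vertex R u ord0 j|).
  rewrite esum_pair exchange_big /=; apply: eq_bigr => u uc.
  by rewrite -energy_vertex ?(fintype.subsetP cP) // energy1 esum_pair mulr_sumr.
apply: ler_esum => i j _; rewrite !summxE -sumrB.
apply: le_trans (ler_norm_sum _ _ _) _; apply: ler_sum => u uc.
by rewrite !mxE -mulrBr normrM ger0_norm ?w0.
Qed.

End Chain.

Section RealizationGraph.
Variable E : rel 'I_n.
Hypotheses (Esym : symmetric E) (Eirr : irreflexive E).
Hypothesis deg_gt0 : forall i, (1 <= deg E i)%N.

Lemma realization_bound AA (M : R) x : AA \subset P2 n ->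
  (forall u, u \in AA -> pair_ratio R E u <= M) -> realization AA x ->
  energy E 1 x <= M * mass E 1 x /\ 0 < mass E 1 x.
Proof.
move=> AP HM [c /andP[cA cc] [w [w0 w1 ->]]].
have cP := fintype.subset_trans cA AP.
have v0 u : u \in c -> 0 < (vol E (usupp u))%:R :> R.
  by move=> uc; rewrite ltr0n vol_gt0 // (fintype.subsetP cP).
rewrite (chain_mass cP cc w0); split.
  apply: le_trans (chain_energy cP w0 Esym Eirr) _; rewrite mulr_sumr.
  apply: ler_sum => u uc; rewrite mulrCA ler_wpM2l ?w0 //.
  by rewrite -ler_pdivrMr ?v0 // HM // (fintype.subsetP cA).
have [u uc wu] : exists2 u, u \in c & w u != 0.
  have [/existsP[u /andP[]]|/existsPn H] := boolP [exists u, (u \in c) && (w u != 0)].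
    by exists u.
  have : \sum_(u in c) w u = 0.
    by apply: big1 => u uc; have := H u; rewrite uc /= negbK => /eqP.
  by move=> /eqP; rewrite w1 oner_eq0.
rewrite (bigD1 u) //= ltr_wpDr ?sumr_ge0 // => [v /andP[vc _]|].
  by rewrite mulr_ge0 ?w0 // ltW // v0.
by rewrite mulr_gt0 ?v0 // lt_def wu w0.
Qed.

Lemma realization_n0 AA : AA \subset P2 n -> ~ realization AA (0 : Rn).
Proof.
move=> AP r0; pose M := \big[Num.max/0]_(u in AA) pair_ratio R E u.
have [|_] := @realization_bound AA M 0 AP _ r0.
  by move=> u uA; apply: le_bigmax_cond.
by rewrite mass1 big1 ?ltxx // => i _; rewrite mxE normr0 mulr0.
Qed.

Definition sublevel (M : R) : {set spair} :=
  [set u in P2 n | (pair_ratio R E u <= M)%R]%SET.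

Lemma sublevel_P2 M : sublevel M \subset P2 n.
Proof. by apply/fintype.subsetP => u; rewrite inE => /andP[]. Qed.

Lemma sublevel_swap M : swap_closed (sublevel M).
Proof.
move=> [A B]; rewrite !inE /= => /andP[/andP[d ne] r]; rewrite finset.setIC d.
by rewrite finset.setUC ne /= /pair_ratio /= finset.setUC addnC.
Qed.

Lemma wtot_sublevel_gt0 M x : x != 0 -> energy E 1 x <= M * mass E 1 x ->
  0 < wtot (sublevel M) x.
Proof.
move=> x0 HM; have [u uP [wu rM]] := good_layer Esym Eirr deg_gt0 x0 HM.
rewrite /wtot (bigD1 u) /=; last by rewrite inE uP.
by rewrite ltr_wpDr // sumr_ge0 // => v _; exact: wgt_ge0.
Qed.

Lemma odd_retr (S : set Rn) M : ~ S 0 ->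
  (forall x, S x -> energy E 1 x <= M * mass E 1 x) ->
  odd_map S (realization (sublevel M)) (retr (sublevel M)).
Proof.
move=> S0 HM; have H x : S x -> 0 < wtot (sublevel M) x.
  by move=> Sx; apply: wtot_sublevel_gt0 (HM x Sx); exact: (mem_neq0 S0).
split=> [|x Sx|x Sx].
- apply/subspace_continuousP => x Sx; apply: cvg_within_filter.
  exact: (retr_continuous (H x Sx)).
- by apply: retr_in; [exact: sublevel_P2|exact: H].
- exact/retr_opp/sublevel_swap.
Qed.

End RealizationGraph.

Lemma compact_realization AA : compact (realization (R := R) AA).
Proof.
pose N := #|{: spair}|.
pose ev (j : 'I_N) : spair := enum_val j.
pose A : 'M[R]_(N, n) := \matrix_(j, i) vertex R (ev j) ord0 i.
(* That the support of w is a chain is written as w_j w_k = 0 for incomparable pairs, which is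
   visibly a closed condition. *)
pose K : set 'rV[R]_N := [set w | forall j, 0 <= w ord0 j] `&`
  [set w | \sum_j w ord0 j = 1] `&`
  [set w | forall j, ev j \in AA \/ w ord0 j = 0] `&`
  [set w | forall j, forall k, prec (ev j) (ev k) || prec (ev k) (ev j) \/
           w ord0 j * w ord0 k = 0].
have clK : closed K.
  apply: closedI; [apply: closedI; [apply: closedI|]|].
  - by apply: closed_forall => j; apply: closed_ge0; exact: coord_continuous.
  - by apply: closed_level; apply: continuous_rsum => i _; exact: coord_continuous.
  - apply: closed_forall => j; have [jA|jA] := boolP (ev j \in AA).
      have -> : [set w : 'rV[R]_N | true \/ w ord0 j = 0] = setT.
        by apply/seteqP; split=> // w _; left.
      exact: closedT.
    have -> : [set w : 'rV[R]_N | false \/ w ord0 j = 0] = [set w | w ord0 j = 0].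
      by apply/seteqP; split=> w /=; [case|right].
    by apply: closed_level; exact: coord_continuous.
  - apply: closed_forall => j; apply: closed_forall => k.
    case: (prec (ev j) (ev k) || prec (ev k) (ev j)).
      have -> : [set w : 'rV[R]_N | true \/ w ord0 j * w ord0 k = 0] = setT.
        by apply/seteqP; split=> // w _; left.
      exact: closedT.
    have -> : [set w : 'rV[R]_N | false \/ w ord0 j * w ord0 k = 0] =
              [set w | w ord0 j * w ord0 k = 0].
      by apply/seteqP; split=> w /=; [case|right].
    apply: closed_level => w; apply: (@cvgM _ _ (nbhs w)); exact: coord_continuous.
have cK : compact K.
  apply: (@compact_rV R _ _ 1) => // w j [[[w0 w1] _] _].
  rewrite ger0_norm // -w1 (bigD1 j) //= lerDl; exact: sumr_ge0.
have mE w : w *m A = \sum_j w ord0 j *: vertex R (ev j).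
  apply/rowP => i; rewrite mxE summxE; apply: eq_bigr => j _; by rewrite !mxE.
suff -> : realization AA = (fun w => w *m A) @` K.
  apply: continuous_compact => //; apply: continuous_subspaceT.
  exact: mulmx_continuous.
have evS (V : zmodType) (F : spair -> V) : \sum_(j < N) F (ev j) = \sum_u F u.
  transitivity (\sum_(u in {: spair}) F u); last exact: eq_bigl.
  by rewrite [RHS]big_enum_val.
apply/seteqP; split=> [x [c /andP[cA cc] [w [w0 w1 xE]]]|x [w [[[w0 w1] wA] wc] <-]].
  exists (\row_j if ev j \in c then w (ev j) else 0).
    split; [split; [split|]|].
    - by move=> j /=; rewrite mxE; case: ifP => // /w0.
    - rewrite /= -[RHS]w1 [RHS]big_mkcond -[RHS]evS; by apply: eq_bigr => j _; rewrite mxE.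
    - move=> j /=; rewrite mxE; case: ifP; last by right.
      by move=> /(fintype.subsetP cA); left.
    - move=> j k /=; rewrite !mxE; case: ifP => [jc|]; last by right; rewrite mul0r.
      case: ifP => [kc|]; last by right; rewrite mulr0.
      by left; have /forall_inP /(_ _ jc) /forall_inP /(_ _ kc) := cc.
  rewrite mE xE [RHS]big_mkcond -[RHS]evS; apply: eq_bigr => j _.
  by rewrite mxE; case: ifP; rewrite ?scale0r.
pose er u : 'I_N := enum_rank u.
have evr u : ev (er u) = u by exact: enum_rankK.
pose c : {set spair} := [set u | (0 < w ord0 (er u))%R]%SET.
have cS (V : lmodType R) (F : spair -> V) :
    \sum_(u in c) w ord0 (er u) *: F u = \sum_j w ord0 j *: F (ev j).
  transitivity (\sum_j w ord0 (er (ev j)) *: F (ev j)); last first.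
    by apply: eq_bigr => j _; rewrite /er /ev enum_valK.
  rewrite (evS _ (fun u => w ord0 (er u) *: F u)) big_mkcond; apply: eq_bigr => u _.
  rewrite inE; case: ifP => // /negbT; rewrite -leNgt => h.
  have -> : w ord0 (er u) = 0 by apply/eqP; rewrite eq_le h w0.
  by rewrite scale0r.
exists c.
  apply/andP; split.
    apply/fintype.subsetP => u; rewrite inE => wu.
    by have [|wz] := wA (er u); [rewrite evr|rewrite wz ltxx in wu].
  apply/forall_inP => u; rewrite inE => wu; apply/forall_inP => v; rewrite inE => wv.
  have [|/eqP] := wc (er u) (er v); first by rewrite !evr.
  by rewrite mulf_eq0 !gt_eqF.
exists (fun u => w ord0 (er u)); split.
- by move=> u _; exact: w0.
- have := cS R^o (fun=> 1); rewrite /GRing.scale /=.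
  under eq_bigr do rewrite mulr1; move=> ->.
  by under eq_bigr do rewrite mulr1.
- by rewrite cS mE.
Qed.

End Retraction.

(** * Continuity of signed powers *)

Section SpowContinuous.
Variable R : realType.
Implicit Types (r a b t : R).

Lemma spow_lt r a b : 0 < r -> a < b -> spow r a < spow r b.
Proof.
move=> r0 ab; have rn0 : r != 0 by rewrite gt_eqF.
have neg c : c < 0 -> spow r c = - ((- c) `^ r).
  by move=> c0; rewrite -[c in LHS]opprK spowN spow_ge0 //; lra.
have [a0|a0] := leP 0 a.
  rewrite !spow_ge0 //; last exact: le_trans a0 (ltW ab).
  by rewrite gt0_ltr_powR // ?nnegrE //; exact: le_trans a0 (ltW ab).
have [b0|b0] := leP 0 b.
  rewrite neg // spow_ge0 //; apply: (@lt_le_trans _ _ 0); last exact: powR_ge0.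
  by rewrite oppr_lt0 powR_gt0 // oppr_gt0.
rewrite !neg // ltrN2 gt0_ltr_powR // ?nnegrE; lra.
Qed.

Lemma spowVK r t : r != 0 -> spow r (spow r^-1 t) = t.
Proof. by move=> r0; rewrite -{1}[r]invrK spowK // invr_eq0. Qed.

(* A strictly increasing map with a strictly increasing inverse. *)
Lemma spow_continuous r : 0 < r -> continuous (spow r : R -> R).
Proof.
move=> r0 t; apply/cvgrPdist_lt => e e0.
have rn0 : r != 0 by rewrite gt_eqF.
have rV0 : 0 < r^-1 by rewrite invr_gt0.
pose l := spow r^-1 (spow r t - e); pose u := spow r^-1 (spow r t + e).
have lt_ : l < t by rewrite -[X in _ < X](spowK t rn0); apply: spow_lt => //; lra.
have tu : t < u by rewrite -[X in X < _](spowK t rn0); apply: spow_lt => //; lra.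
have : \forall s \near t, l < s < u.
  by near=> s; apply/andP; split; near: s; [exact: lt_nbhsr|exact: lt_nbhsl].
apply: filterS => s /andP[ls su].
have := spow_lt r0 ls; have := spow_lt r0 su; rewrite !spowVK // => h1 h2.
by rewrite ltr_norml; apply/andP; split; lra.
Unshelve. all: by end_near.
Qed.

Lemma mspow_continuous n r : 0 < r -> continuous (@mspow R n r).
Proof.
move=> r0; apply: rV_continuous => j.
have -> : (fun x : 'rV[R]_n => mspow r x ord0 j) = (fun x => spow r (x ord0 j)).
  by apply/funext => x; rewrite mxE.
move=> x; apply: (@continuous_comp _ _ _ (fun y : 'rV[R]_n => y ord0 j) (spow r)).
  exact: coord_continuous.
exact: spow_continuous.
Qed.
End SpowContinuous.

(** * Min-max values of an abstract index *)

Section MinMax.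
Variables (R : realType) (n : nat) (E : rel 'I_n).
Notation Rn := 'rV[R]_n.
Notation spair := ({set 'I_n} * {set 'I_n})%type.
Implicit Types (x : Rn) (S : set Rn) (p q r : R).
Hypotheses (Esym : symmetric E) (Eirr : irreflexive E).
Hypothesis deg_gt0 : forall i, (1 <= deg E i)%N.

Definition adm (ind : set Rn -> nat) (k : nat) S : Prop :=
  [/\ compact S, centrally_symmetric S, ~ S 0 & (k <= ind S)%N].

Lemma compact_sphere m : compact (@sphere R m).
Proof.
apply: (@compact_rV R _ _ 1).
  apply: closed_level; apply: continuous_rsum => i _ y.
  by apply: (@cvgM _ _ (nbhs y)); exact: coord_continuous.
move=> x i; rewrite /sphere /= => x1.
rewrite -(@ler_pXn2r _ 2) ?nnegrE // expr1n real_normK ?num_real // -x1.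
by rewrite (bigD1 i) //= lerDl sumr_ge0 // => j _; exact: sqr_ge0.
Qed.

Section Index.
Variable ind : set Rn -> nat.
Hypothesis ind0 : forall S, (0 < ind S)%N -> S !=set0 /\ centrally_symmetric S.
Hypothesis indM : forall S S' f, good S -> good S' -> odd_map S S' f ->
  (ind S <= ind S')%N.
Hypothesis indP : forall S, good S -> (genus_plus S <= ind S)%N.

Variable k : nat.
Hypotheses (k1 : (1 <= k)%N) (kn : (k <= n)%N).

Lemma adm_good S : adm ind k S -> good S.
Proof.
move=> [_ Ss S0 kS]; split => //.
by have [] := ind0 (leq_trans k1 kS).
Qed.

(** The infimum of an empty set would be a default value; the unit sphere excludes this because k <=
    n. *)
Lemma adm_sphere : adm ind k (@sphere R n).
Proof.
have n1 := leq_trans k1 kn.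
have gS : good (@sphere R n).
  by split; [exact: sphere_neq0|exact: sphere_sym|exact: sphere_n0].
split; [exact: compact_sphere|exact: sphere_sym|exact: sphere_n0|].
apply: leq_trans kn (leq_trans _ (indP gS)).
apply: (@genus_plus_ge _ _ _ gS n id) => //; split => //.
by apply: continuous_subspaceT => x; exact: cvg_id.
Qed.

Lemma adm_image S (f : Rn -> Rn) : adm ind k S -> continuous f ->
  (forall x, f (- x) = - f x) -> (forall x, S x -> f x <> 0) -> adm ind k (f @` S).
Proof.
move=> aS cf fo f0; have gS := adm_good aS; case: aS => cS Ss S0 kS.
have nS : ~ (f @` S) 0 by move=> [x Sx]; exact: f0.
have sS : centrally_symmetric (f @` S).
  by move=> _ [x Sx <-]; exists (- x); [exact: Ss|exact: fo].
split => //; first by apply: continuous_compact => //; exact: continuous_subspaceT.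
apply: leq_trans kS (@indM S (f @` S) f gS _ _).
- by split => //; case: gS => -[x Sx] _ _; exists (f x), x.
- by split=> [|x Sx|x _]; [exact: continuous_subspaceT|exists x|exact: fo].
Qed.

Definition supR p S : R := sup [set Rayleigh E p x | x in S].

Lemma minmaxE p : minmax E ind p k = inf [set supR p S | S in adm ind k].
Proof. by []. Qed.

Lemma Rayleigh_le_supR p S x : 1 <= p -> S x -> Rayleigh E p x <= supR p S.
Proof.
move=> p1 Sx; apply: ub_le_sup; last by exists x.
by exists (2 `^ (p - 1)) => _ [y _ <-]; exact: Rayleigh_le.
Qed.

Lemma supR_ge0 p S : 1 <= p -> S !=set0 -> 0 <= supR p S.
Proof.
move=> p1 [x Sx]; apply: le_trans (Rayleigh_le_supR p1 Sx); exact: Rayleigh_ge0.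
Qed.

Lemma minmax_ge p c : (forall S, adm ind k S -> c <= supR p S) ->
  c <= minmax E ind p k.
Proof.
move=> H; rewrite minmaxE; apply: lb_le_inf.
  by exists (supR p (@sphere R n)), (@sphere R n) => //; exact: adm_sphere.
by move=> _ [S aS <-]; exact: H.
Qed.

Lemma minmax_le_supR p S : 1 <= p -> adm ind k S -> minmax E ind p k <= supR p S.
Proof.
move=> p1 aS; rewrite minmaxE; apply: ge_inf; last by exists S.
exists 0 => _ [S' aS' <-]; apply: supR_ge0 => //.
by case: (adm_good aS').
Qed.

Lemma minmax_le p c S : 1 <= p -> adm ind k S ->
  (forall x, S x -> Rayleigh E p x <= c) -> minmax E ind p k <= c.
Proof.
move=> p1 aS H; apply: le_trans (minmax_le_supR p1 aS) _.
apply: ge_sup; first by case: (adm_good aS) => -[x Sx] _ _; exists (Rayleigh E p x), x.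
by move=> _ [x Sx <-]; exact: H.
Qed.

Lemma minmax_ge0 p : 1 <= p -> 0 <= minmax E ind p k.
Proof.
move=> p1; apply: minmax_ge => S aS; apply: supR_ge0 => //.
by case: (adm_good aS).
Qed.

Lemma adm_mspow r S : 0 < r -> adm ind k S -> adm ind k (mspow r @` S).
Proof.
move=> r0 aS; apply: adm_image => //.
- exact: mspow_continuous.
- exact: mspowN.
- move=> x Sx /eqP; rewrite mspow_eq0 ?gt_eqF // => /eqP x0.
  by case: aS => _ _ S0 _; apply: S0; rewrite -x0.
Qed.

Lemma adm_neq0 S x : adm ind k S -> S x -> x != 0.
Proof. by move=> [_ _ S0 _] Sx; apply/eqP => x0; apply: S0; rewrite -x0. Qed.

(** Test sets for the exponent q are carried by [mspow r^-1] to test sets for r q; oddness and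
    continuity keep the index at least k. *)
Lemma minmax_upper r q : 1 <= r -> 1 <= q ->
  minmax E ind (r * q) k <= 2 `^ (r * q - q) * minmax E ind q k.
Proof.
move=> r1 q1; have r0 : 0 < r by exact: lt_le_trans r1.
have p1 : 1 <= r * q by rewrite mulr_ege1.
have c0 : 0 < 2 `^ (r * q - q) :> R by rewrite powR_gt0.
rewrite -ler_pdivrMl //; apply: minmax_ge => S aS.
rewrite ler_pdivrMl //.
have rV0 : 0 < r^-1 by rewrite invr_gt0.
apply: (@minmax_le _ _ (mspow r^-1 @` S)) => //; first exact: adm_mspow.
move=> _ [x Sx <-].
have xE : mspow r (mspow r^-1 x) = x.
  by rewrite -{1}[r]invrK mspowK // invr_eq0 gt_eqF.
have y0 : mspow r^-1 x != 0.
  by rewrite mspow_eq0 ?(adm_neq0 aS) // invr_eq0 gt_eqF.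
apply: le_trans (Rayleigh_mspow_ge E r1 q1 y0) _; rewrite xE.
by rewrite ler_wpM2l ?(ltW c0) //; exact: Rayleigh_le_supR.
Qed.

(** The reverse transport, by [mspow r]. Raising to the power r undoes the exponent 1/r of
    [Rayleigh_mspow_le]. *)
Lemma minmax_lower r q : 1 <= r -> 1 <= q ->
  (2 * minmax E ind q k) `^ r / (2 * r `^ (r * q)) <= minmax E ind (r * q) k.
Proof.
move=> r1 q1; have r0 : 0 < r by exact: lt_le_trans r1.
have p1 : 1 <= r * q by rewrite mulr_ege1.
have rn0 : r != 0 by rewrite gt_eqF.
apply: minmax_ge => S aS.
have s0 : 0 <= supR (r * q) S by apply: supR_ge0 => //; case: (adm_good aS).
have c0 : 0 < r `^ q by rewrite powR_gt0.
have H : 2 * minmax E ind q k <= r `^ q * (2 * supR (r * q) S) `^ r^-1.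
  rewrite -ler_pdivlMl //; apply: (@minmax_le _ _ (mspow r @` S)) => //.
    exact: adm_mspow.
  move=> _ [x Sx <-]; rewrite ler_pdivlMl //.
  have x0 := adm_neq0 aS Sx.
  apply: le_trans (Rayleigh_mspow_le Esym Eirr deg_gt0 r1 q1 x0) _.
  rewrite ler_wpM2l ?(ltW c0) //; apply: ge0_ler_powR.
  - by rewrite invr_ge0 ltW.
  - by rewrite nnegrE mulr_ge0 ?Rayleigh_ge0.
  - by rewrite nnegrE mulr_ge0.
  - by rewrite ler_pM2l //; exact: Rayleigh_le_supR.
have l0 := minmax_ge0 q1.
have H2 : (2 * minmax E ind q k) `^ r <= r `^ (r * q) * (2 * supR (r * q) S).
  have -> : r `^ (r * q) * (2 * supR (r * q) S) =
      (r `^ q * (2 * supR (r * q) S) `^ r^-1) `^ r.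
    rewrite powRM ?powR_ge0 // -!powRrM mulVf // powRr1 ?mulr_ge0 //.
    by rewrite [q * r]mulrC.
  apply: ge0_ler_powR; rewrite ?(ltW r0) // nnegrE ?mulr_ge0 ?powR_ge0 //.
have d0 : 0 < 2 * r `^ (r * q) by rewrite mulr_gt0 ?powR_gt0.
by rewrite ler_pdivrMr //; apply: le_trans H2 _; rewrite mulrCA mulrA mulrC mulrA.
Qed.

Lemma energy_le_mass x (M : R) : x != 0 -> Rayleigh E 1 x <= M ->
  energy E 1 x <= M * mass E 1 x.
Proof.
by move=> x0; rewrite RayleighE ler_pdivrMr // mass_gt0 // oner_eq0.
Qed.

Lemma sublevel_ind S (M : R) : adm ind k S -> (forall x, S x -> Rayleigh E 1 x <= M) ->
  (k <= ind (realization (R := R) (sublevel E M)))%N.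
Proof.
move=> aS HM; have gS := adm_good aS; case: (aS) => _ _ S0 kS.
have of_ : odd_map S (realization (sublevel E M)) (retr (sublevel E M)).
  apply: odd_retr => // x Sx; apply: energy_le_mass (HM x Sx).
  exact: adm_neq0 aS Sx.
apply: leq_trans kS (@indM _ _ _ gS _ of_); split.
- by case: gS => -[x Sx] _ _; case: of_ => _ fS _; exists (retr (sublevel E M) x); exact: fS.
- by apply: realization_sym; exact: sublevel_swap.
- by apply: (realization_n0 Esym Eirr deg_gt0); exact: sublevel_P2.
Qed.

Lemma hat_cheeger_le (AA : {set spair}) (M : R) : 0 <= M -> AA \subset P2 n ->
  (k <= ind (realization (R := R) AA))%N -> (forall u, u \in AA -> pair_ratio R E u <= M) ->
  hat_cheeger E ind k <= M.
Proof.
move=> M0 AP kA HM.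
apply: (@le_trans _ _ (\big[Num.max/0]_(u in AA) pair_ratio R E u)).
  apply: ge_inf; last by exists AA.
  exists 0 => _ [BB _ <-]; elim/big_ind: _ => // [a b a0 b0|u _].
    by rewrite le_max a0.
  by rewrite /pair_ratio divr_ge0.
by apply/bigmax_leP.
Qed.

Lemma hat_cheegerE : hat_cheeger E ind k = minmax E ind 1 k.
Proof.
apply/eqP; rewrite eq_le; apply/andP; split.
  apply: minmax_ge => S aS.
  apply: (@hat_cheeger_le (sublevel E (supR 1 S))).
  - by apply: supR_ge0 => //; case: (adm_good aS).
  - exact: sublevel_P2.
  - by apply: sublevel_ind aS _ => x Sx; exact: Rayleigh_le_supR.
  - by move=> u; rewrite inE => /andP[].
apply: lb_le_inf.
  (* Some family must be admissible for the infimum: the level 1 works because F_1 <= 1 on the whole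
     sphere. *)
  exists (\big[Num.max/0]_(u in sublevel E (1 : R)) pair_ratio R E u), (sublevel E (1 : R)) => //.
  split; first exact: sublevel_P2.
  apply: (sublevel_ind adm_sphere) => x _.
  by have := @Rayleigh_le R n E Esym Eirr 1 x (lexx 1); rewrite subrr powRr0.
move=> _ [AA [AP kA] <-].
have [rne rs] := ind0 (leq_trans k1 kA).
have aR : adm ind k (realization (R := R) AA).
  split => //; first exact: compact_realization.
  exact: (realization_n0 Esym Eirr deg_gt0).
apply: (minmax_le (lexx 1) aR) => x rx.
have HM u : u \in AA -> pair_ratio R E u <= \big[Num.max/0]_(u in AA) pair_ratio R E u.
  by move=> uA; apply: le_bigmax_cond.
have [H m0] := realization_bound Esym Eirr deg_gt0 AP HM rx.
by rewrite RayleighE ler_pdivrMr.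
Qed.

End Index.

(** A smaller index admits fewer test sets. *)
Lemma minmax_anti (ind1 ind2 : set Rn -> nat) k p : (1 <= k <= n)%N -> 1 <= p ->
  (forall S, (0 < ind1 S)%N -> S !=set0 /\ centrally_symmetric S) ->
  (forall S, (0 < ind2 S)%N -> S !=set0 /\ centrally_symmetric S) ->
  (forall S, good S -> (genus_plus S <= ind1 S)%N) ->
  (forall S, good S -> (ind1 S <= ind2 S)%N) ->
  minmax E ind2 p k <= minmax E ind1 p k.
Proof.
move=> /andP[k1 kn] p1 i1 i2 iP H; apply: (minmax_ge iP) => // S aS.
have gS := adm_good i1 k1 aS; apply: (minmax_le_supR i2) => //.
by case: aS => cS Ss S0 kS; split => //; exact: leq_trans kS (H S gS).
Qed.

End MinMax.

(** * Nodal domains *)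

Section Cheeger.
Variables (R : realType) (n : nat) (E : rel 'I_n).
Notation Rn := 'rV[R]_n.
Implicit Types (x y : Rn) (k : nat).
Hypotheses (Esym : symmetric E) (Eirr : irreflexive E).
Hypothesis deg_gt0 : forall i, (1 <= deg E i)%N.

Definition cratio (A : {set 'I_n}) : R := (Defs.cut E A)%:R / (vol E A)%:R.

Definition subpart k (A : 'I_k -> {set 'I_n}) : Prop :=
  (forall i, A i != finset.set0) /\
  (forall i j, i != j -> (A i :&: A j)%SET = finset.set0).

Lemma cratio_ge0 A : 0 <= cratio A.
Proof. by rewrite /cratio divr_ge0. Qed.

Lemma cheeger_le k (A : 'I_k -> {set 'I_n}) (M : R) : 0 <= M -> subpart A ->
  (forall i, cratio (A i) <= M) -> cheeger R E k <= M.
Proof.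
move=> M0 sA HM; apply: (@le_trans _ _ (\big[Num.max/0]_(i < k) cratio (A i))).
  apply: ge_inf; last by exists A.
  exists 0 => _ [B _ <-]; elim/big_ind: _ => [|a b a0 b0|u _];
    [by []|by rewrite le_max a0|exact: cratio_ge0].
by apply/bigmax_leP.
Qed.

Lemma cheeger_ge k (c : R) : (k <= n)%N ->
  (forall A : 'I_k -> {set 'I_n}, subpart A ->
     c <= \big[Num.max/0]_(i < k) cratio (A i)) -> c <= cheeger R E k.
Proof.
move=> kn H; apply: lb_le_inf; last by move=> _ [A sA <-]; exact: H.
pose A (i : 'I_k) : {set 'I_n} := [set widen_ord kn i]%SET.
exists (\big[Num.max/0]_(i < k) cratio (A i)); exists A; last by [].
split=> [i|i j ij].
  by apply/set0Pn; exists (widen_ord kn i); rewrite inE.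
apply/setP => l; rewrite !inE; apply/negbTE; apply: contra ij => /andP[/eqP -> /eqP].
by move=> /(congr1 val) /= /eqP; rewrite -(inj_eq val_inj).
Qed.

Lemma cheeger_ge0 k : (k <= n)%N -> 0 <= cheeger R E k.
Proof.
move=> kn; apply: cheeger_ge => // A _; elim/big_ind: _ => [|a b a0 b0|u _];
    [by []|by rewrite le_max a0|exact: cratio_ge0].
Qed.

Lemma cheeger_mono k l : (k <= l)%N -> (l <= n)%N -> cheeger R E k <= cheeger R E l.
Proof.
move=> kl ln; apply: cheeger_ge => // A [A0 Ad].
apply: (@cheeger_le k (fun i => A (widen_ord kl i))).
- elim/big_ind: _ => [|a b a0 b0|u _];
    [by []|by rewrite le_max a0|exact: cratio_ge0].
- split=> [i|i j ij]; first exact: A0.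
  by apply: Ad; apply: contra ij => /eqP /(congr1 val) /= /eqP; rewrite -(inj_eq val_inj).
- by move=> i; exact: (le_bigmax _ (fun j => cratio (A j))).
Qed.

Lemma cheeger_family (T : finType) (P : pred T) (D : T -> {set 'I_n}) (M : R) :
  0 <= M ->
  (forall s t i, P s -> P t -> i \in D s -> i \in D t -> s = t) ->
  (forall t, P t -> exists A : {set 'I_n},
     [/\ A != finset.set0, A \subset D t & cratio A <= M]) ->
  cheeger R E #|P| <= M.
Proof.
move=> M0 Dd HA.
have [f fP] : exists f : T -> {set 'I_n}, forall t, P t ->
    [/\ f t != finset.set0, f t \subset D t & cratio (f t) <= M].
  have H t : exists A : {set 'I_n}, P t ->
      [/\ A != finset.set0, A \subset D t & cratio A <= M].
    by have [/HA[A HAt]|_] := boolP (P t); [exists A|exists finset.set0].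
  by have [f Hf] := choice H; exists f.
have eP (i : 'I_#|P|) : P (enum_val i) by exact: enum_valP.
apply: (@cheeger_le _ (fun i : 'I_#|P| => f (enum_val i))) => //.
  split=> [i|i j ij]; first by case: (fP _ (eP i)).
  apply/setP => l; rewrite !inE; apply/negbTE; apply: contra ij => /andP[li lj].
  apply/eqP/enum_val_inj; apply: (Dd _ _ l) => //.
    by case: (fP _ (eP i)) => _ /fintype.subsetP H _; exact: H.
  by case: (fP _ (eP j)) => _ /fintype.subsetP H _; exact: H.
by move=> i; case: (fP _ (eP i)).
Qed.

(** Discrete integration by parts: when an antisymmetric flux psi is tested with y, each edge
    receives (y_i - y_j) psi_ij. The case q = 1, where psi is the selection z, and the case q > 1
    are thus treated alike. *)
Lemma flux_bound (q lam : R) y (psi : 'I_n -> 'I_n -> R) :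
  (forall i j, E i j -> psi i j = - psi j i) ->
  (forall i j, E i j -> `|y ord0 i - y ord0 j| `^ q <= (y ord0 i - y ord0 j) * psi i j) ->
  (forall i, y ord0 i * \sum_(j < n | E i j) psi i j =
     lam * (deg E i)%:R * `|y ord0 i| `^ q) ->
  energy E q y <= lam * mass E q y.
Proof.
move=> pa pe ps.
pose g i j : R := if E i j then (y ord0 i - y ord0 j) * psi i j else 0.
have -> : lam * mass E q y = \sum_i \sum_(j < n | E i j) y ord0 i * psi i j.
  rewrite mulr_sumr; apply: eq_bigr => i _; by rewrite mulrA -ps mulr_sumr.
have -> : \sum_i \sum_(j < n | E i j) y ord0 i * psi i j = esum E g.
  apply: (@mulfI R 2); first by rewrite pnatr_eq0.
  rewrite -esum_double //; last first.
    move=> i j; rewrite /g Esym; case: ifP => // Eji.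
    by rewrite (pa j i) // mulrN -mulNr opprB.
  rewrite mulrDl mul1r.
  have {2}-> : \sum_i \sum_(j < n | E i j) y ord0 i * psi i j =
               \sum_i \sum_(j < n | E i j) - (y ord0 j * psi i j).
    rewrite (exchange_big_dep predT) //=; apply: eq_bigr => j _.
    apply: eq_big => [i|i Eij]; first by rewrite Esym.
    by rewrite (pa i j) ?mulrN // Esym.
  rewrite -big_split; apply: eq_bigr => i _; rewrite -big_split.
  by apply: eq_bigr => j Eij; rewrite /g Eij mulrBl.
by apply: ler_esum => i j Eij; rewrite /g Eij; exact: pe.
Qed.

Definition restr x (D : {set 'I_n}) : Rn := \row_i (if i \in D then x ord0 i else 0).

(** True of nodal domains: an edge leaving one ends at a zero or at the opposite sign. *)
Definition isolated x (D : {set 'I_n}) : Prop :=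
  forall i j, E i j -> i \in D -> j \notin D -> x ord0 i * x ord0 j <= 0.

Lemma phi_mul (p t : R) : 0 < p -> phi p t * t = `|t| `^ p.
Proof.
move=> p0; have [->|t0] := eqVneq t 0.
  by rewrite /phi !mulr0 normr0 powR0 // gt_eqF.
rewrite /phi -mulrA -expr2 -real_normK ?num_real // -powR_mulrn ?normr_ge0 //.
by rewrite -powRD ?subrK // normr_eq0 t0 implybT.
Qed.

Lemma phiN (p t : R) : phi p (- t) = - phi p t.
Proof. by rewrite /phi normrN mulrN. Qed.

(** Since a b <= 0, |a - b| = |a| + |b|: replacing b by 0 can only lower the contribution of the
    edge. *)
Lemma phi_opp_ge (p a b : R) : 1 <= p -> a * b <= 0 -> `|a| `^ p <= a * phi p (a - b).
Proof.
move=> p1 ab; have p0 : 0 < p by exact: lt_le_trans p1.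
have [->|a0] := eqVneq a 0; first by rewrite normr0 powR0 ?mul0r // gt_eqF.
have sE : `|a - b| = `|a| + `|b|.
  have [ap|an|az] := ltgtP 0 a; last by rewrite -az eqxx in a0.
    have b0 : b <= 0 by rewrite -(pmulr_rle0 _ ap).
    by rewrite (gtr0_norm ap) (ler0_norm b0) ger0_norm; lra.
  have b0 : 0 <= b by rewrite -(nmulr_rle0 _ an).
  by rewrite (ltr0_norm an) (ger0_norm b0) ler0_norm; lra.
have mE : a * (a - b) = `|a| * `|a - b|.
  rewrite -normrM ger0_norm // mulrBr -expr2; have := sqr_ge0 a; lra.
have s0 : 0 < `|a - b| by rewrite sE ltr_wpDr // normr_gt0.
rewrite /phi mulrCA mE mulrCA.
have -> : `|a - b| `^ (p - 2) * `|a - b| = `|a - b| `^ (p - 1).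
  rewrite -{2}[`|a - b|]powRr1 // -powRD; last by rewrite (gt_eqF s0) implybT.
  by congr (_ `^ _); lra.
rewrite -(mulr_powRB1 (normr_ge0 a) p0) ler_wpM2l // ge0_ler_powR ?nnegrE ?subr_ge0 //.
by rewrite sE lerDl.
Qed.

(** The equation for x is tested with its restriction. Edges inside D are unchanged, and edges
    leaving D carry at least the energy that the restriction has on them. *)
Lemma restr_energy (q lam : R) x D : 1 <= q -> eigenpair E q lam x ->
  isolated x D -> energy E q (restr x D) <= lam * mass E q (restr x D).
Proof.
move=> q1 eig iso; have q0 : 0 < q by exact: lt_le_trans q1.
have iso' i j : E i j -> i \notin D -> j \in D -> x ord0 j * x ord0 i <= 0.
  by move=> Eij iD jD; apply: iso => //; rewrite Esym.
move: eig; rewrite /eigenpair; case: eqP => [qe1|_].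
  move=> [_ [z [zP sP]]].
  have zsg i j : E i j -> 0 < x ord0 i - x ord0 j -> z i j = 1.
    by move=> /zP[+ _]; rewrite /Sgn => + h; rewrite h.
  have zsgN i j : E i j -> x ord0 i - x ord0 j < 0 -> z i j = -1.
    by move=> /zP[+ _]; rewrite /Sgn => + h; rewrite ltNge ltW // h.
  have zabs i j : E i j -> (x ord0 i - x ord0 j) * z i j = `|x ord0 i - x ord0 j|.
    move=> Eij; have [h|h|h] := ltgtP 0 (x ord0 i - x ord0 j).
    - by rewrite zsg // mulr1 gtr0_norm.
    - by rewrite zsgN // mulrN1 ltr0_norm.
    - by rewrite -h mul0r normr0.
  have zout i j : E i j -> x ord0 i * x ord0 j <= 0 -> `|x ord0 i| <= x ord0 i * z i j.
    move=> Eij xx; have [h|h|h] := ltgtP 0 (x ord0 i).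
    - have xj : x ord0 j <= 0 by rewrite -(pmulr_rle0 _ h).
      by rewrite zsg ?mulr1 ?gtr0_norm //; lra.
    - have xj : 0 <= x ord0 j by rewrite -(nmulr_rle0 _ h).
      by rewrite zsgN ?mulrN1 ?ltr0_norm //; lra.
    - by rewrite -h mul0r normr0.
  apply: (@flux_bound q lam _ z) => [i j /zP[]//|i j Eij|i].
  - rewrite qe1 powRr1 // !mxE; case: ifP => iD; case: ifP => jD.
    + by rewrite zabs.
    + by rewrite subr0 zout //; apply: iso => //; rewrite jD.
    + have Eji : E j i by rewrite Esym.
      rewrite sub0r normrN (proj2 (zP _ _ Eij)) mulrNN zout //.
      by apply: iso => //; rewrite iD.
    + by rewrite subrr normr0 mul0r.
  - have [s sS ->] := sP i; rewrite qe1 powRr1 // !mxE; case: ifP => iD.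
      rewrite [RHS]mulrC mulrCA [RHS]mulrC; congr (_ * _).
      move: sS; rewrite /Sgn; case: (ltgtP 0 (x ord0 i)) => [h ->|h ->|<- _].
      - by rewrite mulr1 gtr0_norm.
      - by rewrite mulrN1 ltr0_norm.
      - by rewrite mul0r normr0.
    by rewrite mul0r normr0 mulr0.
move=> [_ Hlap].
apply: (@flux_bound q lam _ (fun i j => phi q (x ord0 i - x ord0 j))) => [i j _|i j Eij|i].
- by rewrite -phiN opprB.
- rewrite !mxE; case: ifP => iD; case: ifP => jD.
  + by rewrite mulrC phi_mul.
  + by rewrite !subr0 phi_opp_ge //; apply: iso => //; rewrite jD.
  + rewrite sub0r normrN mulNr -mulrN -phiN opprB phi_opp_ge //.
    by apply: iso' => //; rewrite iD.
  + by rewrite subrr normr0 powR0 ?mul0r // gt_eqF.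
- rewrite mxE; case: ifP => iD; last by rewrite mul0r normr0 powR0 ?mulr0 // gt_eqF.
  by rewrite -/(Laplacian E q x i) Hlap mulrCA [_ * phi _ _]mulrC phi_mul.
Qed.

Lemma nodal_coarea (q lam L : R) x D : 1 <= q -> eigenpair E q lam x -> lam <= L ->
  isolated x D -> D != finset.set0 ->
  (forall i, i \in D -> 0 < x ord0 i) \/ (forall i, i \in D -> x ord0 i < 0) ->
  exists A : {set 'I_n}, [/\ A != finset.set0, A \subset D &
    cratio A <= q / 2 * (2 * L) `^ q^-1].
Proof.
move=> q1 eig lL iso /set0Pn[i0 i0D] sgn; have q0 : 0 < q by exact: lt_le_trans q1.
have qn0 : q != 0 by rewrite gt_eqF.
pose y := restr x D.
have yi i : i \notin D -> y ord0 i = 0 by rewrite mxE => /negbTE ->.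
have y0 : y != 0.
  apply/eqP => /rowP/(_ i0); rewrite !mxE i0D => xi.
  by case: sgn => /(_ i0 i0D); rewrite xi ltxx.
have Fy : Rayleigh E q y <= L.
  apply: le_trans lL; rewrite RayleighE ler_pdivrMr; last exact: mass_gt0.
  exact: restr_energy.
have Fy0 := Rayleigh_ge0 E q y.
pose z := mspow q y.
have z0 : z != 0 by rewrite mspow_eq0.
(* The comparison of quotients with r = q and base exponent 1, divided by 2. *)
have Fz : Rayleigh E 1 z <= q / 2 * (2 * L) `^ q^-1.
  have := Rayleigh_mspow_le Esym Eirr deg_gt0 q1 (lexx 1) y0.
  rewrite powRr1 ?(ltW q0) // mulr1 -/z => H.
  have : 2 * Rayleigh E 1 z <= q * (2 * L) `^ q^-1.
    apply: le_trans H _; rewrite ler_wpM2l ?(ltW q0) //; apply: ge0_ler_powR.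
    - by rewrite invr_ge0 ltW.
    - by rewrite nnegrE mulr_ge0.
    - by rewrite nnegrE mulr_ge0 //; exact: le_trans Fy.
    - by rewrite ler_pM2l.
  by rewrite mulrAC; lra.
have fin (w : Rn) : w != 0 -> (forall i, 0 <= w ord0 i) ->
    (forall i, i \notin D -> w ord0 i = 0) -> Rayleigh E 1 w = Rayleigh E 1 z ->
    exists A : {set 'I_n}, [/\ A != finset.set0, A \subset D &
      cratio A <= q / 2 * (2 * L) `^ q^-1].
  move=> w0 wp wD Fw; have HM : energy E 1 w <= q / 2 * (2 * L) `^ q^-1 * mass E 1 w.
    by apply: energy_le_mass => //; rewrite Fw.
  have [A [A0 AD rA]] := coarea Esym Eirr deg_gt0 w0 wp HM.
  exists A; split => //; apply/fintype.subsetP => i iA; apply: contraT => iD.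
  by have := AD i iA; rewrite wD // ltxx.
have zD i : i \notin D -> z ord0 i = 0.
  by move=> iD; rewrite mxE yi // /spow sgr0 mul0r.
case: sgn => sg.
  apply: (fin z) => // i; have [iD|/zD -> //] := boolP (i \in D).
  by rewrite mxE /spow mulr_ge0 ?powR_ge0 // sgr_ge0 mxE iD ltW // sg.
apply: (fin (- z)).
- by rewrite oppr_eq0.
- move=> i; have [iD|/zD zi] := boolP (i \in D); last by rewrite mxE zi oppr0.
  rewrite mxE mxE /spow oppr_ge0 mulr_le0_ge0 ?powR_ge0 // sgr_le0 mxE iD.
  by rewrite ltW // sg.
- by move=> i /zD zi; rewrite mxE zi oppr0.
- rewrite !RayleighE !energy1 !mass1; congr (_ / _).
    by congr esum; apply/funext => i; apply/funext => j; rewrite !mxE -opprD normrN.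
  by apply: eq_bigr => i _; rewrite mxE normrN.
Qed.

Lemma nodal_cheeger (q lam L : R) x : 1 <= q -> 0 <= L -> eigenpair E q lam x ->
  lam <= L -> cheeger R E (nodal_domains E x) <= q / 2 * (2 * L) `^ q^-1.
Proof.
move=> q1 L0 eig lL.
have cs (e : rel 'I_n) : symmetric e -> connect_sym e by exact: sym_connect_sym.
have psym : symmetric (pos_adj E x).
  by move=> i j; rewrite /pos_adj /= Esym; case: (E j i) => //=; rewrite andbC.
have nsym : symmetric (neg_adj E x).
  by move=> i j; rewrite /neg_adj /= Esym; case: (E j i) => //=; rewrite andbC.
pose D (t : 'I_n + 'I_n) : {set 'I_n} := match t with
  | inl r => [set i | connect (pos_adj E x) r i]%SET
  | inr r => [set i | connect (neg_adj E x) r i]%SET end.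
pose P (t : 'I_n + 'I_n) : bool := match t with
  | inl r => (r \in roots (pos_adj E x)) && (0 < x ord0 r)
  | inr r => (r \in roots (neg_adj E x)) && (x ord0 r < 0) end.
have pclosed : closed_mem (pos_adj E x) (mem [pred i | 0 < x ord0 i]).
  by move=> i j /and3P[_ xi xj]; rewrite !inE xi xj.
have nclosed : closed_mem (neg_adj E x) (mem [pred i | x ord0 i < 0]).
  by move=> i j /and3P[_ xi xj]; rewrite !inE xi xj.
have Dpos r i : 0 < x ord0 r -> i \in D (inl r) -> 0 < x ord0 i.
  by rewrite inE => xr /(closed_connect pclosed); rewrite !inE xr.
have Dneg r i : x ord0 r < 0 -> i \in D (inr r) -> x ord0 i < 0.
  by rewrite inE => xr /(closed_connect nclosed); rewrite !inE xr.
have -> : nodal_domains E x = #|P|.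
  rewrite -sum1_card big_sumType /= !sum1_card /nodal_domains /n_comp_mem.
  by congr (_ + _)%N; apply: eq_card => r; rewrite !inE.
have M0 : 0 <= q / 2 * (2 * L) `^ q^-1.
  by rewrite mulr_ge0 ?powR_ge0 // divr_ge0 //; lra.
apply: (@cheeger_family _ _ D) => //.
  move=> [r|r] [s|s] i /andP[rr xr] /andP[rs xs].
  - rewrite !inE => ci cj; congr inl; apply/eqP.
    have : connect (pos_adj E x) r s by apply: connect_trans ci _; rewrite (cs _ psym).
    by rewrite -(root_connect (cs _ psym)) (eqP rr) (eqP rs).
  - by move=> /(Dpos _ _ xr) h1 /(Dneg _ _ xs) h2; exfalso; lra.
  - by move=> /(Dneg _ _ xr) h1 /(Dpos _ _ xs) h2; exfalso; lra.
  - rewrite !inE => ci cj; congr inr; apply/eqP.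
    have : connect (neg_adj E x) r s by apply: connect_trans ci _; rewrite (cs _ nsym).
    by rewrite -(root_connect (cs _ nsym)) (eqP rr) (eqP rs).
move=> [r|r] /andP[rr xr]; apply: (nodal_coarea q1 eig lL).
- move=> i j Eij iD jD; have xi := Dpos r i xr iD; rewrite pmulr_rle0 // leNgt.
  apply/negP => xj; move/negP: jD; apply; rewrite inE; rewrite inE in iD.
  by apply: connect_trans iD (connect1 _); rewrite /pos_adj /= Eij xi xj.
- by apply/set0Pn; exists r; rewrite inE connect0.
- by left=> i; exact: Dpos.
- move=> i j Eij iD jD; have xi := Dneg r i xr iD; rewrite nmulr_rle0 // leNgt.
  apply/negP => xj; move/negP: jD; apply; rewrite inE; rewrite inE in iD.
  by apply: connect_trans iD (connect1 _); rewrite /neg_adj /= Eij xi xj.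
- by apply/set0Pn; exists r; rewrite inE connect0.
- by right=> i; exact: Dneg.
Qed.

(** This makes the maximum defining s_k exist, and the Cheeger constant of that order a minimum over
    a nonempty set. *)
Lemma nodal_le x : (nodal_domains E x <= n)%N.
Proof.
rewrite /nodal_domains /n_comp_mem -cardUI.
have -> : #|predI [predI roots (pos_adj E x) & [pred i | (0 < x ord0 i)%R]]
     [predI roots (neg_adj E x) & [pred i | (x ord0 i < 0)%R]]| = 0%N.
  by apply: eq_card0 => i; rewrite !inE; case: ltgtP; rewrite ?andbF.
by rewrite addn0; apply: leq_trans (max_card _) _; rewrite card_ord.
Qed.

End Cheeger.

(** * Random partitions and the higher-order Cheeger inequality *)

Section Partition.
Variables (R : realType) (V Om : finType).
Implicit Types (u v : V) (D : {set V}).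
Variables (g : Om -> V -> nat) (a L : R) (w d : V -> V -> R).
Hypothesis a0 : 0 < a.
Hypothesis L0 : 0 <= L.
Hypothesis w0 : forall u v, 0 <= w u v.
Hypothesis wC : forall u v, w u v = w v u.
Hypothesis d0 : forall u v, 0 <= d u v.
Hypothesis ga : forall v, \sum_(z : Om) (g z v)%:R = a.
Hypothesis gd : forall u v,
  \sum_(z : Om) `|(g z u)%:R - (g z v)%:R| <= 2 * L * a * d u v.

(** The pair (z, t) plays the role of a random parameter: for fixed z, the vertex v lies in the
    droplets of exactly g z v levels t. *)
Definition droplet (z : Om) (t : nat) : {set V} := [set v | (t < g z v)%N]%SET.

Definition gmax : nat := \max_z \max_v g z v.

Lemma g_le_gmax z v : (g z v <= gmax)%N.
Proof.
by apply: (@leq_trans (\max_v g z v)); [exact: leq_bigmax|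
   exact: (@leq_bigmax _ (fun z => \max_v g z v))].
Qed.

Lemma sum_lt (T m : nat) : (m <= T)%N -> \sum_(t < T) (t < m)%N%:R = m%:R :> R.
Proof.
move=> mT; rewrite (eq_bigr (fun t : 'I_T => if (t < m)%N then 1 else 0)) => [|t _].
  by rewrite -big_mkcond (big_ord_narrow mT) sumr_const card_ord.
by case: ltnP.
Qed.

Lemma sum_sep (T b c : nat) : (b <= T)%N -> (c <= T)%N ->
  \sum_(t < T) ((t < b)%N%:R * (1 - (t < c)%N%:R) + (t < c)%N%:R * (1 - (t < b)%N%:R)) =
  `|b%:R - c%:R| :> R.
Proof.
wlog cb : b c / (c <= b)%N.
  move=> H bT cT; case/orP: (leq_total c b) => [cb|bc]; first exact: H.
  by rewrite distrC -H //; apply: eq_bigr => t _; rewrite addrC.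
move=> bT cT; rewrite ger0_norm ?subr_ge0 ?ler_nat //.
rewrite -(sum_lt bT) -(sum_lt cT) -sumrB; apply: eq_bigr => t _.
have [tb|tb] := ltnP t b; have [tc|tc] := ltnP t c; rewrite ?subrr ?subr0 ?mulr0 ?mul0r ?mul1r ?addr0 ?add0r //.
by have := leq_trans tc cb; rewrite ltnNge tb.
Qed.

Definition pot (W : {set V}) (D : {set V}) : R :=
  \sum_(u in D) \sum_(v in W) w u v * d u v.

Definition cutw (W : {set V}) (D : {set V}) : R :=
  \sum_(u in W) \sum_(v in W) w u v * ((u \in D)%:R * (1 - (v \in D)%:R)).

(** Over all (z, t), each vertex is covered a times, and a pair u, v is separated as often as the
    sum of |g z u - g z v|, which [gd] bounds by d u v. Symmetry of w averages the two orders of a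
    pair; this is the 2 in [gd]. *)
Lemma droplet_sum (W : {set V}) :
  \sum_(z : Om) \sum_(t < gmax) cutw W (droplet z t) <=
  \sum_(z : Om) \sum_(t < gmax) L * pot W (droplet z t :&: W)%SET.
Proof.
have I u z (t : nat) : (u \in droplet z t)%:R = (t < g z u)%N%:R :> R by rewrite inE.
have -> : \sum_(z : Om) \sum_(t < gmax) L * pot W (droplet z t :&: W)%SET =
    L * (a * pot W W).
  transitivity (\sum_(z : Om) \sum_(t < gmax) \sum_(u in W)
      (t < g z u)%N%:R * (L * \sum_(v in W) w u v * d u v)).
    apply: eq_bigr => z _; apply: eq_bigr => t _; rewrite /pot mulr_sumr big_mkcond.
    rewrite [RHS]big_mkcond; apply: eq_bigr => u _; rewrite !inE.
    by case: (u \in W); rewrite ?andbF ?andbT //; case: (_ < _)%N; rewrite ?mul1r ?mul0r.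
  under eq_bigr do rewrite exchange_big /=.
  rewrite exchange_big /pot !mulr_sumr /=; apply: eq_bigr => u _.
  under eq_bigr => z _ do rewrite -mulr_suml (sum_lt (g_le_gmax z u)).
  by rewrite -mulr_suml ga mulrCA.
have -> : \sum_(z : Om) \sum_(t < gmax) cutw W (droplet z t) =
    \sum_(u in W) \sum_(v in W) w u v * \sum_(z : Om) \sum_(t < gmax)
      ((t < g z u)%N%:R * (1 - (t < g z v)%N%:R)).
  transitivity (\sum_(z : Om) \sum_(t < gmax) \sum_(u in W) \sum_(v in W)
      w u v * ((t < g z u)%N%:R * (1 - (t < g z v)%N%:R))).
    by do 4!(apply: eq_bigr => ? _); rewrite !I.
  under eq_bigr do rewrite exchange_big /=.
  rewrite exchange_big /=; apply: eq_bigr => u _.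
  under eq_bigr do rewrite exchange_big /=.
  rewrite exchange_big /=; apply: eq_bigr => v _; rewrite mulr_sumr.
  by apply: eq_bigr => z _; rewrite mulr_sumr.
pose c u v : R := \sum_(z : Om) \sum_(t < gmax) ((t < g z u)%N%:R * (1 - (t < g z v)%N%:R)).
change (\sum_(u in W) \sum_(v in W) w u v * c u v <= L * (a * pot W W)).
have cS u v : c u v + c v u <= 2 * L * a * d u v.
  apply: le_trans (gd u v); rewrite /c -big_split /=; apply: ler_sum => z _.
  by rewrite -big_split /= sum_sep ?g_le_gmax.
have E : \sum_(u in W) \sum_(v in W) w u v * c u v =
         \sum_(u in W) \sum_(v in W) w u v * c v u.
  by rewrite exchange_big /=; apply: eq_bigr => u _; apply: eq_bigr => v _; rewrite wC.
rewrite -(@ler_pM2l _ 2) // mulrDl mul1r {2}E -big_split /=.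
have -> : 2 * (L * (a * pot W W)) = \sum_(u in W) \sum_(v in W) w u v * (2 * L * a * d u v).
  rewrite /pot !mulr_sumr; apply: eq_bigr => u _; rewrite !mulr_sumr.
  by apply: eq_bigr => v _; ring.
apply: ler_sum => u _; rewrite -big_split /=; apply: ler_sum => v _.
by rewrite -mulrDr ler_wpM2l.
Qed.

(* Averaging over all z and t: the total weight cut by the droplets is at most L
   times the total potential they contain. *)
Lemma good_droplet (W : {set V}) : W != finset.set0 -> exists z t,
  [/\ (droplet z t :&: W)%SET != finset.set0 &
   cutw W (droplet z t) <= L * pot W (droplet z t :&: W)%SET].
Proof.
move=> /set0Pn[v vW].
have [/existsP[z /existsP[t /andP[ne le_]]]|/existsPn H] := boolP [exists z : Om, exists t : 'I_gmax,
   ((droplet z t :&: W)%SET != finset.set0) &&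
   (cutw W (droplet z t) <= L * pot W (droplet z t :&: W)%SET)].
  by exists z, t.
exfalso; have := droplet_sum W; apply/negP; rewrite -ltNge.
have empty z t : (droplet z t :&: W)%SET = finset.set0 ->
    cutw W (droplet z t) = L * pot W (droplet z t :&: W)%SET.
  move=> e; rewrite e /pot big_set0 mulr0 /cutw big1 // => u uW.
  rewrite big1 // => v' _; have : u \notin droplet z t.
    by apply/negP => ud; move/setP/(_ u): e; rewrite finset.in_setI ud uW finset.in_set0.
  by move=> /negbTE ->; rewrite mul0r mulr0.
have le1 z (t : 'I_gmax) : L * pot W (droplet z t :&: W)%SET <= cutw W (droplet z t).
  have := H z; rewrite negb_exists => /forallP /(_ t).
  rewrite negb_and negbK => /orP[/eqP /empty -> //|]; rewrite -ltNge; exact: ltW.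
have [z gz] : exists z, (0 < g z v)%N.
  apply/existsP; apply: contraT => /existsPn Hz; move: a0; rewrite -(ga v) big1 ?ltxx // => z _.
  by have := Hz z; rewrite -eqn0Ngt => /eqP ->.
have gm : (0 < gmax)%N by apply: leq_trans gz (g_le_gmax z v).
pose t0 : 'I_gmax := Ordinal gm.
have lt1 : L * pot W (droplet z t0 :&: W)%SET < cutw W (droplet z t0).
  have := H z; rewrite negb_exists => /forallP /(_ t0).
  rewrite negb_and negbK => /orP[/eqP e|]; last by rewrite -ltNge.
  by move/setP/(_ v): e; rewrite !inE gz vW.
rewrite [ltLHS](bigD1 z) //= [ltRHS](bigD1 z) //=; apply: ltr_leD.
  rewrite [ltLHS](bigD1 t0) //= [ltRHS](bigD1 t0) //=; apply: ltr_leD => //.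
  by apply: ler_sum => t _; exact: le1.
by apply: ler_sum => z' _; apply: ler_sum => t _; exact: le1.
Qed.

Definition sepw (W : {set V}) (P : V -> nat) : R :=
  \sum_(u in W) \sum_(v in W) w u v * (P u != P v)%:R.

(** Remove a good droplet and recurse. The potential is superadditive over the removed and the
    remaining part, so the cuts are paid for once in total; the factor 2 counts separated pairs in
    both orders. *)
Lemma partition_exists (W : {set V}) : exists P : V -> nat,
  [/\ forall u, u \in W -> (P u <= #|W|)%N,
      forall u v, u \in W -> v \in W -> P u = P v ->
        exists z, (0 < g z u)%N /\ (0 < g z v)%N &
      sepw W P <= 2 * L * pot W W].
Proof.
move: {2}(#|W|.+1) (ltnSn #|W|) => m; elim: m W => // m IH W Wm.
have [->|Wn] := eqVneq W finset.set0.
  exists (fun=> 0%N); split=> [u|u v|]; rewrite ?inE //.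
  by rewrite /sepw /pot !big_set0 mulr0.
have [z [t [Dn HD]]] := good_droplet Wn.
set D := droplet z t in Dn HD.
pose W' := (W :\: D)%SET.
have W'm : (#|W'| < #|W|)%N.
  apply: proper_card; apply/fintype.properP; split; first exact: subsetDl.
  by have /set0Pn[v] := Dn; rewrite inE => /andP[vD vW]; exists v; rewrite // inE vD.
have [P' [P1 P2 P3]] := IH W' (leq_trans W'm Wm).
(* The label #|W| is new: labels on the strictly smaller W' are at most #|W'|. *)
pose P v := if v \in D then #|W| else P' v.
have inW' v : v \in W -> v \notin D -> v \in W' by move=> vW vD; rewrite inE vD.
have ltP v : v \in W -> v \notin D -> (P' v < #|W|)%N.
  by move=> vW vD; apply: leq_ltn_trans W'm; exact/P1/inW'.
exists P; split=> [u uW|u v uW vW|].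
- by rewrite /P; case: ifPn => // uD; exact/ltnW/ltP.
- rewrite /P; case: ifPn => uD; case: ifPn => vD E.
  + exists z; move: uD vD; rewrite !inE => h1 h2.
    by split; [exact: leq_ltn_trans h1|exact: leq_ltn_trans h2].
  + by have := ltP v vW vD; rewrite -E ltnn.
  + by have := ltP u uW uD; rewrite E ltnn.
  + by apply: P2 => //; exact: inW'.
have splitW (F : V -> R) : \sum_(u in W) F u = \sum_(u in (D :&: W)%SET) F u + \sum_(u in W') F u.
  rewrite (bigID (fun u => u \in D)) /=; congr (_ + _); apply: eq_bigl => u; rewrite !inE //; exact: andbC.
have sepE : sepw W P <= sepw W' P' + 2 * cutw W D.
  have cE : cutw W D = \sum_(u in W) \sum_(v in W) w u v * ((v \in D)%:R * (1 - (u \in D)%:R)).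
    by rewrite /cutw exchange_big /=; apply: eq_bigr => u _; apply: eq_bigr => v _; rewrite wC.
  have sE : sepw W' P' = \sum_(u in W) \sum_(v in W)
      w u v * ((1 - (u \in D)%:R) * (1 - (v \in D)%:R) * (P' u != P' v)%:R).
    rewrite /sepw [LHS]big_mkcond [RHS]big_mkcond; apply: eq_bigr => u _; rewrite inE.
    case: (u \in W); rewrite ?andbF ?andbT //; case uD: (u \in D) => /=.
      by rewrite big1 // => v _; rewrite subrr !mul0r mulr0.
    rewrite [LHS]big_mkcond [RHS]big_mkcond; apply: eq_bigr => v _; rewrite inE.
    case: (v \in W); rewrite ?andbF ?andbT //; case: (v \in D) => /=.
      by rewrite subrr mulr0 mul0r mulr0.
    by rewrite !subr0 !mul1r.
  rewrite mulrDl mul1r {2}cE sE -!big_split /=; apply: ler_sum => u uW.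
  rewrite -!big_split /=; apply: ler_sum => v vW; rewrite -!mulrDr ler_wpM2l //.
  rewrite /P; case: (u \in D); case: (v \in D);
    rewrite /= ?subrr ?subr0 ?mulr0 ?mul0r ?mul1r ?add0r ?addr0 ?eqxx //=;
    by case: (_ == _); rewrite /= ?ler01.
apply: le_trans sepE _.
apply: le_trans (lerD P3 (ler_wpM2l (ler0n R 2) HD)) _.
have HP : pot W' W' + pot W (D :&: W)%SET <= pot W W.
  rewrite [in leRHS]/pot splitW addrC lerD2l; apply: ler_sum => u uW.
  rewrite [leRHS]splitW lerDr; apply: sumr_ge0 => v _; exact: mulr_ge0.
rewrite [2 * (L * _)]mulrA -mulrDr ler_wpM2l // mulr_ge0 //.
Qed.

End Partition.

Section Grouping.
Variables (R : realType) (T : finType) (a : T -> R) (B : R).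
Hypothesis aB : forall t, a t <= B.
Hypothesis B1 : 1 <= B.

(* A minimal set of mass at least 1/2 is a single element or has mass at most 1. *)
Lemma half_block (s : {set T}) : 2^-1 <= \sum_(t in s) a t ->
  exists2 b : {set T}, b \subset s & 2^-1 <= \sum_(t in b) a t <= B.
Proof.
move=> hs; have [b /minsetP[hb bmin] bs] := @minset_exists T
  (fun b : {set T} => 2^-1 <= \sum_(t in b) a t) s hs.
exists b => //; rewrite hb /=.
have [b0|/set0Pn[t tb]] := eqVneq b finset.set0.
  by move: hb; rewrite b0 big_set0; lra.
have [ht|ht] := leP (2^-1) (a t).
  have <- : [set t]%SET = b.
    by apply: bmin; [rewrite big_set1|rewrite finset.sub1set].
  by rewrite big_set1.
have : ~~ (2^-1 <= \sum_(i in b :\ t) a i).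
  apply/negP => /bmin /(_ (subD1set _ _)) /setP/(_ t).
  by rewrite !inE eqxx tb.
rewrite -ltNge (big_setD1 t tb) /= => h; move: B1; lra.
Qed.

(** A block uses up at most B, so after j - 1 blocks a mass 1/2 is still there for the last one. *)
Lemma half_blocks (j : nat) (s : {set T}) :
  (0 < j)%N -> (j.-1)%:R * B + 2^-1 <= \sum_(t in s) a t ->
  exists G : nat -> {set T}, [/\ forall i, (i < j)%N -> 2^-1 <= \sum_(t in G i) a t,
    forall i, G i \subset s &
    forall i i', (i < j)%N -> (i' < j)%N -> i != i' -> (G i :&: G i')%SET = finset.set0].
Proof.
elim: j s => // j IH s _ /= hs.
have B0 : 0 <= B by exact: le_trans B1.
have [|b bs /andP[b1 b2]] := @half_block s.
  by apply: le_trans hs; rewrite lerDr mulr_ge0.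
have [j0|j0] := posnP j.
  exists (fun=> b); split=> // i i'; rewrite j0 !ltnS !leqn0 => /eqP -> /eqP ->.
  by rewrite eqxx.
have [|G [G1 G2 G3]] := IH (s :\: b)%SET j0.
  have : \sum_(t in s) a t = \sum_(t in b) a t + \sum_(t in (s :\: b)%SET) a t.
    by rewrite (big_setID b) /= (finset.setIidPr bs).
  move: hs; rewrite -[X in X%:R * B](prednK j0) -natr1 mulrDl mul1r; lra.
exists (fun i => if i == j then b else G i); split=> [i|i|i i' ij i'j ii'].
- by rewrite ltnS leq_eqVlt; case: eqP => //= _; exact: G1.
- by case: eqP => // _; apply: fintype.subset_trans (G2 i) _; exact: subsetDl.
have db i0 : (b :&: G i0)%SET = finset.set0.
  apply/setP => t; rewrite !inE; apply/negP => /andP[tb tG].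
  by have := fintype.subsetP (G2 i0) _ tG; rewrite inE tb.
move: ij i'j ii'; rewrite !ltnS; case: (i =P j) => [->|ij]; case: (i' =P j) => [->|i'j] //.
- by rewrite eqxx.
- by move=> _ _ _; rewrite finset.setIC.
move=> ij' i'j'; apply: G3; rewrite ltn_neqAle ?ij' ?i'j' andbT; exact/eqP.
Qed.
End Grouping.

Section CauchySchwarz.
Variables (R : realType) (I : Type) (r : seq I) (P : pred I).

(** Lagrange's identity: the defect is half the double sum of (a_i b_j - a_j b_i)^2. *)
Lemma cauchy_schwarz (a b : I -> R) :
  (\sum_(i <- r | P i) a i * b i) ^+ 2 <=
  (\sum_(i <- r | P i) a i ^+ 2) * \sum_(i <- r | P i) b i ^+ 2.
Proof.
pose s (f g : I -> R) := \sum_(i <- r | P i) f i * g i.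
have sE (x y : I -> R) : (\sum_(i <- r | P i) x i) * (\sum_(i <- r | P i) y i) =
    \sum_(i <- r | P i) \sum_(j <- r | P j) x i * y j.
  by rewrite mulr_suml; apply: eq_bigr => i _; rewrite mulr_sumr.
have : 0 <= \sum_(i <- r | P i) \sum_(j <- r | P j) (a i * b j - a j * b i) ^+ 2.
  by apply: sumr_ge0 => i _; apply: sumr_ge0 => j _; exact: sqr_ge0.
have -> : \sum_(i <- r | P i) \sum_(j <- r | P j) (a i * b j - a j * b i) ^+ 2 =
  (\sum_(i <- r | P i) a i ^+ 2) * (\sum_(i <- r | P i) b i ^+ 2) +
  (\sum_(i <- r | P i) b i ^+ 2) * (\sum_(i <- r | P i) a i ^+ 2) -
  2 * (\sum_(i <- r | P i) a i * b i) ^+ 2.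
  rewrite expr2 !sE mulr_sumr -big_split -sumrB /=; apply: eq_bigr => i _.
  rewrite mulr_sumr -big_split -sumrB /=; apply: eq_bigr => j _; ring.
lra.
Qed.

End CauchySchwarz.

(** * Hat functions on a lattice and their products *)

Section Hat.
Variables (R : realType) (m B : nat).
Hypothesis m0 : (0 < m)%N.

(** As subtraction truncates, this is the positive part of m - |x + m - z|. The centre is shifted by
    m so that every hat with x <= B fits into the range of z, which makes sums over z independent of
    x. *)
Definition hat (x z : nat) : nat := (m - ((x + m - z) + (z - (x + m))))%N.

Let N := (B + m.*2.+1)%N.

Lemma sum_hat (H : nat -> R) (x : nat) : H 0%N = 0 -> (x <= B)%N ->
  \sum_(z < N) H (hat x z) = \sum_(j < m) H j + \sum_(j < m.+1) H j.
Proof.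
move=> H0 xB; rewrite -(big_mkord xpredT (fun z => H (hat x z))).
rewrite (@big_cat_nat _ _ _ x) //=; last by rewrite /N; lia.
rewrite big_nat_cond big1 ?add0r => [|z]; last first.
  rewrite andbT => /andP[_ zx]; rewrite (_ : hat x z = 0%N) // /hat; lia.
rewrite (@big_cat_nat _ _ _ (x + m)) ?leq_addr //=; last by rewrite /N; lia.
congr (_ + _).
  rewrite -{1}[x]add0n big_addn addKn big_mkord; apply: eq_bigr => j _.
  congr H; rewrite /hat; have := ltn_ord j; lia.
rewrite (@big_cat_nat _ _ _ (x + m + m.+1)) ?leq_addr //=; last by rewrite /N; lia.
rewrite [X in _ + X]big_nat_cond [X in _ + X]big1 ?addr0 => [|z]; last first.
  rewrite andbT => /andP[zx _]; rewrite (_ : hat x z = 0%N) // /hat; lia.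
rewrite -{1}[(x + m)%N]add0n big_addn addKn big_mkord.
rewrite (reindex_inj rev_ord_inj) /=; apply: eq_bigr => j _.
congr H; rewrite /hat; have := ltn_ord j; lia.
Qed.

Definition hat_mass : R := \sum_(j < m) j%:R ^+ 2 + \sum_(j < m.+1) j%:R ^+ 2.

Lemma sum_squares (l : nat) :
  6 * \sum_(j < l) j%:R ^+ 2 = l%:R * (l%:R - 1) * (2 * l%:R - 1) :> R.
Proof.
elim: l => [|l IH]; first by rewrite big_ord0 mulr0 !mul0r.
rewrite big_ord_recr /= mulrDr IH -natr1; ring.
Qed.

Lemma hat_massE : 3 * hat_mass = 2 * m%:R ^+ 3 + m%:R.
Proof.
have := sum_squares m; have := sum_squares m.+1; rewrite /hat_mass -natr1; lra.
Qed.

Lemma hat_mass_gt0 : 0 < hat_mass.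
Proof.
have m0' : 0 < m%:R :> R by rewrite ltr0n.
have := exprn_gt0 3 m0'; have := hat_massE; lra.
Qed.

Lemma sum_hat_sqr (x : nat) : (x <= B)%N -> \sum_(z < N) (hat x z)%:R ^+ 2 = hat_mass.
Proof. by move=> xB; rewrite (@sum_hat (fun j => j%:R ^+ 2)) // expr0n. Qed.

Lemma hat_dist (x y z : nat) : `|(hat x z)%:R - (hat y z)%:R| <= `|x%:R - y%:R| :> R.
Proof.
wlog xy : x y / (x <= y)%N.
  move=> H; case/orP: (leq_total x y) => [|yx]; first exact: H.
  by rewrite distrC [leRHS]distrC; exact: H.
have -> : `|x%:R - y%:R| = (y - x)%N%:R :> R.
  by rewrite distrC -natrB // normr_nat.
have [xz|zx] := leqP (hat y z) (hat x z).
  by rewrite -natrB // normr_nat ler_nat /hat; lia.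
by rewrite distrC -natrB ?(ltnW zx) // normr_nat ler_nat /hat; lia.
Qed.

(** A term is nonzero only where one of the hats is, hence at no more than 4 m places, and each
    difference is at most |x - y|. *)
Lemma sum_hat_dist (x y : nat) : (x <= B)%N -> (y <= B)%N ->
  \sum_(z < N) ((hat x z)%:R - (hat y z)%:R) ^+ 2 <= 4 * m%:R * (x%:R - y%:R) ^+ 2 :> R.
Proof.
move=> xB yB; pose H (j : nat) : R := (0 < j)%N%:R.
have sH (u : nat) : (u <= B)%N -> \sum_(z < N) H (hat u z) <= 2 * m%:R.
  move=> uB; rewrite sum_hat // [X in _ + X]big_ord_recl add0r /= mulrDl mul1r.
  apply: lerD; rewrite -[leRHS]mulr1 -[m in leRHS]card_ord -sumr_const mulr_suml;
    apply: ler_sum => j _; rewrite mul1r /H; by case: ltnP.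
have HD : \sum_(z < N) ((hat x z)%:R - (hat y z)%:R) ^+ 2 <=
    \sum_(z < N) (H (hat x z) + H (hat y z)) * (x%:R - y%:R) ^+ 2.
  apply: ler_sum => z _.
  have [e|ne] := eqVneq (hat x z) (hat y z).
    by rewrite e subrr expr0n mulr_ge0 ?sqr_ge0 // addr_ge0 /H.
  have hd : ((hat x z)%:R - (hat y z)%:R) ^+ 2 <= (x%:R - y%:R) ^+ 2 :> R.
    by rewrite -[leLHS]real_normK ?num_real // -[leRHS]real_normK ?num_real //
      lerXn2r ?nnegrE // hat_dist.
  apply: le_trans hd _; rewrite -[leLHS]mul1r ler_wpM2r ?sqr_ge0 // /H.
  move: ne; case: (hat x z) => [|a]; case: (hat y z) => [|b] //= _; lra.
apply: le_trans HD _; rewrite -mulr_suml ler_wpM2r ?sqr_ge0 // big_split /=.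
have := sH _ xB; have := sH _ yB; lra.
Qed.

End Hat.

(** The union bound for independent events of probability 1 - q i. *)
Lemma one_sub_prod (R : realDomainType) (I : Type) (r : seq I) (q : I -> R) :
  (forall i, 0 <= q i <= 1) -> 1 - \prod_(i <- r) q i <= \sum_(i <- r) (1 - q i).
Proof.
move=> q01; suff [] : 0 <= \prod_(i <- r) q i <= 1 /\
    1 - \prod_(i <- r) q i <= \sum_(i <- r) (1 - q i) by [].
elim: r => [|i r [/andP[h0 h1] h2]]; first by rewrite !big_nil subrr ler01 lexx.
rewrite !big_cons; have /andP[q0 q1] := q01 i.
split; first by rewrite mulr_ge0 //= -[leRHS]mul1r ler_pM.
have := mulr_ge0 (_ : 0 <= 1 - q i) (_ : 0 <= 1 - \prod_(i <- r) q i).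
by rewrite !subr_ge0 => /(_ q1 h1); rewrite mulrBl mul1r mulrBr mulr1; lra.
Qed.

Section ProductHat.
Variables (R : realType) (k m B : nat).
Hypothesis m0 : (0 < m)%N.
Let N := (B + m.*2.+1)%N.
Implicit Types X Y : 'I_k -> nat.

Definition phat X (Z : {ffun 'I_k -> 'I_N}) : nat := (\prod_i hat m (X i) (Z i))%N.

Let A := hat_mass R m.

Lemma sum_phat_mul X Y :
  \sum_Z (phat X Z)%:R * (phat Y Z)%:R =
  \prod_i \sum_(z < N) (hat m (X i) z)%:R * (hat m (Y i) z)%:R :> R.
Proof.
rewrite bigA_distr_bigA /=; apply: eq_bigr => Z _.
by rewrite /phat !natr_prod -big_split.
Qed.

Lemma sum_phat_sqr X : (forall i, (X i <= B)%N) -> \sum_Z (phat X Z)%:R ^+ 2 = A ^+ k.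
Proof.
move=> XB; under eq_bigr do rewrite expr2; rewrite sum_phat_mul.
under eq_bigr => i _ do under eq_bigr do rewrite -expr2.
by under eq_bigr => i _ do rewrite sum_hat_sqr //; rewrite prodr_const card_ord.
Qed.

(* The sums of squares being independent of X, the left side only involves the
   correlations, which factor over the coordinates. *)
Lemma sum_phat_dist X Y : (forall i, (X i <= B)%N) -> (forall i, (Y i <= B)%N) ->
  m%:R ^+ 2 * \sum_Z ((phat X Z)%:R - (phat Y Z)%:R) ^+ 2 <=
  6 * A ^+ k * \sum_i ((X i)%:R - (Y i)%:R) ^+ 2 :> R.
Proof.
move=> XB YB; have A0 : 0 < A by exact: hat_mass_gt0.
have mR0 : 0 < m%:R :> R by rewrite ltr0n.
pose c i : R := \sum_(z < N) (hat m (X i) z)%:R * (hat m (Y i) z)%:R.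
pose D i : R := \sum_(z < N) ((hat m (X i) z)%:R - (hat m (Y i) z)%:R) ^+ 2.
have cE i : c i = A - D i / 2.
  have : D i = A + A - 2 * c i.
    rewrite /A -{1}(sum_hat_sqr R m0 (XB i)) -(sum_hat_sqr R m0 (YB i)) /D /c mulr_sumr.
    rewrite -big_split -sumrB /=; apply: eq_bigr => z _; ring.
  lra.
have D0 i : 0 <= D i by apply: sumr_ge0 => z _; exact: sqr_ge0.
have c0 i : 0 <= c i by apply: sumr_ge0 => z _; exact: mulr_ge0.
have PE : \prod_i (c i / A) = (\prod_i c i) / A ^+ k.
  by rewrite big_split /= prodr_const card_ord exprVn.
have -> : \sum_Z ((phat X Z)%:R - (phat Y Z)%:R) ^+ 2 = 2 * A ^+ k * (1 - \prod_i (c i / A)).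
  rewrite PE mulrBr mulr1 -!mulrA.
  rewrite [A ^+ k * _]mulrCA mulfV ?mulr1; last by rewrite expf_neq0 // gt_eqF.
  rewrite -(sum_phat_mul X Y) mulrDl mul1r -{1}(sum_phat_sqr XB) -(sum_phat_sqr YB).
  rewrite mulr_sumr -big_split -sumrB /=; apply: eq_bigr => Z _; ring.
have Hp : 1 - \prod_i (c i / A) <= \sum_i (1 - c i / A).
  apply: one_sub_prod => i; rewrite divr_ge0 ?(ltW A0) //= ler_pdivrMr // mul1r cE.
  have := D0 i; lra.
have Ak : 0 < A ^+ k by exact: exprn_gt0.
(* From D <= 4 m S and 3 A >= 2 m^3, the quotient D / (2 A) is at most 3 S / m^2. *)
have Hs : m%:R ^+ 2 * \sum_i (1 - c i / A) <= 3 * \sum_i ((X i)%:R - (Y i)%:R) ^+ 2.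
  rewrite !mulr_sumr; apply: ler_sum => i _.
  have -> : 1 - c i / A = D i / 2 / A by rewrite cE mulrBl divff ?gt_eqF //; ring.
  rewrite mulrA ler_pdivrMr //.
  have := sum_hat_dist R m0 (XB i) (YB i); rewrite -/(D i).
  set S := (_ - _) ^+ 2 => hD.
  have S0 : 0 <= S by exact: sqr_ge0.
  have h1 := ler_wpM2l (ltW (exprn_gt0 2 mR0)) hD.
  have : 2 * m%:R ^+ 3 * S <= 3 * A * S.
    by rewrite ler_wpM2r // /A hat_massE lerDl ltW.
  rewrite [m%:R ^+ 3]exprS; lra.
have := ler_wpM2l (ltW Ak) (le_trans (ler_wpM2l (ltW (exprn_gt0 2 mR0)) Hp) Hs).
lra.
Qed.

(** Factor a^2 - b^2 and apply Cauchy-Schwarz. The two sums of squares are at most 6 A^k S / m^2 and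
    4 A^k, and 24 <= 5^2. *)
Lemma sum_phat_sqr_dist X Y : (forall i, (X i <= B)%N) -> (forall i, (Y i <= B)%N) ->
  \sum_Z `|((phat X Z) ^ 2)%N%:R - ((phat Y Z) ^ 2)%N%:R| <=
  5 / m%:R * A ^+ k * Num.sqrt (\sum_i ((X i)%:R - (Y i)%:R) ^+ 2) :> R.
Proof.
move=> XB YB; have A0 : 0 < A by exact: hat_mass_gt0.
have Ak : 0 < A ^+ k by exact: exprn_gt0.
have mR0 : 0 < m%:R :> R by rewrite ltr0n.
pose S : R := \sum_i ((X i)%:R - (Y i)%:R) ^+ 2; rewrite -/S; have S0 : 0 <= S by apply: sumr_ge0 => i _; exact: sqr_ge0.
have rhs0 : 0 <= 5 / m%:R * A ^+ k * Num.sqrt S.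
  by rewrite !mulr_ge0 ?sqrtr_ge0 ?invr_ge0 ?(ltW Ak) ?(ltW mR0).
rewrite -(@ler_pXn2r _ 2) ?nnegrE //; last by apply: sumr_ge0 => Z _; exact: normr_ge0.
have := @cauchy_schwarz R _ (index_enum _) xpredT
   (fun Z : {ffun 'I_k -> 'I_N} => `|(phat X Z)%:R - (phat Y Z)%:R|)
   (fun Z => (phat X Z)%:R + (phat Y Z)%:R).
have -> : \sum_Z `|(phat X Z)%:R - (phat Y Z)%:R| * ((phat X Z)%:R + (phat Y Z)%:R) =
    \sum_Z `|((phat X Z) ^ 2)%N%:R - ((phat Y Z) ^ 2)%N%:R| :> R.
  apply: eq_bigr => Z _; rewrite !natrX subr_sqr normrM; congr (_ * _).
  by rewrite ger0_norm // addr_ge0.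
move=> /le_trans; apply.
under eq_bigr do rewrite real_normK ?num_real //.
have h1 := sum_phat_dist XB YB; rewrite -/S in h1.
have h2 : \sum_Z ((phat X Z)%:R + (phat Y Z)%:R) ^+ 2 <= 4 * A ^+ k :> R.
  have : \sum_Z ((phat X Z)%:R + (phat Y Z)%:R) ^+ 2 <=
     \sum_Z (2 * (phat X Z)%:R ^+ 2 + 2 * (phat Y Z)%:R ^+ 2) :> R.
    apply: ler_sum => Z _; set a := _%:R; set b := _%:R; have := sqr_ge0 (a - b); lra.
  rewrite big_split /= -!mulr_sumr !sum_phat_sqr //; lra.
have h3 : \sum_Z ((phat X Z)%:R - (phat Y Z)%:R) ^+ 2 <= 6 * A ^+ k * S / m%:R ^+ 2.
  by rewrite ler_pdivlMr ?exprn_gt0 // mulrC.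
apply: le_trans (_ : _ <= 6 * A ^+ k * S / m%:R ^+ 2 * (4 * A ^+ k)) _.
  by apply: ler_pM => //; apply: sumr_ge0 => Z _; exact: sqr_ge0.
rewrite [leRHS]exprMn sqr_sqrtr //.
have q0 : 0 <= (A ^+ k / m%:R) ^+ 2 * S by rewrite mulr_ge0 ?sqr_ge0.
have -> : 6 * A ^+ k * S / m%:R ^+ 2 * (4 * A ^+ k) = 24 * ((A ^+ k / m%:R) ^+ 2 * S).
  by field; rewrite gt_eqF.
have -> : (5 / m%:R * A ^+ k) ^+ 2 * S = 25 * ((A ^+ k / m%:R) ^+ 2 * S).
  by field; rewrite gt_eqF.
lra.
Qed.

Lemma phat_close X Y Z i : (0 < phat X Z)%N -> (0 < phat Y Z)%N ->
  `|(X i)%:R - (Y i)%:R| < (m.*2)%:R :> R.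
Proof.
have pos W : (0 < phat W Z)%N -> (0 < hat m (W i) (Z i))%N.
  by rewrite /phat (bigD1 i) //= muln_gt0 => /andP[].
move=> /pos + /pos; rewrite /hat => hX hY.
have [XY|YX] := leqP (X i) (Y i).
  by rewrite distrC -natrB // normr_nat ltr_nat; lia.
by rewrite -natrB ?(ltnW YX) // normr_nat ltr_nat; lia.
Qed.

End ProductHat.

(** * Orthonormal functions of small energy *)

Section Frame.
Variables (R : realType) (n : nat) (E : rel 'I_n).
Notation Rn := 'rV[R]_n.
Implicit Types (x y : Rn).
Hypotheses (Esym : symmetric E) (Eirr : irreflexive E).
Hypothesis deg_gt0 : forall i, (1 <= deg E i)%N.

Definition ddot x y : R := \sum_i (deg E i)%:R * (x ord0 i * y ord0 i).
Definition denergy x : R := esum E (fun i j => (x ord0 i - x ord0 j) ^+ 2).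

Lemma ddotC x y : ddot x y = ddot y x.
Proof. by apply: eq_bigr => i _; rewrite [x _ _ * _]mulrC. Qed.

Lemma ddotZ c x y : ddot (c *: x) y = c * ddot x y.
Proof. by rewrite /ddot mulr_sumr; apply: eq_bigr => i _; rewrite mxE; ring. Qed.

Lemma denergyZ c x : denergy (c *: x) = c ^+ 2 * denergy x.
Proof.
rewrite /denergy -esumZ !esum_pair; apply: eq_bigr => u _.
by rewrite !mxE -mulrBr exprMn.
Qed.

Lemma energy2 x : energy E 2 x = denergy x.
Proof.
rewrite /energy /denergy !esum_pair; apply: eq_bigr => u _.
by rewrite (powR_mulrn 2) ?normr_ge0 // real_normK ?num_real.
Qed.

Lemma mass2 x : mass E 2 x = ddot x x.
Proof.
apply: eq_bigr => i _.
by rewrite (powR_mulrn 2) ?normr_ge0 // real_normK ?num_real // expr2.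
Qed.

Lemma ddot_gt0 x : x != 0 -> 0 < ddot x x.
Proof. by move=> x0; rewrite -mass2 mass_gt0 // pnatr_eq0. Qed.

Lemma ddot_continuous y : continuous (ddot^~ y).
Proof.
apply: continuous_rsum => i _ x; apply: (@cvgM _ _ (nbhs x)); first exact: cvg_cst.
by apply: (@cvgM _ _ (nbhs x)); [exact: coord_continuous|exact: cvg_cst].
Qed.

Lemma ddot_diag_continuous : continuous (fun x => ddot x x).
Proof.
apply: continuous_rsum => i _ x; apply: (@cvgM _ _ (nbhs x)); first exact: cvg_cst.
by apply: (@cvgM _ _ (nbhs x)); exact: coord_continuous.
Qed.

Lemma denergy_continuous : continuous denergy.
Proof.
apply: continuous_rsum => i _; apply: continuous_rsum => j _ x.
by apply: (@cvgM _ _ (nbhs x)); apply: (@cvgB _ _ _ (nbhs x)); exact: coord_continuous.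
Qed.

Lemma orthogonal_vector (m : nat) (f : nat -> Rn) : (m < n)%N ->
  exists2 y, y != 0 & forall b, (b < m)%N -> ddot y (f b) = 0.
Proof.
move=> mn; pose M : 'M[R]_(n, m) := \matrix_(i, b) ((deg E i)%:R * f b ord0 i).
have : kermx M != 0.
  by rewrite kermx_eq0 /row_free neq_ltn (leq_ltn_trans (rank_leq_col M) mn).
move=> /rowV0Pn[y /sub_kermxP yM y0]; exists y => // b bm.
have /rowP/(_ (Ordinal bm)) := yM; rewrite !mxE => e; rewrite -[RHS]e.
by apply: eq_bigr => i _; rewrite !mxE /=; ring.
Qed.

(* An eigenbasis is avoided: f a minimises the energy on the unit sphere of the
   orthogonal complement of the previous vectors. *)
Lemma greedy_frame (m : nat) : (m <= n)%N -> exists f : nat -> Rn,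
  (forall a b, (a < m)%N -> (b < m)%N -> ddot (f a) (f b) = (a == b)%:R) /\
  (forall a y, (a < m)%N -> (forall b, (b < a)%N -> ddot y (f b) = 0) ->
     denergy (f a) * ddot y y <= denergy y).
Proof.
elim: m => [|m IH] mn; first by exists (fun=> 0).
have [f [fo fm]] := IH (ltnW mn).
pose K := [set y | ddot y y = 1] `&` [set y | forall b : 'I_m, ddot y (f b) = 0].
have normK y : y != 0 -> (forall b, (b < m)%N -> ddot y (f b) = 0) ->
    K ((Num.sqrt (ddot y y))^-1 *: y).
  move=> y0 yf; have d0 := ddot_gt0 y0; split => /= [|b]; last by rewrite ddotZ yf ?mulr0.
  rewrite ddotZ ddotC ddotZ mulrA -invfM -expr2 sqr_sqrtr ?(ltW d0) //.
  by rewrite mulVf // gt_eqF.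
have cK : compact K.
  apply: (@compact_rV R _ _ 1).
    apply: closedI; first exact: closed_level ddot_diag_continuous.
    by apply: closed_forall => b; apply: closed_level; exact: ddot_continuous.
  move=> x i [x1 _]; rewrite -(@ler_pXn2r _ 2) ?nnegrE // expr1n real_normK ?num_real //.
  rewrite -[leRHS]x1 /ddot (bigD1 i) //= -expr2; apply: (@le_trans _ _ ((deg E i)%:R * x ord0 i ^+ 2)).
    by rewrite -[leLHS]mul1r ler_wpM2r ?sqr_ge0 // ler1n.
  by rewrite lerDl sumr_ge0 // => j _; rewrite mulr_ge0 // -expr2 sqr_ge0.
have Kne : K !=set0.
  have [y y0 yf] := orthogonal_vector f mn.
  by eexists; exact: normK y0 yf.
have [e /set_mem[e1 ef] emin] := @compact_EVT_min _ R denergy K Kne cK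
  (continuous_subspaceT denergy_continuous).
exists (fun a => if a == m then e else f a); split=> [a b|a y].
  rewrite !ltnS (leq_eqVlt a) (leq_eqVlt b).
  have [->|am] := eqVneq a m; have [->|bm] := eqVneq b m => //= ha hb.
  - exact: (ef (Ordinal hb)).
  - by rewrite (negbTE am) ddotC; exact: (ef (Ordinal ha)).
  - exact: fo.
rewrite ltnS (leq_eqVlt a); have [->|am] := eqVneq a m => /= ha yf; last first.
  apply: fm => // b ba; have := yf b ba; rewrite ifN // neq_ltn.
  by rewrite (ltn_trans ba ha).
have [->|y0] := eqVneq y 0.
  by rewrite -(scale0r (0 : Rn)) ddotZ denergyZ expr0n !mul0r mulr0.
have d0 := ddot_gt0 y0.
have Ky : K ((Num.sqrt (ddot y y))^-1 *: y).
  by apply: normK => // b bm; have := yf b bm; rewrite ifN // neq_ltn bm.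
have := emin _ (mem_set Ky).
by rewrite denergyZ exprVn sqr_sqrtr ?(ltW d0) // mulrC ler_pdivlMr.
Qed.

(** Otherwise the k - 1 products with the f b would map S oddly into R^(k-1) minus the origin, and
    normalising would give genus at most k - 1. *)
Lemma genus_orthogonal (k : nat) (f : nat -> Rn) (S : set Rn) : (1 <= k)%N -> good S ->
  (k <= genus_minus S)%N -> exists2 x, S x & forall b, (b < k.-1)%N -> ddot x (f b) = 0.
Proof.
move=> k1 gS kS; apply: contrapT => H.
case: (gS) => -[x0 Sx0] Ss S0.
(* For k = 1 no condition is imposed, and the genus argument would need a sphere of dimension -1. *)
have [k0|k0] := posnP k.-1; first by apply: H; exists x0 => // b; rewrite k0.
pose L x : 'rV[R]_k.-1 := \row_b ddot x (f b).
have LN x : L (- x) = - L x.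
  by apply/rowP => b; rewrite !mxE -scaleN1r ddotZ mulN1r.
have L0 : ~ (L @` S) 0.
  move=> [x Sx Lx]; apply: H; exists x => // b bk.
  by have /rowP/(_ (Ordinal bk)) := Lx; rewrite !mxE.
have oL : odd_map S (L @` S) L.
  split=> [|x Sx|x _]; [|by exists x|exact: LN].
  apply: continuous_subspaceT; apply: rV_continuous => b.
  have -> : (fun x => L x ord0 b) = ddot^~ (f b) by apply/funext => x; rewrite mxE.
  exact: ddot_continuous.
have := genus_minus_le gS k0 (odd_map_comp oL (odd_normalize L0)).
by rewrite leqNgt (leq_trans _ kS) // prednK.
Qed.

(** A point of S orthogonal to the first k - 1 vectors competes in each of the k minimisations
    defining the frame. *)
Lemma spectral_frame (k : nat) : (1 <= k <= n)%N -> exists f : 'I_k -> Rn,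
  (forall a b, ddot (f a) (f b) = (a == b)%:R) /\
  (forall a, denergy (f a) <= minmax E genus_minus 2 k).
Proof.
move=> /andP[k1 kn]; have [f [fo fm]] := greedy_frame kn.
exists (fun a => f a); split=> [a b|a]; first exact: fo.
apply: (minmax_ge (ind := @genus_minus R n)) => //.
  by move=> S gS; exact: leq_trans (plus_le_yang gS) (yang_le_minus gS).
move=> S aS; have gS : good S.
  by apply: adm_good aS => // T; exact: index_or0_gt0.
have [_ _ _ kS] := aS.
have [x Sx xf] := genus_orthogonal f k1 gS kS.
have x0 : x != 0 by apply/eqP => x0; case: gS => _ _; apply; rewrite -x0.
apply: le_trans (Rayleigh_le_supR Esym Eirr _ Sx); last by rewrite ler1n.
rewrite RayleighE energy2 mass2 ler_pdivlMr ?ddot_gt0 //; apply: fm => // b ba.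
apply: xf; apply: leq_trans ba _; rewrite -ltnS prednK //.
Qed.

End Frame.

Section Vectors.
Variables (R : realType) (k : nat).
Implicit Types x y : 'rV[R]_k.

Definition dist2 x y : R := \sum_a (x ord0 a - y ord0 a) ^+ 2.

Lemma dist2_ge0 x y : 0 <= dist2 x y.
Proof. by apply: sumr_ge0 => a _; exact: sqr_ge0. Qed.

Lemma nrm2_ge0 x : 0 <= nrm2 x. Proof. exact: sqrtr_ge0. Qed.

Lemma sqr_nrm2 x : nrm2 x ^+ 2 = \sum_a x ord0 a ^+ 2.
Proof. by rewrite sqr_sqrtr // sumr_ge0 // => a _; exact: sqr_ge0. Qed.

Lemma dist2E x y : dist2 x y =
  nrm2 x ^+ 2 + nrm2 y ^+ 2 - 2 * \sum_a x ord0 a * y ord0 a.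
Proof.
rewrite !sqr_nrm2 mulr_sumr -big_split -sumrB /=; apply: eq_bigr => a _; ring.
Qed.

Lemma nrm2_dist x y : (nrm2 x - nrm2 y) ^+ 2 <= dist2 x y.
Proof.
have H : \sum_a x ord0 a * y ord0 a <= nrm2 x * nrm2 y.
  apply: le_trans (ler_norm _) _.
  rewrite -(@ler_pXn2r _ 2) ?nnegrE ?mulr_ge0 ?nrm2_ge0 ?normr_ge0 //.
  rewrite real_normK ?num_real // exprMn !sqr_nrm2; exact: cauchy_schwarz.
rewrite dist2E sqrrB; lra.
Qed.

Lemma normalize_nrm2 x : nrm2 x != 0 -> nrm2 (normalize x) = 1.
Proof.
move=> x0; apply: (@pexpIrn _ 2); rewrite // ?nnegrE ?nrm2_ge0 //.
rewrite sqr_nrm2; under eq_bigr do rewrite mxE exprMn.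
by rewrite -mulr_sumr -sqr_nrm2 -exprMn mulVf ?expr1n.
Qed.

Lemma normalize_le1 x a : `|normalize x ord0 a| <= 1.
Proof.
have [x0|x0] := eqVneq (nrm2 x) 0; first by rewrite /normalize mxE x0 invr0 mul0r normr0.
rewrite -(@ler_pXn2r _ 2) ?nnegrE // real_normK ?num_real //.
rewrite -(normalize_nrm2 x0) sqr_nrm2 (bigD1 a) //= lerDl sumr_ge0 // => b _.
exact: sqr_ge0.
Qed.

Lemma normalizeK x a : nrm2 x != 0 -> x ord0 a = nrm2 x * normalize x ord0 a.
Proof. by move=> x0; rewrite mxE mulrA mulfV ?mul1r. Qed.

(** The two sides differ exactly by the square of the difference of the norms. *)
Lemma normalize_dist x y :
  nrm2 x * nrm2 y * dist2 (normalize x) (normalize y) <= dist2 x y.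
Proof.
have [x0|x0] := eqVneq (nrm2 x) 0; first by rewrite x0 !mul0r dist2_ge0.
have [y0|y0] := eqVneq (nrm2 y) 0; first by rewrite y0 mulr0 mul0r dist2_ge0.
rewrite [leRHS]dist2E.
have -> : \sum_a x ord0 a * y ord0 a =
    nrm2 x * nrm2 y * \sum_a normalize x ord0 a * normalize y ord0 a.
  rewrite mulr_sumr; apply: eq_bigr => a _.
  rewrite (normalizeK a x0) (normalizeK a y0); ring.
rewrite dist2E !normalize_nrm2 // expr1n.
set s := nrm2 x; set t := nrm2 y; set c := \sum_a _; have := sqr_ge0 (s - t); lra.
Qed.

End Vectors.

(** * Rounding directions to a lattice *)

Section Embedding.
Variables (R : realType) (V : finType) (k : nat) (H : V -> 'rV[R]_k).
Hypothesis k0 : (0 < k)%N.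
Hypothesis H1 : forall v a, `|H v ord0 a| <= 1.
Let kR0 : 0 < k%:R :> R. Proof. by rewrite ltr0n. Qed.

(* X v rounds the vector (H v + 1) * 6km to the lattice; m is taken so large that
   rounding does not matter for the finitely many pairs of vectors. *)
Lemma lattice_embedding : exists m B (X : V -> 'I_k -> nat),
  [/\ (0 < m)%N, forall v a, (X v a <= B)%N,
      forall u v, Num.sqrt (\sum_a ((X u a)%:R - (X v a)%:R) ^+ 2) <=
         12 * k%:R * m%:R * Num.sqrt (dist2 (H u) (H v)) &
      forall u v, (forall a, `|(X u a)%:R - (X v a)%:R| < (m.*2)%:R :> R) ->
         dist2 (H u) (H v) <= (4 * k%:R)^-1].
Proof.
pose s : R := \sum_(u : V) \sum_(v : V) k%:R / dist2 (H u) (H v).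
(* Directions at positive distance now satisfy k <= m * dist2, so rounding errors of at most 1 per
   coordinate are dominated by the distance. *)
pose m := (Num.truncn s).+1.
have t0 u v : 0 <= k%:R / dist2 (H u) (H v) by rewrite divr_ge0 ?dist2_ge0.
have s0 : 0 <= s by apply: sumr_ge0 => u _; apply: sumr_ge0 => v _; exact: t0.
have sm : s < m%:R by have /andP[] := truncn_itv s0.
have m0 : 0 < m%:R :> R by rewrite ltr0n.
have m1 : 1 <= m%:R :> R by rewrite ler1n.
have k1 : 1 <= k%:R :> R by rewrite ler1n.
have hk u v : dist2 (H u) (H v) != 0 -> k%:R <= m%:R * dist2 (H u) (H v).
  move=> d0; rewrite -ler_pdivrMr ?lt_def ?d0 ?dist2_ge0 //; apply: le_trans (ltW sm).
  rewrite /s (bigD1 u) //= (bigD1 v) //= -addrA lerDl addr_ge0 //.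
    by apply: sumr_ge0 => w _; exact: t0.
  by apply: sumr_ge0 => w _; apply: sumr_ge0 => w' _; exact: t0.
(* At this scale, lattice points within 2 m in each coordinate come from directions within 3 m / M =
   1 / (2 k) in each, hence within 1 / (4 k) in squared distance. *)
pose M : R := 6 * k%:R * m%:R.
have mM : m%:R <= M by rewrite /M -[leLHS]mul1r ler_wpM2r ?(ltW m0) //; lra.
have M0 : 0 < M by exact: lt_le_trans mM.
pose Y u a := (H u ord0 a + 1) * M.
have Y0 u a : 0 <= Y u a.
  by rewrite mulr_ge0 ?(ltW M0) //; have := H1 u a; rewrite ler_norml; lra.
pose X u a := Num.truncn (Y u a).
have XY u a : (X u a)%:R <= Y u a < (X u a)%:R + 1.
  by rewrite natr1; exact: truncn_itv.
have XYd u v a : `|((X u a)%:R - (X v a)%:R) - (H u ord0 a - H v ord0 a) * M| <= 1.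
  have -> : (H u ord0 a - H v ord0 a) * M = Y u a - Y v a by rewrite /Y; ring.
  have /andP[h1 h2] := XY u a; have /andP[h3 h4] := XY v a.
  by rewrite ler_norml; lra.
exists m, (12 * k * m)%N, X; split=> //.
- move=> v a; rewrite -(ler_nat R); have /andP[h1 _] := XY v a; apply: le_trans h1 _.
  rewrite !natrM /Y /M; have := H1 v a; rewrite ler_norml => /andP[_ h].
  have -> : 12 * k%:R * m%:R = 2 * (6 * k%:R * m%:R) :> R by ring.
  by rewrite ler_wpM2r ?(ltW M0) //; lra.
- move=> u v; set S := \sum_a _.
  have S0 : 0 <= S by apply: sumr_ge0 => a _; exact: sqr_ge0.
  have d0 := dist2_ge0 (H u) (H v).
  rewrite -(@ler_pXn2r _ 2) ?nnegrE ?sqrtr_ge0 //.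
  rewrite exprMn !sqr_sqrtr //.
  have -> : 12 * k%:R * m%:R = 2 * M :> R by rewrite /M; ring.
  have [e|ne] := eqVneq (dist2 (H u) (H v)) 0.
    rewrite e mulr0 /S big1 // => a _.
    move/eqP: e; rewrite /dist2 psumr_eq0 => [/allP/(_ a (mem_index_enum a))|b _]; last exact: sqr_ge0.
    by rewrite /= sqrf_eq0 subr_eq0 => /eqP e; rewrite /X /Y e subrr expr0n.
  have HS : S <= 2 * M ^+ 2 * dist2 (H u) (H v) + 2 * k%:R.
    have -> : 2 * k%:R = \sum_(a < k) (2 : R) by rewrite sumr_const card_ord mulr_natr.
    rewrite /S /dist2 mulr_sumr -big_split /=; apply: ler_sum => a _.
    have := XYd u v a; set p := (X u a)%:R - (X v a)%:R; set q := _ ord0 a - _ => h.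
    have h2 : (p - q * M) ^+ 2 <= 1.
      by rewrite -[leLHS]real_normK ?num_real // expr_le1.
    have := sqr_ge0 (p - 2 * (q * M)); move: h2; rewrite !expr2; lra.
  have h := hk u v ne.
  have h' : m%:R * dist2 (H u) (H v) <= M ^+ 2 * dist2 (H u) (H v).
    rewrite ler_wpM2r // expr2 -[leLHS]mul1r ler_pM //; exact: le_trans mM.
  rewrite exprMn; lra.
move=> u v Huv.
have -> : (4 * k%:R)^-1 = \sum_(a < k) (2 * k%:R)^-1 ^+ 2 :> R.
  by rewrite sumr_const card_ord -[RHS]mulr_natr; field; rewrite gt_eqF.
apply: ler_sum => a _; rewrite -real_normK ?num_real // lerXn2r ?nnegrE ?invr_ge0 //.
rewrite -[leRHS]mul1r ler_pdivlMr ?mulr_gt0 //.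
have h1 : `|H u ord0 a - H v ord0 a| * M <= 3 * m%:R.
  rewrite -[M in leLHS](gtr0_norm M0) -normrM.
  have := XYd u v a; have := Huv a; rewrite -mul2n natrM.
  set p := (X u a)%:R - (X v a)%:R; set q := _ * M => h2 h3.
  have := ler_normB p (p - q); rewrite opprB addrCA subrr addr0; lra.
have : `|H u ord0 a - H v ord0 a| * (2 * k%:R) * (3 * m%:R) <= 1 * (3 * m%:R).
  by move: h1; rewrite /M; lra.
by rewrite ler_pM2r // mulr_gt0.
Qed.

End Embedding.

(** * Partition of the spectral embedding *)

Section HigherCheeger.
Variables (R : realType) (n : nat) (E : rel 'I_n).
Notation Rn := 'rV[R]_n.
Hypotheses (Esym : symmetric E) (Eirr : irreflexive E).
Hypothesis deg_gt0 : forall i, (1 <= deg E i)%N.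
Variables (k : nat) (f : 'I_k -> Rn) (lam : R).
Hypothesis k0 : (0 < k)%N.
Hypothesis fo : forall a b, ddot E (f a) (f b) = (a == b)%:R.
Hypothesis fl : forall a, denergy E (f a) <= lam.
Let kR1 : 1 <= k%:R :> R. Proof. by rewrite ler1n. Qed.

Definition spec (v : 'I_n) : 'rV[R]_k := \row_a f a ord0 v.
Notation F := spec.
Notation N v := (nrm2 (spec v)).
Notation H v := (normalize (spec v)).

(** Expanding the square produces the Gram matrix of the f a, which is the identity. *)
Lemma spec_isotropy (xi : 'rV[R]_k) :
  \sum_v (deg E v)%:R * (\sum_a xi ord0 a * F v ord0 a) ^+ 2 = \sum_a xi ord0 a ^+ 2.
Proof.
transitivity (\sum_v \sum_a \sum_b xi ord0 a * xi ord0 b *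
    ((deg E v)%:R * (f a ord0 v * f b ord0 v))).
  apply: eq_bigr => v _; rewrite expr2 mulr_suml mulr_sumr; apply: eq_bigr => a _.
  rewrite !mulr_sumr; apply: eq_bigr => b _; rewrite !mxE; ring.
rewrite exchange_big; apply: eq_bigr => a _; rewrite exchange_big /=.
rewrite (eq_bigr (fun b => xi ord0 a * xi ord0 b * (a == b)%:R)) => [|b _].
  rewrite (bigD1 a) //= eqxx mulr1 big1 ?addr0 // => b ba.
  by rewrite eq_sym (negbTE ba) mulr0.
by rewrite -fo /ddot mulr_sumr.
Qed.

Lemma spec_mass : \sum_v (deg E v)%:R * N v ^+ 2 = k%:R.
Proof.
transitivity (\sum_(a < k) \sum_v (deg E v)%:R * (f a ord0 v * f a ord0 v)).
  rewrite exchange_big /=; apply: eq_bigr => v _; rewrite sqr_nrm2 mulr_sumr.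
  by apply: eq_bigr => a _; rewrite mxE expr2.
by under eq_bigr => a _ do [rewrite -/(ddot E (f a) (f a)) fo eqxx]; rewrite sumr_const card_ord.
Qed.

Lemma spec_energy : esum E (fun u v => dist2 (F u) (F v)) <= k%:R * lam.
Proof.
have -> : esum E (fun u v => dist2 (F u) (F v)) = \sum_a denergy E (f a).
  rewrite esum_pair /dist2 exchange_big /=; apply: eq_bigr => a _.
  rewrite /denergy esum_pair; apply: eq_bigr => u _; by rewrite !mxE.
rewrite mulr_natl -[k in leRHS]card_ord -sumr_const; exact: ler_sum.
Qed.

(** A common bound for the variation of N^2 over the edges and for the variation of the direction
    weighted by N u N v. *)
Definition slope : R := esum E (fun u v => Num.sqrt (dist2 (F u) (F v)) * (N u + N v)).

Lemma slope_ge0 : 0 <= slope.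
Proof. by apply: esum_ge0 => u v; rewrite mulr_ge0 ?sqrtr_ge0 ?addr_ge0 ?nrm2_ge0. Qed.

(** Cauchy-Schwarz between the total energy, at most k lam, and the edge sum of (N u + N v)^2, at
    most twice the mass k. *)
Lemma slope_sqr : slope ^+ 2 <= 2 * k%:R ^+ 2 * lam.
Proof.
rewrite /slope esum_pair; apply: le_trans (cauchy_schwarz _ _ _ _) _.
have h1 : \sum_(u : 'I_n * 'I_n | (u.1 < u.2)%N && E u.1 u.2)
    Num.sqrt (dist2 (F u.1) (F u.2)) ^+ 2 <= k%:R * lam.
  apply: le_trans spec_energy; rewrite esum_pair; apply: ler_sum => u _.
  by rewrite sqr_sqrtr ?dist2_ge0.
have h2 : \sum_(u : 'I_n * 'I_n | (u.1 < u.2)%N && E u.1 u.2) (N u.1 + N u.2) ^+ 2 <=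
    2 * k%:R.
  rewrite -spec_mass mulr_sumr; under [leRHS]eq_bigr do rewrite mulrCA.
  rewrite -(esum_add Esym Eirr (fun v => 2 * N v ^+ 2)) esum_pair.
  apply: ler_sum => u _; have := sqr_ge0 (N u.1 - N u.2); rewrite !expr2; lra.
apply: le_trans (_ : _ <= k%:R * lam * (2 * k%:R)) _; last by rewrite expr2; lra.
by apply: ler_pM => //; apply: sumr_ge0 => u _; exact: sqr_ge0.
Qed.

Lemma angle_slope : esum E (fun u v => N u * N v * Num.sqrt (dist2 (H u) (H v))) <= slope.
Proof.
apply: ler_esum => u v _.
have Nu := nrm2_ge0 (F u); have Nv := nrm2_ge0 (F v).
rewrite -(@ler_pXn2r _ 2) ?nnegrE ?mulr_ge0 ?sqrtr_ge0 ?addr_ge0 //.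
rewrite [leLHS]exprMn [leRHS]exprMn !(sqr_sqrtr (dist2_ge0 _ _)) expr2 -mulrA mulrC.
apply: ler_pM; rewrite ?mulr_ge0 ?dist2_ge0 //; first exact: normalize_dist.
rewrite sqrrD; have := sqr_ge0 (N u); have := sqr_ge0 (N v); have := mulr_ge0 Nu Nv; lra.
Qed.

Lemma spec_partition : exists P : 'I_n -> 'I_n.+1,
  (forall u v, P u = P v -> dist2 (H u) (H v) <= (4 * k%:R)^-1) /\
  esum E (fun u v => (P u != P v)%:R * (N u * N v)) <= 60 * k%:R * slope.
Proof.
have [m [B [X [m0 XB Xd Xc]]]] := lattice_embedding k0 (fun v a => normalize_le1 (F v) a).
have mR0 : 0 < m%:R :> R by rewrite ltr0n.
pose w u v : R := (E u v)%:R * (N u * N v).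
pose d u v : R := Num.sqrt (\sum_a ((X u a)%:R - (X v a)%:R) ^+ 2).
pose g (Z : {ffun 'I_k -> 'I_(B + m.*2.+1)}) v := (phat (X v) Z ^ 2)%N.
have w0 u v : 0 <= w u v by rewrite !mulr_ge0 ?nrm2_ge0.
have wC u v : w u v = w v u by rewrite /w Esym [N u * _]mulrC.
have d0 u v : 0 <= d u v by exact: sqrtr_ge0.
have dC u v : d u v = d v u.
  by congr Num.sqrt; apply: eq_bigr => a _; rewrite -sqrrN opprB.
have ga v : \sum_Z (g Z v)%:R = hat_mass R m ^+ k.
  by rewrite -(sum_phat_sqr R m0 (XB v)); apply: eq_bigr => Z _; rewrite natrX.
have A0 : 0 < hat_mass R m ^+ k by rewrite exprn_gt0 // hat_mass_gt0.
(* Thus 2 L is the variation bound 5 / m; times the dilation 12 k m of the lattice map it gives 60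
   k, free of m. *)
pose L : R := 5 / (2 * m%:R).
have L2 : 2 * L = 5 / m%:R by rewrite /L; field; rewrite gt_eqF.
have L0 : 0 <= L by rewrite divr_ge0 // mulr_ge0 // ltW.
have gd u v : \sum_Z `|(g Z u)%:R - (g Z v)%:R| <= 2 * L * hat_mass R m ^+ k * d u v.
  by rewrite L2; exact: sum_phat_sqr_dist.
have [P [P1 P2 P3]] := partition_exists A0 L0 w0 wC d0 ga gd [set: 'I_n]%SET.
have Pn v : (P v < n.+1)%N.
  by rewrite ltnS; apply: leq_trans (P1 v _) _; rewrite ?inE // cardsT card_ord.
exists (fun v => Ordinal (Pn v)); split=> [u v /(congr1 val) /= uv|].
  apply: Xc => a; have [||Z [h1 h2]] := P2 u v _ _ uv; rewrite ?inE //.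
  move: h1 h2; rewrite /g !expn_gt0 !orbF; exact: phat_close.
have bT (c : 'I_n -> R) : \sum_(u in [set: 'I_n]%SET) c u = \sum_u c u.
  by apply: eq_bigl => u; rewrite inE.
have sE (c : 'I_n -> 'I_n -> R) : (forall u v, c u v = c v u) ->
    \sum_(u in [set: 'I_n]%SET) \sum_(v in [set: 'I_n]%SET) w u v * c u v =
    2 * esum E (fun u v => c u v * (N u * N v)).
  move=> cC; rewrite -esum_double //; last by move=> u v; rewrite cC [N u * _]mulrC.
  rewrite bT; apply: eq_bigr => u _; rewrite bT [RHS]big_mkcond /=.
  apply: eq_bigr => v _; rewrite /w; case: (E u v); rewrite ?mul0r // mul1r mulrC //.
have eC u v : (P u != P v)%:R = (P v != P u)%:R :> R by rewrite eq_sym.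
move: P3; rewrite /sepw /pot (sE _ eC) (sE _ dC) => P3.
have hd : esum E (fun u v => d u v * (N u * N v)) <= 12 * k%:R * m%:R * slope.
  apply: le_trans (ler_wpM2l _ angle_slope); last by rewrite !mulr_ge0 ?(ltW mR0).
  rewrite -esumZ; apply: ler_esum => u v _.
  by rewrite mulrC mulrCA; apply: ler_wpM2l (Xd u v); rewrite mulr_ge0 ?nrm2_ge0.
rewrite -(@ler_pM2l _ 2) //; apply: le_trans P3 _; rewrite L2 mulrCA ler_pM2l //.
apply: le_trans (ler_wpM2l _ hd) _; first by rewrite divr_ge0 // ltW.
rewrite le_eqVlt; apply/orP; left; apply/eqP; field; by rewrite gt_eqF.
Qed.

(* Isotropy in the direction xi = H v0 of some vertex v0 of the part, from which
   all directions H v of the part deviate little. *)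
Lemma spec_part_mass (P : 'I_n -> 'I_n.+1) (t : 'I_n.+1) :
  (forall u v, P u = P v -> dist2 (H u) (H v) <= (4 * k%:R)^-1) ->
  \sum_(v | P v == t) (deg E v)%:R * N v ^+ 2 <= 4 * k%:R / (4 * k%:R - 1).
Proof.
move=> Pd; have k1 : 1 <= k%:R :> R by exact: kR1.
have kp : 0 < k%:R :> R by lra.
have k4 : 0 < 4 * k%:R - 1 :> R by lra.
have dN v : 0 <= (deg E v)%:R * N v ^+ 2 by rewrite mulr_ge0 ?sqr_ge0.
have [/existsP[v0 /andP[/eqP Pv0 Nv0]]|/existsPn Hn] :=
    boolP [exists v0, (P v0 == t) && (N v0 != 0)]; last first.
  rewrite big1 ?divr_ge0 ?(ltW k4) // => v Pv.
  by have := Hn v; rewrite Pv /= negbK => /eqP ->; rewrite expr0n mulr0.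
have iso : \sum_v (deg E v)%:R * (\sum_a H v0 ord0 a * F v ord0 a) ^+ 2 = 1.
  by rewrite spec_isotropy -sqr_nrm2 normalize_nrm2 // expr1n.
rewrite ler_pdivlMr // -[leRHS]mulr1 -[X in _ <= _ * X]iso mulr_sumr mulr_suml.
rewrite [leRHS](bigID (fun v => P v == t)) /= ler_wpDr //.
  by apply: sumr_ge0 => v _; rewrite mulr_ge0 // mulr_ge0 ?sqr_ge0.
apply: ler_sum => v /eqP Pv.
have [e|Nv] := eqVneq (N v) 0.
  by rewrite e expr0n mulr0 mul0r mulr_ge0 // mulr_ge0 ?sqr_ge0.
have -> : \sum_a H v0 ord0 a * F v ord0 a = N v * \sum_a H v0 ord0 a * H v ord0 a.
  by rewrite mulr_sumr; apply: eq_bigr => a _; rewrite {1}(normalizeK a Nv); ring.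
have := Pd v0 v (etrans Pv0 (esym Pv)); rewrite dist2E !normalize_nrm2 //.
set c := \sum_a _; rewrite expr1n => hc.
have k8 : (8 * k%:R)^-1 <= 8^-1 :> R.
  by rewrite lef_pV2 ?posrE ?mulr_gt0 //; lra.
have kE : (4 * k%:R)^-1 = 2 * (8 * k%:R)^-1 :> R by field; rewrite gt_eqF.
have c1 : 1 - (8 * k%:R)^-1 <= c by move: hc; rewrite kE; lra.
have cc : 4 * k%:R - 1 <= 4 * k%:R * c ^+ 2.
  have h : (1 - (8 * k%:R)^-1) ^+ 2 <= c ^+ 2.
    by rewrite lerXn2r ?nnegrE //; lra.
  have h2 : 1 - (4 * k%:R)^-1 <= c ^+ 2.
    by move: h; rewrite sqrrB expr1n mul1r kE; have := sqr_ge0 ((8 * k%:R)^-1 : R); lra.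
  have := ler_wpM2l (_ : 0 <= 4 * k%:R) h2.
  by rewrite mulrBr mulr1 mulfV ?gt_eqF //; [apply; lra|lra].
rewrite exprMn.
have -> : 4 * k%:R * ((deg E v)%:R * (N v ^+ 2 * c ^+ 2)) =
    (deg E v)%:R * N v ^+ 2 * (4 * k%:R * c ^+ 2) by ring.
exact: ler_wpM2l.
Qed.

(** The test function is N^2 cut off outside the parts in G. Variation of N^2 costs slope and the
    separated edges cost 60 k slope, together at most 61 k slope; division by the mass 1/2 gives
    122. *)
Lemma spec_cut (P : 'I_n -> 'I_n.+1) (G : {set 'I_n.+1}) :
  esum E (fun u v => (P u != P v)%:R * (N u * N v)) <= 60 * k%:R * slope ->
  2^-1 <= \sum_(v | P v \in G) (deg E v)%:R * N v ^+ 2 ->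
  exists A : {set 'I_n}, [/\ A != finset.set0, forall v, v \in A -> P v \in G &
    cratio R E A <= 122 * k%:R * slope].
Proof.
move=> Psep Gm; pose z : Rn := \row_v (if P v \in G then N v ^+ 2 else 0).
have z0 v : 0 <= z ord0 v by rewrite mxE; case: ifP; rewrite ?sqr_ge0.
have mz : mass E 1 z = \sum_(v | P v \in G) (deg E v)%:R * N v ^+ 2.
  rewrite mass1 [RHS]big_mkcond; apply: eq_bigr => v _; rewrite ger0_norm // mxE.
  by case: ifP; rewrite ?mulr0.
have zn0 : z != 0.
  apply/eqP => ze; move: Gm; rewrite -mz ze /mass big1 => [|v _]; first by lra.
  by rewrite mxE normr0 powRr1 // mulr0.
have S0 := slope_ge0.
have ez : energy E 1 z <= 61 * k%:R * slope.
  apply: (@le_trans _ _ (slope + 60 * k%:R * slope)); last first.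
    have := ler_wpM2r S0 kR1; lra.
  apply: le_trans (lerD (lexx slope) Psep); rewrite energy1 /slope -esumD.
  apply: ler_esum => u v _.
  have Nu := nrm2_ge0 (F u); have Nv := nrm2_ge0 (F v).
  have h1 : `|N u ^+ 2 - N v ^+ 2| <= Num.sqrt (dist2 (F u) (F v)) * (N u + N v).
    rewrite subr_sqr normrM (ger0_norm (addr_ge0 Nu Nv)) ler_wpM2r ?addr_ge0 //.
    rewrite -(@ler_pXn2r _ 2) ?nnegrE ?sqrtr_ge0 ?normr_ge0 // real_normK ?num_real //.
    by rewrite (sqr_sqrtr (dist2_ge0 _ _)); exact: nrm2_dist.
  (* For edges leaving G: the jump a^2 is the variation of N^2 plus at most the weight of a
     separated edge. *)
  have h2 (a b : R) : 0 <= a -> 0 <= b -> `|a ^+ 2| <= `|a ^+ 2 - b ^+ 2| + a * b.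
    move=> a0 b0; rewrite ger0_norm ?sqr_ge0 //.
    have [ab|/ltW ba] := leP a b.
      have : a * a <= a * b by rewrite ler_wpM2l.
      rewrite expr2; have := normr_ge0 (a * a - b ^+ 2); lra.
    have : b * b <= a * b by rewrite ler_wpM2r.
    rewrite !expr2; have := ler_norm (a * a - b * b); lra.
  rewrite !mxE; case: (boolP (P u \in G)) => uG; case: (boolP (P v \in G)) => vG.
  - by apply: le_trans h1 _; rewrite lerDl !mulr_ge0.
  - have -> : (P u != P v) by apply: contraNneq vG => <-.
    by rewrite subr0 mul1r; apply: le_trans (h2 _ _ Nu Nv) _; rewrite lerD2r.
  - have -> : (P u != P v) by apply: contraNneq uG => ->.
    rewrite sub0r normrN mul1r; apply: le_trans (h2 _ _ Nv Nu) _.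
    by rewrite distrC [N v * _]mulrC lerD2r.
  - by rewrite subrr normr0 addr_ge0 // !mulr_ge0 ?sqrtr_ge0 ?addr_ge0.
have [|A [A0 Az Ar]] := @coarea R n E Esym Eirr deg_gt0 z (122 * k%:R * slope) zn0 z0 _.
  apply: le_trans ez _; rewrite mz.
  have c0 : 0 <= 122 * k%:R * slope by rewrite !mulr_ge0.
  have := ler_wpM2l c0 Gm; lra.
by exists A; split=> // v /Az; rewrite mxE; case: ifP => //; rewrite ltxx.
Qed.

Lemma higher_cheeger : (k <= n)%N -> cheeger R E k ^+ 2 <= 2 * 122 ^+ 2 * k%:R ^+ 4 * lam.
Proof.
move=> kn; have [P [Pd Psep]] := spec_partition.
pose a t := \sum_(v | P v == t) (deg E v)%:R * N v ^+ 2.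
have aB t : a t <= 4 * k%:R / (4 * k%:R - 1) by exact: spec_part_mass.
have k1 : 1 <= k%:R :> R by exact: kR1.
have kp : 0 < k%:R :> R by lra.
have k4 : 0 < 4 * k%:R - 1 :> R by lra.
have aS (G : {set 'I_n.+1}) :
    \sum_(t in G) a t = \sum_(v | P v \in G) (deg E v)%:R * N v ^+ 2.
  rewrite (partition_big P (mem G)) //=; apply: eq_bigr => t tG.
  by apply: eq_bigl => v; case: eqP => [->|]; rewrite ?tG ?andbF.
(* With B = 1 + 1/(4k - 1), (k - 1) B exceeds k - 1 by at most 1/4, so (k - 1) B + 1/2 is below the
   total mass k. *)
have [||G [G1 _ G3]] := @half_blocks R _ a _ aB _ k [set: 'I_n.+1]%SET k0.
- by rewrite ler_pdivlMr //; lra.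
- rewrite aS (eq_bigl predT) => [|v]; last by rewrite inE.
  rewrite spec_mass -subn1 natrB // mulrA -lerBrDr ler_pdivrMr //; lra.
have Hc (i : 'I_k) : exists A : {set 'I_n}, [/\ A != finset.set0,
    forall v, v \in A -> P v \in G i & cratio R E A <= 122 * k%:R * slope].
  by apply: spec_cut => //; rewrite -aS; exact: G1.
have [A HA] := boolp.choice Hc.
have M0 : 0 <= 122 * k%:R * slope by rewrite !mulr_ge0 ?slope_ge0.
have hM : cheeger R E k <= 122 * k%:R * slope.
  apply: (@cheeger_le _ _ _ _ A) => //; last by move=> i; case: (HA i).
  split=> [i|i j ij]; first by case: (HA i).
  apply/setP => v; rewrite finset.in_set0; apply/negP; rewrite finset.in_setI => /andP[vi vj].
  have [_ /(_ v vi) h1 _] := HA i; have [_ /(_ v vj) h2 _] := HA j.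
  by have /setP/(_ (P v)) := G3 i j (ltn_ord i) (ltn_ord j) ij; rewrite !inE h1 h2.
have h0 := cheeger_ge0 R E kn.
apply: (@le_trans _ _ ((122 * k%:R * slope) ^+ 2)).
  by rewrite lerXn2r ?nnegrE.
rewrite exprMn; apply: le_trans (ler_wpM2l (sqr_ge0 _) slope_sqr) _.
rewrite le_eqVlt; apply/orP; left; apply/eqP; ring.
Qed.

End HigherCheeger.

(** * Comparison of the constants *)

Section Indices.
Variables (R : realType) (n : nat).

(** Bounds common to the three indices are proved once from these properties; the comparison with
    [genus_plus] makes the sphere admissible. *)
Definition index_like (ind : set 'rV[R]_n -> nat) : Prop :=
  [/\ forall S, (0 < ind S)%N -> S !=set0 /\ centrally_symmetric S,
      forall S S' f, good S -> good S' -> odd_map S S' f -> (ind S <= ind S')%N &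
      forall S, good S -> (genus_plus S <= ind S)%N].

Lemma index_like_minus : index_like (@genus_minus R n).
Proof.
split=> [S|S S' f gS gS' of_|S gS]; first exact: index_or0_gt0.
  exact: genus_minus_mono of_.
exact: leq_trans (plus_le_yang gS) (yang_le_minus gS).
Qed.

Lemma index_like_yang : index_like (@yang R n).
Proof.
split=> [S|S S' f gS gS' of_|S gS]; first exact: index_or0_gt0.
  exact: yang_mono of_.
exact: plus_le_yang.
Qed.

Lemma index_like_plus : index_like (@genus_plus R n).
Proof.
split=> [S|S S' f gS gS' of_|S gS //]; first exact: index_or0_gt0.
exact: genus_plus_mono of_.
Qed.

End Indices.

Section Comparison.
Variables (R : realType) (n : nat) (E : rel 'I_n).
Notation Rn := 'rV[R]_n.
Hypotheses (Esym : symmetric E) (Eirr : irreflexive E).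
Hypothesis deg_gt0 : forall i, (1 <= deg E i)%N.
Variable k : nat.
Hypotheses (k1 : (1 <= k)%N) (kn : (k <= n)%N).

Lemma powR2B1 (p : R) : 2 `^ (p - 1) = 2 `^ p / 2.
Proof. by rewrite powRB ?powRr1 // pnatr_eq0 implybT. Qed.

(** Covers the default value 0 of [max_nodal]. *)
Lemma cheeger0 : cheeger R E 0 = 0.
Proof.
apply/eqP; rewrite eq_le cheeger_ge0 // andbT.
apply: (@cheeger_le _ _ _ _ (fun=> finset.set0)) => //; first by split=> -[].
by case.
Qed.

Lemma max_nodalP ind (p : R) :
  (max_nodal E ind p k = 0%N \/ exists q lam x, [/\ 1 <= q <= p,
      eigenpair E q lam x, lam <= minmax E ind q k &
      nodal_domains E x = max_nodal E ind p k]) /\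
  forall q lam x, 1 <= q <= p -> eigenpair E q lam x -> lam <= minmax E ind q k ->
    (nodal_domains E x <= max_nodal E ind p k)%N.
Proof.
rewrite /max_nodal; set P := (X in nat_max X).
have PI q lam x : 1 <= q <= p -> eigenpair E q lam x -> lam <= minmax E ind q k ->
    P (nodal_domains E x).
  by move=> qp ex le_; exists x => //; exists q => //; exists lam.
have Pn j : P j -> (j <= n)%N by move=> [x _ <-]; exact: nodal_le.
have [Pne|Pe] := pselect (P !=set0).
  have [[x [q qp [lam ex le_]] <-] mx] := nat_maxP Pne Pn.
  split=> [|q' lam' x' qp' ex' le']; last exact/mx/(PI q' lam').
  by right; exists q, lam, x.
split=> [|q' lam' x' qp' ex' le']; last first.
  by case: Pe; exists (nodal_domains E x'); exact: PI ex' le'.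
by left; apply: xgetPN => j [Pj _]; apply: Pe; exists j.
Qed.

Lemma max_nodal_le ind (p : R) : (max_nodal E ind p k <= n)%N.
Proof.
by have [[->|[q [lam [x [_ _ _ <-]]]]] _] := max_nodalP ind p; rewrite ?nodal_le.
Qed.

Lemma max_nodal_mono ind1 ind2 (p : R) :
  (forall q : R, 1 <= q -> minmax E ind1 q k <= minmax E ind2 q k) ->
  (max_nodal E ind1 p k <= max_nodal E ind2 p k)%N.
Proof.
move=> H; have [[->//|[q [lam [x [/andP[q1 qp] ex le_ <-]]]]] _] := max_nodalP ind1 p.
have [_] := max_nodalP ind2 p; apply; [|exact: ex|exact: le_trans le_ (H q q1)].
by rewrite q1.
Qed.

(* Disjoint sets A j span a (k-1)-sphere of functions that are constant on each
   of them. *)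
Lemma hat_cheeger_plus_le : hat_cheeger E (@genus_plus R n) k <= cheeger R E k.
Proof.
have [i0 iM iP] := index_like_plus R n.
rewrite (hat_cheegerE Esym Eirr deg_gt0 i0 iM iP k1 kn).
apply: cheeger_ge => // A [A0 Ad]; set M := \big[Num.max/0]_(i < k) _.
have AM j : cratio R E (A j) <= M by apply: (@le_bigmax _ R _ 0 (fun i => cratio R E (A i))).
pose u j : {set 'I_n} * {set 'I_n} := (A j, finset.set0).
have uP j : u j \in P2 n.
  by rewrite inE /= finset.setI0 eqxx /= finset.setU0 A0.
have vj j i : vertex R (u j) ord0 i = (i \in A j)%:R.
  by rewrite mxE /= finset.in_set0 subr0.
pose x (y : 'rV[R]_k) : Rn := \row_i \sum_j y ord0 j * (i \in A j)%:R.
have uniqA i j j' : i \in A j -> i \in A j' -> j = j'.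
  move=> ij ij'; apply/eqP; apply: contraT => /Ad /setP/(_ i).
  by rewrite finset.in_setI ij ij' finset.in_set0.
have xA y i j : i \in A j -> x y ord0 i = y ord0 j.
  move=> ij; rewrite mxE (bigD1 j) //= ij mulr1 big1 ?addr0 // => j' j'j.
  have /negbTE -> : i \notin A j' by apply: contra j'j => /(uniqA _ _ _ ij) ->.
  by rewrite mulr0.
have xN y : x (- y) = - x y.
  apply/rowP => i; rewrite !mxE -sumrN; apply: eq_bigr => j _.
  by rewrite mxE mulNr.
have x0 y : sphere (k := k) y -> x y != 0.
  move=> Sy; have y0 : y != 0 by apply/eqP => y0; apply: (@sphere_n0 R k); rewrite -y0.
  have [j yj _] := first_nonzero y0; have /set0Pn[i ij] := A0 j.
  by apply: contra_neq yj => xe; rewrite -(xA y i j ij) xe mxE.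
have xc : continuous x.
  apply: rV_continuous => i.
  have -> : (fun y => x y ord0 i) = (fun y : 'rV[R]_k => \sum_j y ord0 j * (i \in A j)%:R).
    by apply/funext => y; rewrite mxE.
  apply: continuous_rsum => j _ y; apply: (@cvgM _ _ (nbhs y)); last exact: cvg_cst.
  exact: coord_continuous.
have nS : ~ (x @` @sphere R k) 0 by move=> [y /x0 + xe]; rewrite xe eqxx.
have sS : centrally_symmetric (x @` @sphere R k).
  by move=> _ [y Sy <-]; exists (- y); [exact: sphere_sym|exact: xN].
have gS : good (x @` @sphere R k).
  by split=> //; have [y Sy] := @sphere_neq0 R k k1; exists (x y), y.
have aS : adm (@genus_plus R n) k (x @` @sphere R k).
  split=> //; first by apply: continuous_compact;
    [exact: continuous_subspaceT|exact: compact_sphere].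
  apply: (genus_plus_ge gS (f := x)) => //.
  by split=> [|y Sy|y _]; [exact: continuous_subspaceT|exists y|exact: xN].
apply: (minmax_le Esym Eirr i0 k1 (lexx 1) aS) => _ [y Sy <-].
rewrite RayleighE ler_pdivrMr ?mass_gt0 ?oner_eq0 ?x0 //.
(* The sets A j are disjoint, so masses add up exactly, while subadditivity is enough for the
   energies. *)
have mE : mass E 1 (x y) = \sum_j `|y ord0 j| * mass E 1 (vertex R (u j)).
  rewrite mass1; under [RHS]eq_bigr do rewrite mass1 mulr_sumr.
  rewrite exchange_big /=; apply: eq_bigr => i _.
  under [RHS]eq_bigr do rewrite vj normr_nat mulrCA.
  rewrite -mulr_sumr; congr (_ * _).
  have [/existsP[j ij]|/existsPn Hn] := boolP [exists j, i \in A j].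
    rewrite (xA y i j ij) (bigD1 j) //= ij mulr1 big1 ?addr0 // => j' j'j.
    have /negbTE -> : i \notin A j' by apply: contra j'j => /(uniqA _ _ _ ij) ->.
    by rewrite mulr0.
  rewrite mxE !big1 ?normr0 // => j _; by rewrite (negbTE (Hn j)) mulr0.
have eE : energy E 1 (x y) <= \sum_j `|y ord0 j| * energy E 1 (vertex R (u j)).
  rewrite energy1; under [leRHS]eq_bigr do rewrite energy1 -esumZ esum_pair.
  rewrite esum_pair exchange_big /=; apply: ler_sum => -[i i'] _ /=.
  rewrite !mxE -sumrB; apply: le_trans (ler_norm_sum _ _ _) _; apply: ler_sum => j _.
  by rewrite -mulrBr normrM !vj.
apply: le_trans eE _; rewrite mE mulr_sumr; apply: ler_sum => j _.
rewrite mulrCA ler_wpM2l // energy_vertex // mass_vertex // /usupp /= finset.setU0.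
have -> : Defs.cut E finset.set0 = 0%N.
  by apply: eq_card0 => e; rewrite !inE andbF.
rewrite addn0; have V0 : (0 < vol E (A j))%N.
  by have := vol_gt0 deg_gt0 (uP j); rewrite /usupp /= finset.setU0.
by have := AM j; rewrite /cratio ler_pdivrMr ?ltr0n.
Qed.

Section Index.
Variable ind : set Rn -> nat.
Hypothesis indL : index_like ind.
Variable p : R.
Hypothesis p1 : 1 <= p.
Let lam := minmax E ind p k.
Let hh := hat_cheeger E ind k.

Let p0 : 0 < p. Proof. exact: lt_le_trans p1. Qed.

Lemma minmax_hat_upper : lam <= 2 `^ (p - 1) * hh.
Proof.
have [i0 iM iP] := indL.
have := minmax_upper Esym Eirr i0 iM iP k1 kn p1 (lexx 1).
by rewrite mulr1 -(hat_cheegerE Esym Eirr deg_gt0 i0 iM iP k1 kn).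
Qed.

Lemma hat_cheeger_ge0 : 0 <= hh.
Proof.
have [i0 iM iP] := indL; rewrite /hh (hat_cheegerE Esym Eirr deg_gt0 i0 iM iP k1 kn).
by apply: minmax_ge0.
Qed.

Lemma minmax_hat_lower : 2 `^ (p - 1) / p `^ p * hh `^ p <= lam.
Proof.
have [i0 iM iP] := indL.
have := minmax_lower Esym Eirr deg_gt0 i0 iM iP k1 kn p1 (lexx 1).
rewrite mulr1 -(hat_cheegerE Esym Eirr deg_gt0 i0 iM iP k1 kn) => /(le_trans _); apply.
rewrite (powRM p (ler0n R 2) hat_cheeger_ge0) powR2B1 invfM.
rewrite le_eqVlt; apply/orP; left; apply/eqP; ring.
Qed.

(** An eigenvector with the maximal number of domains belongs to some q <= p. Its domains give the
    constant (q/2)^p, the signed power p/q leading from q to p costs (p/q)^p, and q cancels. *)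
Lemma minmax_nodal_lower :
  2 `^ (p - 1) / p `^ p * cheeger R E (max_nodal E ind p k) `^ p <= lam.
Proof.
have [i0 iM iP] := indL.
have [[->|[q [mu [x [/andP[q1 qp] ex le_ <-]]]]] _] := max_nodalP ind p.
  rewrite cheeger0 powR0 ?gt_eqF // mulr0; exact: minmax_ge0.
have q0 : 0 < q by exact: lt_le_trans q1.
have L0 : 0 <= minmax E ind q k by exact: minmax_ge0.
have L20 : 0 <= 2 * minmax E ind q k by rewrite mulr_ge0.
have r1 : 1 <= p / q by rewrite ler_pdivlMr // mul1r.
have rq : p / q * q = p by rewrite divfK // gt_eqF.
have := minmax_lower Esym Eirr deg_gt0 i0 iM iP k1 kn r1 q1; rewrite rq => low.
have h0 : 0 <= cheeger R E (nodal_domains E x) by exact/cheeger_ge0/nodal_le.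
have up := nodal_cheeger Esym Eirr deg_gt0 q1 L0 ex le_.
have q20 : 0 <= q / 2 by rewrite divr_ge0 // ltW.
have hp : cheeger R E (nodal_domains E x) `^ p <=
    (q / 2) `^ p * (2 * minmax E ind q k) `^ (p / q).
  rewrite [p / q]mulrC powRrM -(powRM p q20 (powR_ge0 _ _)).
  by apply: ge0_ler_powR; rewrite ?(ltW p0) // nnegrE mulr_ge0 ?powR_ge0.
have rp0 : 0 < (p / q) `^ p by rewrite powR_gt0 // divr_gt0.
have low' : (2 * minmax E ind q k) `^ (p / q) <= 2 * (p / q) `^ p * lam.
  by rewrite [leRHS]mulrC -ler_pdivrMr // mulr_gt0.
have b0 : 0 <= 2 `^ (p - 1) / p `^ p by rewrite divr_ge0 ?powR_ge0.
apply: le_trans (ler_wpM2l b0 hp) _.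
apply: le_trans (ler_wpM2l b0 (ler_wpM2l (powR_ge0 _ _) low')) _.
have e : (q / 2) `^ p * (p / q) `^ p = p `^ p * (2 `^ p)^-1.
  rewrite -(powRM p q20 (ltW (lt_le_trans ltr01 r1))).
  have -> : q / 2 * (p / q) = p * 2^-1 by field; rewrite gt_eqF.
  have h20 : 0 <= 2^-1 :> R by rewrite invr_ge0.
  by rewrite (powRM p (ltW p0) h20) -(powR_inv1 (ler0n R 2)) -powRrM mulN1r powRN.
have P0 : 0 < p `^ p by rewrite powR_gt0.
have T0 : 0 < 2 `^ p :> R by rewrite powR_gt0.
rewrite le_eqVlt; apply/orP; left; apply/eqP.
transitivity (2 `^ (p - 1) / p `^ p * 2 * ((q / 2) `^ p * (p / q) `^ p) * lam).
  by ring.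
rewrite e powR2B1; by field; rewrite !gt_eqF.
Qed.

End Index.

Lemma minmax2_lower : cheeger R E k ^+ 2 <=
  2 * 122 ^+ 2 * k%:R ^+ 4 * minmax E (@genus_minus R n) 2 k.
Proof.
have kk : (1 <= k <= n)%N by rewrite k1.
have [f [fo fl]] := spectral_frame R Esym Eirr deg_gt0 kk.
exact: higher_cheeger fo fl kn.
Qed.

Let k0 : 0 < k%:R :> R. Proof. by rewrite ltr0n. Qed.

(** The signed power 2/p leads from p to 2 at the cost 2^(2-p) <= 2. *)
Lemma minmax_lower_small (p : R) : 1 <= p -> p <= 2 ->
  cheeger R E k ^+ 2 / (4 * 122 ^+ 2 * k%:R ^+ 4) <= minmax E (@genus_minus R n) p k.
Proof.
move=> p1 p2; have [i0 iM iP] := index_like_minus R n.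
have p0 : 0 < p by exact: lt_le_trans p1.
have r1 : 1 <= 2 / p by rewrite ler_pdivlMr // mul1r.
have := minmax_upper Esym Eirr i0 iM iP k1 kn r1 p1.
rewrite divfK ?gt_eqF // => up.
have l0 := minmax_ge0 Esym Eirr i0 iP k1 kn p1.
have e2 : 2 `^ (2 - p) <= 2 :> R.
  rewrite -[leRHS](@powRr1 R 2) //; apply: ler_powR; lra.
have up2 : minmax E genus_minus 2 k <= 2 * minmax E (@genus_minus R n) p k.
  by apply: le_trans up _; exact: ler_wpM2r.
rewrite ler_pdivrMr; last by rewrite !mulr_gt0 ?exprn_gt0.
apply: le_trans minmax2_lower _.
have c0 : 0 <= 2 * 122 ^+ 2 * k%:R ^+ 4 :> R by rewrite !mulr_ge0 ?exprn_ge0.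
apply: le_trans (ler_wpM2l c0 up2) _.
rewrite le_eqVlt; apply/orP; left; apply/eqP; ring.
Qed.

(** The signed power p/2 leads from 2 to p, and the inequality for the exponent 2 is raised to the
    power p/2. *)
Lemma minmax_lower_large (p : R) : 2 <= p ->
  cheeger R E k `^ p / (2 * (p / 2) `^ p * 122 `^ p * k%:R `^ (2 * p)) <=
  minmax E (@genus_minus R n) p k.
Proof.
move=> p2; have [i0 iM iP] := index_like_minus R n.
have p0 : 0 < p by lra.
have r1 : 1 <= p / 2 by lra.
have two1 : 1 <= 2 :> R by rewrite ler1n.
have := minmax_lower Esym Eirr deg_gt0 i0 iM iP k1 kn r1 two1.
rewrite divfK // => low.
have l0 := minmax_ge0 Esym Eirr i0 iP k1 kn two1.
have h0 : 0 <= cheeger R E k by exact: cheeger_ge0.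
have sq (t : R) : 0 <= t -> (t ^+ 2) `^ (p / 2) = t `^ p.
  move=> t0; rewrite -(powR_mulrn 2 t0) -powRrM; congr (_ `^ _).
  by rewrite mulrC divfK.
have hp : cheeger R E k `^ p <=
    122 `^ p * k%:R `^ (2 * p) * (2 * minmax E (@genus_minus R n) 2 k) `^ (p / 2).
  rewrite -(sq _ h0).
  have -> : 122 `^ p * k%:R `^ (2 * p) * (2 * minmax E (@genus_minus R n) 2 k) `^ (p / 2) =
      ((122 * k%:R ^+ 2) ^+ 2 * (2 * minmax E (@genus_minus R n) 2 k)) `^ (p / 2).
    have c1 : 0 <= 122 * k%:R ^+ 2 :> R by rewrite mulr_ge0 ?exprn_ge0.
    have c2 : 0 <= 2 * minmax E (@genus_minus R n) 2 k by rewrite mulr_ge0.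
    rewrite [RHS](powRM _ (sqr_ge0 _) c2) (sq _ c1).
    rewrite (powRM _ (ler0n R 122) (exprn_ge0 2 (ltW k0))).
    by rewrite -(powR_mulrn 2 (ltW k0)) -[in RHS]powRrM.
  apply: ge0_ler_powR; rewrite ?nnegrE ?sqr_ge0 ?divr_ge0 ?(ltW p0) //.
    by rewrite !mulr_ge0 ?sqr_ge0.
  apply: le_trans minmax2_lower _.
  rewrite le_eqVlt; apply/orP; left; apply/eqP; ring.
have c0 : 0 < 122 `^ p * k%:R `^ (2 * p) :> R by rewrite mulr_gt0 ?powR_gt0.
have d0 : 0 < 2 * (p / 2) `^ p by rewrite mulr_gt0 ?powR_gt0 ?divr_gt0.
rewrite -mulrA; move: c0 d0 low hp; set c := 122 `^ p * _; set d := 2 * _.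
set h := cheeger R E k `^ p; set m := (2 * _) `^ _ => c0 d0 low hp.
have dc0 : 0 < d * c by exact: mulr_gt0.
rewrite (ler_pdivrMr _ _ dc0); apply: (le_trans hp).
rewrite [d * c]mulrC mulrCA ler_wpM2l ?(ltW c0) //.
by rewrite -ler_pdivrMr.
Qed.

End Comparison.

Theorem theorem1p4 (R : realType) :
  exists C : R, 0 < C /\
  exists Cp : R -> R, (forall p : R, 2 <= p -> 0 < Cp p) /\
  forall (n : nat) (E : rel 'I_n),
    symmetric E -> irreflexive E -> (forall i, (1 <= deg E i)%N) ->
  forall (p : R) (k : nat), 1 <= p -> (1 <= k <= n)%N ->
  let h := cheeger R E in
  let hh := hat_cheeger E yang k in
  let hh_m := hat_cheeger E genus_minus k in
  let hh_p := hat_cheeger E genus_plus k in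
  let lam := minmax E yang p k in
  let lam_m := minmax E genus_minus p k in
  let lam_p := minmax E genus_plus p k in
  let s := max_nodal E yang p k in
  let s_m := max_nodal E genus_minus p k in
  let s_p := max_nodal E genus_plus p k in
  let a := 2 `^ (p - 1) in
  let b := 2 `^ (p - 1) / p `^ p in
  (* (i) *)
  (a * hh_m <= a * hh /\ a * hh <= a * hh_p /\ a * hh_p <= a * h k) /\
  (* (ii) *)
  (lam_m <= lam /\ lam <= lam_p) /\
  (* (iii) *)
  (lam_m <= a * hh_m /\ lam <= a * hh /\ lam_p <= a * hh_p) /\
  (* (iv) *)
  (b * hh_m `^ p <= lam_m /\ b * hh `^ p <= lam /\ b * hh_p `^ p <= lam_p /\
   b * hh_m `^ p <= b * hh `^ p /\ b * hh `^ p <= b * hh_p `^ p) /\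
  (* (v) *)
  (b * h s_m `^ p <= lam_m /\ b * h s `^ p <= lam /\
   b * h s_p `^ p <= lam_p /\
   b * h s_m `^ p <= b * h s `^ p /\ b * h s `^ p <= b * h s_p `^ p) /\
  (* (vi) *)
  ((p <= 2 -> h k ^+ 2 / (C * k%:R ^+ 4) <= lam_m) /\
   (2 <= p -> h k `^ p / (Cp p * k%:R `^ (2 * p)) <= lam_m)).
Proof.
exists (4 * 122 ^+ 2); split; first by rewrite mulr_gt0 ?exprn_gt0.
exists (fun p => 2 * (p / 2) `^ p * 122 `^ p); split=> [p p2|].
  have p0 : 0 < p by exact: lt_le_trans p2.
  by rewrite !mulr_gt0 ?powR_gt0 ?divr_gt0.
move=> n E Esym Eirr dg p k p1 kk h hh hh_m hh_p lam lam_m lam_p s s_m s_p a b.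
have /andP[k1 kn] := kk; have p0 : 0 < p by exact: lt_le_trans p1.
have LM := index_like_minus R n; have LY := index_like_yang R n.
have LP := index_like_plus R n.
have [[m0 mM mP] [y0 yM yP] [q0 qM qP]] := And3 LM LY LP.
have a0 : 0 < a by rewrite powR_gt0.
have b0 : 0 <= b by rewrite divr_ge0 ?powR_ge0.
have anti_my (q : R) : 1 <= q -> minmax E genus_minus q k <= minmax E (@yang R n) q k.
  by move=> q1; apply: minmax_anti => // S gS; exact: yang_le_minus.
have anti_yp (q : R) : 1 <= q -> minmax E yang q k <= minmax E (@genus_plus R n) q k.
  by move=> q1; apply: minmax_anti => // S gS; exact: plus_le_yang.
have hh_my : hh_m <= hh.
  rewrite /hh_m /hh (hat_cheegerE Esym Eirr dg m0 mM mP k1 kn).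
  rewrite (hat_cheegerE Esym Eirr dg y0 yM yP k1 kn); exact: anti_my.
have hh_yp : hh <= hh_p.
  rewrite /hh_p /hh (hat_cheegerE Esym Eirr dg q0 qM qP k1 kn).
  rewrite (hat_cheegerE Esym Eirr dg y0 yM yP k1 kn); exact: anti_yp.
have hm0 : 0 <= hh_m by exact: (hat_cheeger_ge0 Esym Eirr dg k1 kn LM).
have b_mono (x y : R) : 0 <= x -> x <= y -> b * x `^ p <= b * y `^ p.
  move=> x0 xy; rewrite ler_wpM2l //; apply: ge0_ler_powR; rewrite ?(ltW p0) ?nnegrE //.
  exact: le_trans xy.
have hs_mono (i j : nat) : (i <= j)%N -> (j <= n)%N -> b * h i `^ p <= b * h j `^ p.
  move=> ij jn; apply: b_mono; last exact: cheeger_mono.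
  by apply: cheeger_ge0; exact: leq_trans jn.
split; first split; [|split|].
- by rewrite ler_pM2l.
- by rewrite ler_pM2l.
- by rewrite ler_pM2l //; exact: hat_cheeger_plus_le.
split; first by split; [exact: anti_my|exact: anti_yp].
split.
  by split; [exact: (minmax_hat_upper Esym Eirr dg k1 kn LM p1)|split;
    [exact: (minmax_hat_upper Esym Eirr dg k1 kn LY p1)|exact: (minmax_hat_upper Esym Eirr dg k1 kn LP p1)]].
split.
  split; first exact: (minmax_hat_lower Esym Eirr dg k1 kn LM p1).
  split; first exact: (minmax_hat_lower Esym Eirr dg k1 kn LY p1).
  split; first exact: (minmax_hat_lower Esym Eirr dg k1 kn LP p1).
  by split; apply: b_mono => //; exact: le_trans hh_my.
split.
  split; first exact: (minmax_nodal_lower Esym Eirr dg k1 kn LM p1).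
  split; first exact: (minmax_nodal_lower Esym Eirr dg k1 kn LY p1).
  split; first exact: (minmax_nodal_lower Esym Eirr dg k1 kn LP p1).
  by split; apply: hs_mono; rewrite ?max_nodal_le //; exact: max_nodal_mono.
by split=> p2; [exact: minmax_lower_small|exact: minmax_lower_large].
Qed.
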